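(* Fix $(x,t)\in\mathbb{R}^2$. The functional $\mathcal E[\cdot](x,t)$ has a unique minimizer $\rho^{\min}=\rho^{\min}(\cdot;x,t)$ in $\mathcal A$ (up to null sets). Moreover, an element $\rho\in\mathcal A$ equals $\rho^{\min}$ if and only if, writing $\Phi(\kappa):=V(\kappa;x,t)+\mathcal L[\rho](\zeta(\kappa))$, one has for a.e. $\kappa\in[0,\kappa_{\max}]$: $\rho(\kappa)=0$ whenever $\Phi(\kappa)>0$ (voids); $\rho(\kappa)=\rho^{\mathrm{Wyl}}(\kappa)$ whenever $\Phi(\kappa)<0$ (saturations); and (automatically) $0\le\rho(\kappa)\le\rho^{\mathrm{Wyl}}(\kappa)$ where $\Phi(\kappa)=0$ (bands).
   Context: Fix $\delta>0$ and an admissible $u_0$ ($C^1$, positive, $\to0$ at $\pm\infty$, $\int(x^2+1)u_0<\infty$, $u_0'$ vanishing only at $x_{\max}$ where the maximum $u_{\max}$ is attained) with $\int\sqrt{u_0}<\infty$. Lambert $W$: standard branches $W_n$ of the inverse of $w\mapsto we^w$; for real $a\in[-e^{-1},0)$, $W_0(a)\in[-1,0)$, $W_{-1}(a)\le-1$; for real $a<-e^{-1}$, $W_0(a)$ is the solution with $0<\operatorname{Im}w<\pi$, $W_{-1}(a):=\overline{W_0(a)}$. $\zeta(\kappa):=\kappa\cot(2\delta\kappa)+i\kappa$, $\zeta(0):=1/(2\delta)$; $E(\zeta):=-\zeta+\frac1{2\delta}(1+\operatorname{Log}(2\delta\zeta))$; $\kappa_{\max}:=\operatorname{Im}[-\frac1{2\delta}W_{-1}(-e^{2\delta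 u_{\max}-1})]$; for $\kappa\in(0,\kappa_{\max}]$, $x_-(\kappa)\le x_{\max}\le x_+(\kappa)$ solve $u_0(x)=E(\zeta(\kappa))$, $x_\pm(0)=\pm\infty$; $a(\kappa,u):=-2\delta\zeta(\kappa)e^{-2\delta(\zeta(\kappa)+u)}$. $R^{\mathrm{Wyl}}(\kappa):=\frac1{4\delta}\int_{x_-(\kappa)}^{x_+(\kappa)}[W_0-W_{-1}](a(\kappa,u_0(x)))dx$; $\rho^{\mathrm{Wyl}}:=-\frac{d}{d\kappa}R^{\mathrm{Wyl}}$. $\theta_+(\kappa):=\kappa x_+(\kappa)+\int_{x_+(\kappa)}^\infty\operatorname{Im}[\zeta(\kappa)+\frac1{2\delta}W_{-1}(a(\kappa,u_0(x)))]dx$. $V(\kappa;x,t):=x\kappa+t\operatorname{Im}[(\zeta(\kappa)-\frac1{2\delta})^2]-\theta_+(\kappa)$; $\mathcal A$: real measurable $\rho$ on $[0,\kappa_{\max}]$ with $0\le\rho\le\rho^{\mathrm{Wyl}}$ a.e.; $\mathcal L[\rho](\lambda):=\frac1\pi\int_0^{\kappa_{\max}}\log\big|\frac{\lambda-\overline{\zeta(\eta)}}{\lambda-\zeta(\eta)}\big|\rho(\eta)d\eta$; $\mathcal E[\rho](x,t):=\int_0^{\kappa_{\max}}(V(\kappa;x,t)+\frac12\mathcal L[\rho](\zeta(\kappa)))\rho(\kappa)d\kappa$. The function $\Phi$ is the Fréchet derivative of $\mathcal E[\cdot](x,t)$ at $\rho$. *)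

(* Defs.v *)
From HB Require Import structures.
From mathcomp Require Import all_boot all_order all_algebra.
From mathcomp Require Import all_classical all_reals all_analysis.
From mathcomp Require Import complex.
Set Implicit Arguments. Unset Strict Implicit. Unset Printing Implicit Defensive.
Import Order.TTheory GRing.Theory Num.Theory.
Import numFieldNormedType.Exports.
Local Open Scope classical_set_scope.
Local Open Scope ring_scope.
Local Open Scope complex_scope.

Section Defs.
Variable R : realType.

Notation leb := (@lebesgue_measure R).

Definition cabs (z : R[i]) : R := Num.sqrt (complex.Re z ^+ 2 + complex.Im z ^+ 2).
Definition cconj (z : R[i]) : R[i] := complex.Re z -i* complex.Im z.
Definition cexp (z : R[i]) : R[i] :=
  (expR (complex.Re z) * cos (complex.Im z)) +i* (expR (complex.Re z) * sin (complex.Im z)).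
Definition cArg (z : R[i]) : R :=
  xget 0 (fun th : R => - pi < th <= pi /\
        z = (cabs z * cos th) +i* (cabs z * sin th)).
Definition cLog (z : R[i]) : R[i] := ln (cabs z) +i* cArg z.

Definition LambertW0 (a : R[i]) : R[i] :=
  xget 0 (fun w : R[i] => w * cexp w = a /\ complex.Im a = 0 /\
    ((- expR (-1) <= complex.Re a < 0 /\ complex.Im w = 0 /\ -1 <= complex.Re w < 0)
     \/ (complex.Re a < - expR (-1) /\ 0 < complex.Im w < pi))).
Definition LambertWm1 (a : R[i]) : R[i] :=
  if complex.Re a < - expR (-1) then cconj (LambertW0 a)
  else xget 0 (fun w : R[i] => w * cexp w = a /\ complex.Im a = 0 /\
    - expR (-1) <= complex.Re a < 0 /\ complex.Im w = 0 /\ complex.Re w <= -1).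

Definition cot (x : R) : R := cos x / sin x.

Definition zeta (d k : R) : R[i] :=
  if k == 0 then (1 / (2 * d))%:C else (k * cot (2 * d * k)) +i* k.

Definition Efn (d : R) (z : R[i]) : R[i] :=
  - z + (1 / (2 * d))%:C * (1 + cLog ((2 * d)%:C * z)).

Definition kappa_max (d umax : R) : R :=
  complex.Im (- (1 / (2 * d))%:C * LambertWm1 (- expR (2 * d * umax - 1))%:C).

(* x_-(k) <= xmax <= x_+(k) solving u0(x) = E(zeta(k)), for k in (0, kappa_max] *)
Definition xplus (d : R) (u0 : R -> R) (xmax k : R) : R :=
  xget 0 (fun x : R => xmax <= x /\ (u0 x)%:C = Efn d (zeta d k)).
Definition xminus (d : R) (u0 : R -> R) (xmax k : R) : R :=
  xget 0 (fun x : R => x <= xmax /\ (u0 x)%:C = Efn d (zeta d k)).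

Definition aW (d k u : R) : R[i] :=
  - (2 * d)%:C * zeta d k * cexp (- (2 * d)%:C * (zeta d k + u%:C)).

(* integration domain [x_-(k), x_+(k)], with x_{+-}(0) = +-oo *)
Definition xdom (d : R) (u0 : R -> R) (xmax k : R) : set R :=
  if k == 0 then setT else `[xminus d u0 xmax k, xplus d u0 xmax k]%classic.

(* the integrand [W_0 - W_{-1}](a) is real on the integration domain
   (there a is in [-1/e, 0)); we integrate its real part *)
Definition RWyl (d : R) (u0 : R -> R) (xmax k : R) : R :=
  1 / (4 * d) * Rintegral leb (xdom d u0 xmax k)
    (fun x => complex.Re (LambertW0 (aW d k (u0 x)) - LambertWm1 (aW d k (u0 x)))).

Definition rhoWyl (d : R) (u0 : R -> R) (xmax k : R) : R :=
  - derive1 (RWyl d u0 xmax) k.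

Definition thetaplus (d : R) (u0 : R -> R) (xmax k : R) : R :=
  k * xplus d u0 xmax k +
  Rintegral leb `[xplus d u0 xmax k, +oo[%classic
    (fun x => complex.Im (zeta d k + (1 / (2 * d))%:C * LambertWm1 (aW d k (u0 x)))).

Definition Vfn (d : R) (u0 : R -> R) (xmax x t k : R) : R :=
  x * k + t * complex.Im ((zeta d k - (1 / (2 * d))%:C) ^+ 2) - thetaplus d u0 xmax k.

Definition inA (d : R) (u0 : R -> R) (xmax : R) (rho : R -> R) : Prop :=
  let km := kappa_max d (u0 xmax) in
  measurable_fun `[0, km]%classic rho /\
  {ae leb, forall k, 0 <= k <= km -> 0 <= rho k <= rhoWyl d u0 xmax k}.

Definition Lop (d : R) (u0 : R -> R) (xmax : R) (rho : R -> R) (lam : R[i]) : R :=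
  1 / pi * Rintegral leb `[0, kappa_max d (u0 xmax)]%classic
    (fun eta => ln (cabs (lam - cconj (zeta d eta)) / cabs (lam - zeta d eta)) * rho eta).

Definition Efun (d : R) (u0 : R -> R) (xmax x t : R) (rho : R -> R) : R :=
  Rintegral leb `[0, kappa_max d (u0 xmax)]%classic
    (fun k => (Vfn d u0 xmax x t k + 1 / 2 * Lop d u0 xmax rho (zeta d k)) * rho k).

(* Fréchet derivative of E[.](x,t) at rho *)
Definition Phi (d : R) (u0 : R -> R) (xmax x t : R) (rho : R -> R) (k : R) : R :=
  Vfn d u0 xmax x t k + Lop d u0 xmax rho (zeta d k).

Definition ae_eq_on (d : R) (u0 : R -> R) (xmax : R) (r1 r2 : R -> R) : Prop :=
  {ae leb, forall k, 0 <= k <= kappa_max d (u0 xmax) -> r1 k = r2 k}.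

Definition admissible (u0 : R -> R) (xmax : R) : Prop :=
  (forall x, derivable u0 x 1) /\ (forall x : R, {for x, continuous (fun y : R => derive1 u0 y)}) /\
  (forall x, 0 < u0 x) /\
  (u0 x @[x --> +oo] --> (0:R)) /\ (u0 x @[x --> -oo] --> (0:R)) /\
  leb.-integrable setT (fun x => ((x ^+ 2 + 1) * u0 x)%:E) /\
  (forall x, u0 x <= u0 xmax) /\
  (forall x, derive1 u0 x = 0 <-> x = xmax) /\
  leb.-integrable setT (fun x => (Num.sqrt (u0 x))%:E).

End Defs.

(* Main.v *)
Require Import Defs.
From HB Require Import structures.
From mathcomp Require Import all_boot all_order all_algebra.
From mathcomp Require Import all_classical all_reals all_analysis.
From mathcomp Require Import measurable_realfun complex.
From mathcomp Require Import ring lra.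
Import Order.TTheory GRing.Theory Num.Theory.
Import numFieldNormedType.Exports.
Local Open Scope classical_set_scope.
Local Open Scope ring_scope.

(** The energy is a convex quadratic functional on the order interval
    [0 <= r <= rhoWyl].  A minimizing sequence chosen with almost least weighted [L^2] norm
    is Cauchy by the parallelogram identity, which yields a minimizer without weak
    compactness; the first variation is linear, so optimality decouples into pointwise sign
    conditions, and uniqueness is positive definiteness of the interaction form.

    Definiteness comes from a Gram representation.  With [zeta k = a k + i k],
    [log |(zeta k - conj (zeta e)) / (zeta k - zeta e)|] is twice the integral over
    [0 < s < min k e] and [0 < xi] of
    [exp (- xi (k - s)) exp (- xi (e - s)) cos (xi (a k - a e))].
    If the form vanishes at [r], then for some [xi > 0] the tails over [k > s] of
    [exp (- xi k) cos (xi a k) r k] and of its sine counterpart vanish for a.e. [s],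
    and Lebesgue differentiation gives [r = 0].

    Boundedness of the operator rests on an explicit formula for the Weyl density:
    differentiating the gap [W_0 - W_{-1}] in [kappa] and integrating over [x] by Tonelli writes
    it as a superposition of densities at most [C * q / sqrt (q (q - eta))] on [0 < eta < q],
    where [q] is of order [sqrt (u0 x)]; the logarithmic kernel integrates
    against each of them to at most a multiple of [q]. *)

(** * Convex minimization over an order interval *)

(** Three obstacles shape the proof. The upper constraint is a derivative, under control only almost
    everywhere, and elements of the constraint set obey it only almost everywhere on a closed
    interval. Each is therefore replaced by [clip], which lies between 0 and the everywhere defined
    representative [weyl_g] at every real point and vanishes off the open interval, so that the
    abstract minimization works with pointwise bounds on the whole line. That upper bound is only
    shown to be integrable, since it superposes inverse square root singularities; hence the weight
    in the [L^2] norm. Finally, the logarithmic kernel blows up on the diagonal, so Fubini is run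
    off the diagonal and controlled by [soliton_kern0], the kernel with equal real parts, whose
    features are nonnegative. All explicit estimates reduce to one real variable: the Lambert
    argument a(k, u) equals -exp(-1 - y) with y = 2 d (u - E(zeta(k))), so the branches depend on
    (k, u) only through y. *)

Section ae_cvg.
Context d (T : measurableType d) (R : realType) (m : {measure set T -> \bar R}).

(** AM-GM bounds an increment by half of [2 ^+ k] times its square plus half of [2 ^- k], and both
    series converge. *)
Lemma cvg_series_of_weighted_square (u : nat -> R) (w c : R) : 0 < w ->
  (forall n, \sum_(0 <= k < n) (2 ^+ k * (w * (u k.+1 - u k) ^+ 2)) <= c) ->
  cvgn u.
Proof.
move=> w0 hc.
pose v n := 2 ^+ n * (w * (u n.+1 - u n) ^+ 2).
have v0 n : 0 <= v n by rewrite /v mulr_ge0 ?exprn_ge0// mulr_ge0 ?sqr_ge0// ltW.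
have cv : cvgn (series v).
  apply: nondecreasing_is_cvgn.
    by apply/nondecreasing_seqP => n; rewrite /series/= big_nat_recr//= lerDl.
  by exists c => _ [n _ <-]; exact: hc.
have cg : cvgn (series (geometric (1 / 2 : R) (1 / 2))).
  by apply: is_cvg_geometric_series; rewrite ger0_norm; lra.
suff : cvgn (series (telescope u)).
  rewrite telescopeK => /cvg_ex[/= l hl]; apply/cvg_ex; exists (l + u 0%N).
  rewrite [X in X @ _ --> _](_ : u = (fun n => (u n - u 0%N) + u 0%N)).
    by apply: cvgD; [exact: hl|exact: cvg_cst].
  by apply/funext => n; rewrite subrK.
apply: normed_cvg.
apply: (@series_le_cvg _ _
    (fun n => 1 / (2 * w) * v n + 1 / 2 * (1 / 2) ^+ n)) => //.
- by move=> n; exact: normr_ge0.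
- by move=> n; rewrite addr_ge0// mulr_ge0// ?exprn_ge0 ?divr_ge0// ?mulr_ge0//; lra.
- move=> n; rewrite /telescope /v -[X in X <= _]/(`|u n.+1 - u n|).
  have -> : 1 / (2 * w) * (2 ^+ n * (w * (u n.+1 - u n) ^+ 2)) =
      1 / 2 * (2 ^+ n * (u n.+1 - u n) ^+ 2).
    by field; rewrite gt_eqF.
  set D := u n.+1 - u n.
  have p0 : 0 < 2 ^+ n :> R by rewrite exprn_gt0.
  rewrite expr_div_n expr1n.
  have -> : 2 ^+ n * D ^+ 2 = (2 ^+ n * `|D|) ^+ 2 / 2 ^+ n.
    by rewrite exprMn real_normK ?num_real//; field; rewrite gt_eqF.
  set a := 2 ^+ n * `|D|.
  have -> : `|D| = a / 2 ^+ n by rewrite /a mulrC mulKf// gt_eqF.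
  have -> : 1 / 2 * (a ^+ 2 / 2 ^+ n) + 1 / 2 * (1 / 2 ^+ n) =
      (a ^+ 2 + 1) / 2 / 2 ^+ n by field; rewrite gt_eqF.
  rewrite ler_pM2r ?invr_gt0//.
  have := sqr_ge0 (a - 1); nra.
- have -> : (fun n => 1 / (2 * w) * v n + 1 / 2 * (1 / 2) ^+ n) =
      (1 / (2 * w)) *: (v : R^o^nat) + geometric (1 / 2 : R) (1 / 2) by [].
  by rewrite seriesD; apply: is_cvgD => //; rewrite seriesZ; exact: is_cvgZr.
Qed.

(** After multiplication by [2 ^+ n] the integrals are at most [1 / 2 ^ n.+1], which sum to 1.
    Tonelli makes the weighted sum of squares finite almost everywhere, and the previous lemma
    applies at each such point. *)
Lemma ae_cvg_of_fast_L2 (h : nat -> T -> R) (w : T -> R) :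
  (forall n, measurable_fun setT (h n)) -> measurable_fun setT w ->
  (forall x, 0 < w x) ->
  (forall n, (\int[m]_x (w x * (h n.+1 x - h n x) ^+ 2)%:E
               <= (1 / (2 ^+ n) / (2 ^ n.+1)%:R)%:E)%E) ->
  {ae m, forall x, cvgn (h ^~ x)}.
Proof.
move=> mh mw w0 hint.
pose a n x := (2 ^+ n * (w x * (h n.+1 x - h n x) ^+ 2))%:E.
have a0 n x : (0 <= a n x)%E.
  by rewrite lee_fin mulr_ge0 ?exprn_ge0// mulr_ge0 ?sqr_ge0// ltW.
have mwh n : measurable_fun setT (fun x => (w x * (h n.+1 x - h n x) ^+ 2)).
  by apply: measurable_funM => //; apply: measurable_funX; exact: measurable_funB.
have ma n : measurable_fun setT (a n).
  by apply/measurable_EFinP; apply: measurable_funM.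
have sfin : (\int[m]_x (\sum_(0 <= n <oo) a n x) < +oo)%E.
  rewrite integral_nneseries//.
  apply: (@le_lt_trans _ _ 1%E); last by rewrite ltry.
  apply: le_trans (@epsilon_trick0 R 1 predT ler01).
  apply: lee_nneseries => [n _ _|n _]; first exact: integral_ge0.
  rewrite /a; under eq_integral do rewrite EFinM.
  rewrite ge0_integralZl//.
  - apply: (@le_trans _ _ ((2 ^+ n)%:E * (1 / (2 ^+ n) / (2 ^ n.+1)%:R)%:E)%E).
      by rewrite lee_pmul2l.
    rewrite -EFinM lee_fin le_eqVlt; apply/orP; left; apply/eqP.
    have p1 : 2 ^+ n != 0 :> R by rewrite gt_eqF// exprn_gt0.
    have p2 : (2 ^ n.+1)%:R != 0 :> R by rewrite pnatr_eq0 -lt0n expn_gt0.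
    move: p1 p2; generalize (2 ^+ n : R) ((2 ^ n.+1)%:R : R) => a1 a2 p1 p2.
    field; apply/andP; split => //.
  - exact/measurable_EFinP.
  - by move=> x _; rewrite lee_fin mulr_ge0 ?sqr_ge0// ltW.
have sint : m.-integrable setT (fun x => \sum_(0 <= n <oo) a n x)%E.
  apply/integrableP; split; first exact: ge0_emeasurable_sum.
  by under eq_integral do rewrite gee0_abs ?nneseries_ge0//.
have := integrable_ae measurableT sint.
apply: filterS => x /= /(_ I) fx.
apply: (@cvg_series_of_weighted_square _ (w x) (fine (\sum_(0 <= n <oo) a n x))) => // n.
rewrite -lee_fin fineK// -sumEFin.
by apply: (@nneseries_lim_ge R (fun k => a k x) predT) => k _ _; exact: a0.
Qed.

End ae_cvg.

(** * Direct method for a convex quadratic energy *)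

Section Variational.
Context d (T : measurableType d) (R : realType) (m : {measure set T -> \bar R}).
Implicit Types (f g r s : T -> R) (c C t a : R).
Variables (mu V : T -> R) (L : (T -> R) -> T -> R) (CV CL : R).

Lemma integrableMl_EFin f a : m.-integrable setT (EFin \o f) ->
  m.-integrable setT (EFin \o (fun x => a * f x)).
Proof. by move=> fi; have := @integrableZl _ _ _ m setT measurableT a _ fi. Qed.

Lemma integrableD_EFin f g : m.-integrable setT (EFin \o f) ->
  m.-integrable setT (EFin \o g) ->
  m.-integrable setT (EFin \o (fun x => f x + g x)).
Proof. by move=> fi gi; have := integrableD measurableT fi gi. Qed.

(** Differences of competitors leave the order interval, so the assumptions on [L] are made on this
    larger linear space. *)
Definition dominated (r : T -> R) :=
  measurable_fun setT r /\ exists2 c, 0 <= c & forall x, `|r x| <= c * mu x.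
Definition between (r : T -> R) :=
  measurable_fun setT r /\ forall x, 0 <= r x <= mu x.

Hypothesis mu_int : m.-integrable setT (EFin \o mu).
Hypothesis mu_ge0 : forall x, 0 <= mu x.
Hypothesis V_meas : measurable_fun setT V.
Hypothesis V_bd : forall x, `|V x| <= CV.
Hypothesis L_meas : forall r, dominated r -> measurable_fun setT (L r).
Hypothesis L_lin : forall a r s, dominated r -> dominated s -> forall x,
  L (fun y => a * r y + s y) x = a * L r x + L s x.
Hypothesis L_bd : forall (r : T -> R) c, measurable_fun setT r -> 0 <= c ->
  (forall x, `|r x| <= c * mu x) -> forall x, `|L r x| <= c * CL.
Hypothesis L_cvg : forall (r_ : nat -> T -> R) r, (forall n, between (r_ n)) ->
  between r -> {ae m, forall x, r_ n x @[n --> \oo] --> r x} ->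
  forall x, L (r_ n) x @[n --> \oo] --> L r x.
Hypothesis L_sym : forall r s, dominated r -> dominated s ->
  \int[m]_x (L r x * s x) = \int[m]_x (L s x * r x).
Hypothesis L_pos : forall r, dominated r -> 0 <= \int[m]_x (L r x * r x).
Hypothesis L_def : forall r, dominated r -> \int[m]_x (L r x * r x) = 0 ->
  {ae m, forall x, r x = 0}.

Definition energy r := \int[m]_x ((V x + 1 / 2 * L r x) * r x).
Definition denergy r x := V x + L r x.

Lemma mu_meas : measurable_fun setT mu.
Proof. by apply/measurable_EFinP; exact: measurable_int mu_int. Qed.

Lemma between_dominated r : between r -> dominated r.
Proof.
move=> [mr h]; split => //; exists 1 => // x.
by have /andP[h1 h2] := h x; rewrite ger0_norm// mul1r.
Qed.

Lemma dominated_lin a r s : dominated r -> dominated s ->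
  dominated (fun y => a * r y + s y).
Proof.
move=> [mr [c c0 hc]] [ms [e e0 he]]; split.
  by apply: measurable_funD => //; exact: measurable_funM.
exists (`|a| * c + e); first by rewrite addr_ge0// mulr_ge0.
move=> x; rewrite (le_trans (ler_normD _ _))// mulrDl lerD// normrM -mulrA.
by rewrite ler_wpM2l.
Qed.

Lemma dominatedB r s : dominated r -> dominated s ->
  dominated (fun y => r y - s y).
Proof.
move=> dr ds; have := dominated_lin (-1) s r ds dr.
by congr dominated; apply/funext => y; rewrite mulN1r addrC.
Qed.

Lemma dominated_int f C r : measurable_fun setT f -> (forall x, `|f x| <= C) ->
  dominated r -> m.-integrable setT (EFin \o (fun x => f x * r x)).
Proof.
move=> mf fC [mr [c c0 rc]].
apply: (@le_integrable _ _ _ m setT measurableT _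
   (fun x => (C * c)%:E * (EFin \o mu) x)%E).
- by apply/measurable_EFinP; exact: measurable_funM.
- move=> x _ /=; rewrite lee_fin normrM [leRHS]ger0_norm; last first.
    by rewrite mulr_ge0// mulr_ge0// (le_trans _ (fC x)).
  by rewrite -mulrA ler_pM.
- exact: integrableZl.
Qed.

Lemma L_bounded r : dominated r -> exists C, forall x, `|L r x| <= C.
Proof. by move=> [mr [c c0 hc]]; exists (c * CL); exact: L_bd. Qed.

Lemma Lr_int r s : dominated r -> dominated s ->
  m.-integrable setT (EFin \o (fun x => L r x * s x)).
Proof.
move=> dr ds; have [C hC] := L_bounded r dr.
by apply: dominated_int hC ds; exact: L_meas.
Qed.

Lemma Vr_int r : dominated r -> m.-integrable setT (EFin \o (fun x => V x * r x)).
Proof. exact: dominated_int. Qed.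

Lemma energyE r : dominated r ->
  energy r = \int[m]_x (V x * r x) + 1 / 2 * \int[m]_x (L r x * r x).
Proof.
move=> dr; rewrite /energy -RintegralZl//; last exact: Lr_int.
rewrite -RintegralD//; first by apply: eq_Rintegral => x _; rewrite mulrDl mulrA.
- exact: Vr_int.
- by apply: integrableMl_EFin; exact: Lr_int.
Qed.

(** The expansion is exact because the energy is quadratic; [L_sym] merges the two cross terms into
    the first variation [denergy]. *)
Lemma energy_expand t r s : dominated r -> dominated s ->
  energy (fun x => t * s x + r x) = energy r + t * \int[m]_x (denergy r x * s x)
    + t ^+ 2 / 2 * \int[m]_x (L s x * s x).
Proof.
move=> dr ds; have dts := dominated_lin t s r ds dr.
rewrite !energyE//.
have -> : \int[m]_x (V x * (t * s x + r x)) =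
    t * \int[m]_x (V x * s x) + \int[m]_x (V x * r x).
  rewrite -RintegralZl//; last exact: Vr_int.
  rewrite -RintegralD//.
  - by apply: eq_Rintegral => x _; ring.
  - exact/integrableMl_EFin/Vr_int.
  - exact: Vr_int.
have -> : \int[m]_x (denergy r x * s x) =
    \int[m]_x (V x * s x) + \int[m]_x (L r x * s x).
  rewrite -RintegralD//; [|exact: Vr_int|exact: Lr_int].
  by apply: eq_Rintegral => x _; rewrite /denergy mulrDl.
have -> : \int[m]_x (L (fun y => t * s y + r y) x * (t * s x + r x)) =
   t ^+ 2 * \int[m]_x (L s x * s x) + (t * \int[m]_x (L s x * r x)) +
   (t * \int[m]_x (L r x * s x) + \int[m]_x (L r x * r x)).
  rewrite -!RintegralZl//; try exact: Lr_int.
  rewrite -!RintegralD//; do ?[exact: Lr_int|apply: integrableD_EFin|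
    apply: integrableMl_EFin].
  by apply: eq_Rintegral => x _; rewrite L_lin//; ring.
rewrite (L_sym s r)//.
by field.
Qed.

Lemma energyB r s : dominated r -> dominated s ->
  energy s = energy r + \int[m]_x (denergy r x * (s x - r x))
    + 1 / 2 * \int[m]_x (L (fun y => s y - r y) x * (s x - r x)).
Proof.
move=> dr ds; have := energy_expand 1 r _ dr (dominatedB _ _ ds dr).
by rewrite expr1n mul1r => <-; congr energy; apply/funext => x; ring.
Qed.

Definition mid (r s : T -> R) x := 1 / 2 * (s x - r x) + r x.

Lemma between_mid r s : between r -> between s -> between (mid r s).
Proof.
move=> br bs; split.
  exact: (dominated_lin (1/2) _ r (dominatedB _ _ (between_dominated _ bs)
     (between_dominated _ br)) (between_dominated _ br)).1.
by move=> x; have /andP[? ?] := br.2 x; have /andP[? ?] := bs.2 x; rewrite /mid; lra.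
Qed.

(** The convexity gap is one eighth of the nonnegative form at [s - r]. It keeps midpoints of
    near-minimisers near-minimal. *)
Lemma energy_mid r s : between r -> between s ->
  energy (mid r s) <= (energy r + energy s) / 2.
Proof.
move=> br bs; have dr := between_dominated _ br; have ds := between_dominated _ bs.
have dsr := dominatedB _ _ ds dr.
rewrite [energy s](energyB r)// /mid (energy_expand (1/2) r)//.
have := L_pos _ dsr; lra.
Qed.

Lemma energy_lbound : exists B, forall r, between r -> B <= energy r.
Proof.
exists (\int[m]_x (- (CV + CL) * mu x)) => r br.
have dr := between_dominated _ br; have [mr hr] := br.
have hL x : `|L r x| <= CL.
  rewrite -[leRHS]mul1r; apply: L_bd => // y.
  by have /andP[h1 h2] := hr y; rewrite ger0_norm// mul1r.
apply: le_Rintegral => //.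
- exact: integrableMl_EFin.
- apply: (dominated_int (fun x => V x + 1 / 2 * L r x) (CV + CL)) => //.
    apply: measurable_funD => //; apply: measurable_funM => //; exact: L_meas.
  move=> x; rewrite (le_trans (ler_normD _ _))// lerD//.
  rewrite normrM (le_trans _ (hL x))// ler_piMl// ger0_norm; lra.
- move=> x _; have /andP[r0 rmu] := hr x; have := V_bd x; have := hL x.
  rewrite !ler_norml => /andP[l1 l2] /andP[v1 v2].
  have L0 : 0 <= CL by lra.
  nra.
Qed.

(** [mu] is merely integrable, so a competitor may have infinite [L^2] norm. Since
    [mu <= 1 + mu ^+ 2], this weight makes [qnorm] finite on competitors, and its positivity still
    lets a fast decay of [qnorm] control increments pointwise. *)
Definition qweight x := (1 + mu x ^+ 2)^-1.
Definition qnorm r := \int[m]_x (qweight x * r x * r x).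

Lemma qweight_gt0 x : 0 < qweight x.
Proof. by rewrite invr_gt0 ltr_pwDl ?sqr_ge0. Qed.

Lemma qweight_meas : measurable_fun setT qweight.
Proof.
apply: measurable_funTS.
apply: (measurableT_comp (f := fun y : R => (1 + y ^+ 2)^-1)) mu_meas.
apply: continuous_measurable_fun => y.
apply: cvgV; first by rewrite gt_eqF// ltr_pwDl ?sqr_ge0.
by apply: cvgD; [exact: cvg_cst|exact: exprn_continuous].
Qed.

Lemma qnorm_int r s : dominated r -> dominated s ->
  m.-integrable setT (EFin \o (fun x => qweight x * r x * s x)).
Proof.
move=> [mr [c c0 hc]] ds.
apply: (dominated_int (fun x => qweight x * r x) c) => //.
  exact: measurable_funM qweight_meas mr.
move=> x; rewrite normrM ger0_norm; last exact/ltW/qweight_gt0.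
rewrite /qweight mulrC ler_pdivrMr ?ltr_pwDl ?sqr_ge0//.
rewrite (le_trans (hc x))// ler_wpM2l//.
have := sqr_ge0 (mu x - 1 / 2); nra.
Qed.

Lemma qnorm_ge0 r : 0 <= qnorm r.
Proof.
apply: Rintegral_ge0 => x _; rewrite -mulrA -expr2.
by rewrite mulr_ge0 ?sqr_ge0// ltW// qweight_gt0.
Qed.

Lemma qnorm_parallelogram r s : dominated r -> dominated s ->
  qnorm (fun x => s x - r x) = 2 * qnorm r + 2 * qnorm s - 4 * qnorm (mid r s).
Proof.
move=> dr ds.
have dm : dominated (mid r s) by apply: dominated_lin => //; exact: dominatedB.
rewrite -!RintegralZl//; try exact: qnorm_int.
rewrite -RintegralD//; try by apply: integrableMl_EFin; exact: qnorm_int.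
rewrite -RintegralB//.
- by apply: eq_Rintegral => x _; rewrite /mid; field.
- by apply: integrableD_EFin; apply: integrableMl_EFin; exact: qnorm_int.
- by apply: integrableMl_EFin; exact: qnorm_int.
Qed.

Lemma qnorm_le r : between r -> qnorm r <= qnorm mu.
Proof.
move=> br; have dr := between_dominated _ br.
have dmu : dominated mu.
  by split; [exact: mu_meas|exists 1 => // x; rewrite mul1r ger0_norm].
apply: le_Rintegral => //; try exact: qnorm_int.
move=> x _; have /andP[h1 h2] := br.2 x.
by rewrite -!mulrA ler_wpM2l ?ler_pM// ltW// qweight_gt0.
Qed.

Definition infimum := inf [set energy r | r in between].

Lemma between0 : between (fun=> 0).
Proof. by split=> // x; rewrite lexx mu_ge0. Qed.

Lemma infimum_le r : between r -> infimum <= energy r.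
Proof.
move=> br; apply: ge_inf; last by exists r.
by have [B hB] := energy_lbound; exists B => _ [s /= bs <-]; exact: hB.
Qed.

Definition near_minimal n r := between r /\ energy r <= infimum + n.+1%:R^-1.

Lemma near_minimal_ex n : exists r, near_minimal n r.
Proof.
have [] := @inf_adherent R [set energy r | r in between] n.+1%:R^-1 _ _.
- by rewrite invr_gt0.
- split; first by exists (energy (fun=> 0)), (fun=> 0) => //; exact: between0.
  by have [B hB] := energy_lbound; exists B => _ [s /= bs <-]; exact: hB.
- by move=> _ [r br <-] /ltW ?; exists r.
Qed.

(** [near_minimal n] shrinks as [n] grows, so these least norms increase while staying below
    [qnorm mu]; their convergence replaces compactness. *)
Definition qinf n := inf [set qnorm r | r in near_minimal n].

Lemma qinf_le n r : near_minimal n r -> qinf n <= qnorm r.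
Proof.
move=> br; apply: ge_inf; last by exists r.
by exists 0 => _ [s _ <-]; exact: qnorm_ge0.
Qed.

Lemma near_minimalS n k r : (n <= k)%N -> near_minimal k r -> near_minimal n r.
Proof.
move=> nk [br he]; split => //; rewrite (le_trans he)// lerD2l.
by rewrite lef_pV2 ?posrE// ler_nat.
Qed.

Lemma qinf_nd : {homo qinf : n k / (n <= k)%N >-> n <= k}.
Proof.
move=> n k nk; apply: lb_le_inf.
  by have [r hr] := near_minimal_ex k; exists (qnorm r), r.
by move=> _ [r hr <-]; apply: qinf_le; exact: near_minimalS hr.
Qed.

Lemma qinf_cvg : cvgn qinf.
Proof.
apply: nondecreasing_is_cvgn; first exact: qinf_nd.
exists (qnorm mu) => _ [n _ <-]; have [r hr] := near_minimal_ex n.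
by rewrite (le_trans (qinf_le n r hr))// qnorm_le//; case: hr.
Qed.

Lemma qinf_adherent n : exists r, near_minimal n r /\ qnorm r < qinf n + n.+1%:R^-1.
Proof.
have [] := @inf_adherent R [set qnorm r | r in near_minimal n] n.+1%:R^-1 _ _.
- by rewrite invr_gt0.
- split; first by have [r hr] := near_minimal_ex n; exists (qnorm r), r.
  by exists 0 => _ [s _ <-]; exact: qnorm_ge0.
- by move=> _ [r br <-] h; exists r.
Qed.

(* Among near-minimisers the almost least [qnorm] ones form a Cauchy sequence,
   by the parallelogram identity. *)
Lemma near_minimal_cauchy (g : nat -> T -> R) n k : (n <= k)%N ->
  (forall j, near_minimal j (g j) /\ qnorm (g j) < qinf j + j.+1%:R^-1) ->
  qnorm (fun x => g k x - g n x) <= 2 * (limn qinf - qinf n) + 4 * n.+1%:R^-1.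
Proof.
move=> nk hg.
have [[bn en] qn] := hg n; have [mk qk] := hg k.
have [bk ek] := near_minimalS _ _ _ nk mk.
rewrite qnorm_parallelogram; [|exact: between_dominated..].
have hm : near_minimal n (mid (g n) (g k)).
  split; first exact: between_mid.
  apply: le_trans (energy_mid _ _ bn bk) _; move: en ek.
  by move: (energy _) (energy _) infimum (n.+1%:R^-1) => a b e c ?; lra.
have h1 := qinf_le _ _ hm.
have h2 : qinf k <= limn qinf by apply: nondecreasing_cvgn_le; [exact: qinf_nd|exact: qinf_cvg].
have h3 : k.+1%:R^-1 <= n.+1%:R^-1 :> R by rewrite lef_pV2 ?posrE// ler_nat.
move: qn qk h1 h2 h3; move: (qnorm _) (qnorm _) (qnorm _) (qinf n) (qinf k) (limn _).
by move: (n.+1%:R^-1) (k.+1%:R^-1) => *; lra.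
Qed.

Lemma qinf_gap : (fun n => 2 * (limn qinf - qinf n) + 4 * n.+1%:R^-1) x @[x --> \oo] --> (0 : R).
Proof.
rewrite [X in _ --> X](_ : 0 = 2 * (limn qinf - limn qinf) + 4 * 0); last by ring.
apply: cvgD; apply: cvgM; try exact: cvg_cst.
- by apply: cvgB; [exact: cvg_cst|exact: qinf_cvg].
- exact: cvg_harmonic.
Qed.

Lemma minimizing_sequence : exists h : nat -> T -> R,
  [/\ forall n, near_minimal n (h n) & {ae m, forall x, cvgn (h ^~ x)}].
Proof.
have [g hg] := choice qinf_adherent.
pose eps n : R := 2 * (limn qinf - qinf n) + 4 * n.+1%:R^-1.
have eps_ni : {homo eps : n k / (n <= k)%N >-> k <= n}.
  move=> n k nk; have h1 := qinf_nd _ _ nk.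
  have h3 : k.+1%:R^-1 <= n.+1%:R^-1 :> R by rewrite lef_pV2 ?posrE// ler_nat.
  by rewrite /eps; move: h1 h3; move: (n.+1%:R^-1) (k.+1%:R^-1) => *; lra.
have /choice[phi hphi] : forall k, exists n, eps n <= 1 / 2 ^+ k / (2 ^ k.+1)%:R.
  move=> k; have := qinf_gap; move=> /cvgrPdist_le /(_ (1 / 2 ^+ k / (2 ^ k.+1)%:R)) [].
    by rewrite !divr_gt0// ?exprn_gt0// ltr0n expn_gt0.
  move=> N _ /(_ N (leqnn N)); rewrite sub0r normrN => h.
  by exists N; rewrite (le_trans _ h)// ler_norm.
(* Partial sums of [(phi j).+1] give increasing indices that dominate both [phi] and the identity:
   the first bounds the increments at the rate that [ae_cvg_of_fast_L2] demands, the second keeps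
   the [n]-th term [near_minimal n]. *)
pose sig k := (\sum_(0 <= j < k.+1) (phi j).+1)%N.
have sigS k : sig k.+1 = (sig k + (phi k.+1).+1)%N by rewrite /sig big_nat_recr.
have phi_sig k : (phi k <= sig k)%N.
  case: k => [|k]; first by rewrite /sig big_nat1.
  by rewrite sigS -addSnnS leq_addl.
have sig_id k : (k <= sig k)%N.
  by elim: k => // k ih; rewrite sigS addnS ltnS (leq_trans ih)// leq_addr.
exists (g \o sig); split.
  by move=> n; apply: near_minimalS (sig_id n) (hg _).1.
have bg j : between (g j) by have [[]] := hg j.
apply: (@ae_cvg_of_fast_L2 _ _ _ _ _ qweight).
- by move=> n; exact: (bg (sig n)).1.
- exact: qweight_meas.
- exact: qweight_gt0.
- move=> n /=.
  have -> : (\int[m]_x (qweight x * (g (sig n.+1) x - g (sig n) x) ^+ 2)%:E)%E =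
      (qnorm (fun x => g (sig n.+1) x - g (sig n) x))%:E.
    have db : dominated (fun x => g (sig n.+1) x - g (sig n) x).
      by apply: dominatedB; exact: between_dominated.
    rewrite /qnorm /Rintegral fineK; last exact: integrable_fin_num (qnorm_int _ _ db db).
    by apply: eq_integral => x _; rewrite expr2 mulrA.
  rewrite lee_fin; apply: le_trans (hphi n).
  have sn : (sig n <= sig n.+1)%N by rewrite sigS leq_addr.
  exact: le_trans (near_minimal_cauchy _ _ _ sn hg) (eps_ni _ _ (phi_sig n)).
Qed.

Lemma minimizer_ex : exists2 r, between r & forall s, between s -> energy r <= energy s.
Proof.
have [h [hh hc]] := minimizing_sequence.
have bh n : between (h n) by case: (hh n).
have hb n x : 0 <= h n x <= mu x := (bh n).2 x.
(* Truncating the upper limit to [[0, mu x]] gives a competitor at every point, including the null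
   set where the sequence may diverge. *)
pose r x := Num.min (mu x) (Num.max 0 (limn_sup (h ^~ x))).
have br : between r.
  split; last first.
    by move=> x; rewrite /r le_min mu_ge0 le_max lexx/= ge_min lexx.
  apply: measurable_minr; first exact: mu_meas.
  apply: measurable_maxr => //; apply: measurable_fun_limn_sup.
  - by move=> x _; exists (mu x) => _ [n _ <-]; have /andP[] := hb n x.
  - by move=> x _; exists 0 => _ [n _ <-]; have /andP[] := hb n x.
  - by move=> n; exact: (bh n).1.
have hr : {ae m, forall x, h n x @[n --> \oo] --> r x}.
  apply: filterS hc => x cx; rewrite /r.
  have -> : limn_sup (h ^~ x) = limn (h ^~ x) by rewrite (cvg_limn_inf_sup cx).2.
  have l0 : 0 <= limn (h ^~ x).
    by apply: limr_ge => //; near=> n; have /andP[] := hb n x.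
  have lm : limn (h ^~ x) <= mu x.
    by apply: limr_le => //; near=> n; have /andP[] := hb n x.
  by rewrite max_r// min_r.
exists r => // s bs; apply: le_trans (infimum_le s bs).
have dr := between_dominated _ br.
have hL u : between u -> forall x, `|V x + 1 / 2 * L u x| <= CV + CL.
  move=> [mu_ hu] x.
  have hLx : `|L u x| <= CL.
    rewrite -[leRHS]mul1r; apply: L_bd => // y.
    by have /andP[h1 h2] := hu y; rewrite ger0_norm// mul1r.
  rewrite (le_trans (ler_normD _ _))// lerD//.
  rewrite normrM (le_trans _ hLx)// ler_piMl// ger0_norm; lra.
have mE u : between u -> measurable_fun setT (fun x => (V x + 1 / 2 * L u x) * u x).
  move=> bu; apply: measurable_funM; last exact: bu.1.
  apply: measurable_funD => //; apply: measurable_funM => //.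
  by apply: L_meas; exact: between_dominated.
pose e_ n := EFin \o (fun x => (V x + 1 / 2 * L (h n) x) * h n x).
pose e := EFin \o (fun x => (V x + 1 / 2 * L r x) * r x).
have me_ n : measurable_fun setT (e_ n) by apply/measurable_EFinP; exact: mE.
have me : measurable_fun setT e by apply/measurable_EFinP; exact: mE.
have [|||ie _ cve] := @dominated_convergence _ _ _ m setT measurableT e_ e
  (EFin \o (fun x => (CV + CL) * mu x)) me_ me.
- apply: filterS (hr) => x cx _; apply: cvg_EFin; first by near=> n.
  rewrite /comp/=; apply: cvgM; last exact: cx.
  apply: cvgD; first exact: cvg_cst.
  by apply: cvgM; [exact: cvg_cst|exact: (L_cvg h r bh br hr x)].
- exact: integrableMl_EFin.
- apply: aeW => x n _; rewrite /e_/= lee_fin normrM.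
  have /andP[h0 h1] := hb n x.
  by rewrite ler_pM// ?hL// ger0_norm.
have cE : energy (h n) @[n --> \oo] --> energy r.
  apply: (@fine_cvg _ _ _ _ (fun n => \int[m]_x (e_ n x))%E).
  rewrite /energy /Rintegral fineK; first exact: cve.
  exact: integrable_fin_num ie.
have cI : infimum + n.+1%:R^-1 @[n --> \oo] --> infimum + 0.
  by apply: cvgD; [exact: cvg_cst|exact: cvg_harmonic].
rewrite -[leRHS]addr0; apply: ler_cvg_to cE cI _.
by near=> n; case: (hh n).
Unshelve. all: by end_near. Qed.

Definition kkt r := {ae m, forall x,
  (0 < denergy r x -> r x = 0) /\ (denergy r x < 0 -> r x = mu x)}.

Lemma denergy_meas r : dominated r -> measurable_fun setT (denergy r).
Proof. by move=> dr; apply: measurable_funD => //; exact: L_meas. Qed.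

Lemma denergy_int r s : dominated r -> dominated s ->
  m.-integrable setT (EFin \o (fun x => denergy r x * s x)).
Proof.
move=> dr ds; have [C hC] := L_bounded r dr.
apply: (dominated_int _ (CV + C)) => //; first exact: denergy_meas.
by move=> x; rewrite (le_trans (ler_normD _ _))// lerD.
Qed.

(** The integrand is nonnegative almost everywhere: where [denergy] is positive [r] sits at the
    floor 0, where it is negative at the ceiling [mu]. *)
Lemma kkt_denergy_ge0 r s : between r -> between s -> kkt r ->
  0 <= \int[m]_x (denergy r x * (s x - r x)).
Proof.
move=> br bs hk.
have dr := between_dominated _ br; have ds := between_dominated _ bs.
rewrite /Rintegral (ae_eq_integral (EFin \o (fun x => `|denergy r x * (s x - r x)|)))//.
- by apply: fine_ge0; apply: integral_ge0 => x _; rewrite lee_fin.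
- exact: measurable_int (denergy_int _ _ dr (dominatedB _ _ ds dr)).
- apply/measurable_EFinP; apply: measurableT_comp => //; apply/measurable_EFinP.
  exact: measurable_int (denergy_int _ _ dr (dominatedB _ _ ds dr)).
- apply: filterS hk => x [k1 k2] _ /=; congr EFin.
  have /andP[s0 s1] := bs.2 x; rewrite ger0_norm//.
  have [p0|p0|<-] := ltgtP 0 (denergy r x); last by rewrite mul0r.
    by rewrite k1// subr0 mulr_ge0// ltW.
  by rewrite k2// mulr_le0 ?subr_le0// ltW.
Qed.

Lemma kkt_minimizer r s : between r -> between s -> kkt r -> energy r <= energy s.
Proof.
move=> br bs hk.
have dr := between_dominated _ br; have ds := between_dominated _ bs.
rewrite (energyB r s)// -addrA lerDl addr_ge0 ?kkt_denergy_ge0//.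
by rewrite mulr_ge0//; apply: L_pos; exact: dominatedB.
Qed.

Lemma minimizer_denergy_ge0 r s : between r -> between s ->
  (forall s, between s -> energy r <= energy s) ->
  0 <= \int[m]_x (denergy r x * (s x - r x)).
Proof.
move=> br bs hm.
have dr := between_dominated _ br; have ds := between_dominated _ bs.
have dsr := dominatedB _ _ ds dr.
have Q0 := L_pos _ dsr.
set a := \int[m]_x (denergy r x * (s x - r x)).
set Q := \int[m]_x (L _ x * _) in Q0.
have key t : 0 <= t <= 1 -> 0 <= t * a + t ^+ 2 / 2 * Q.
  move=> /andP[t0 t1]; have ee := energy_expand t r _ dr dsr.
  have : energy r <= energy (fun x => t * (s x - r x) + r x).
    apply: hm; split; first by apply: (dominated_lin _ _ _ dsr dr).1.
    move=> x; have /andP[? ?] := br.2 x; have /andP[? ?] := bs.2 x; nra.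
  by rewrite ee -addrA lerDl.
move: a Q Q0 key => a Q Q0 key.
rewrite leNgt; apply/negP => a0.
have qa : 0 < Q - a by lra.
(* Dividing by [Q - a] rather than [Q] keeps the step in [(0, 1]] even when [Q = 0]; at this [t] one
   has [a + t * Q / 2 = a * (1 + t) / 2 < 0]. *)
have := key (- a / (Q - a)).
have t0 : 0 < - a / (Q - a) by rewrite divr_gt0// oppr_gt0.
have t1 : - a / (Q - a) <= 1 by rewrite ler_pdivrMr// mul1r; lra.
have tE : - a / (Q - a) * (Q - a) = - a by rewrite divfK// gt_eqF.
rewrite (ltW t0) t1 => /(_ isT); move: t0 t1 tE.
move: (- a / (Q - a)) => t t0 t1 tE; rewrite expr2 => h.
have : 0 <= t * (a + t * Q / 2) by lra.
rewrite pmulr_rge0// => {}h; nra.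
Qed.

Lemma minimizer_kkt r : between r ->
  (forall s, between s -> energy r <= energy s) -> kkt r.
Proof.
move=> br hm; have dr := between_dominated _ br.
have mp := denergy_meas _ dr.
(* This bang-bang competitor minimizes the first variation pointwise. The integrand
   [denergy r * (s - r)] is then nonpositive while its integral is nonnegative, so it vanishes
   almost everywhere. *)
pose s x := if 0 < denergy r x then 0 else if denergy r x < 0 then mu x else r x.
have bs : between s.
  split.
    apply: measurable_fun_ifT => //; first exact: measurable_fun_ltr.
    apply: measurable_fun_ifT; first exact: measurable_fun_ltr.
      exact: mu_meas.
    exact: br.1.
  move=> x; rewrite /s; case: ifPn => _; first by rewrite lexx mu_ge0.
  by case: ifPn => _; [rewrite lexx mu_ge0|exact: br.2].
have ds := between_dominated _ bs.
have i0 := denergy_int _ _ dr (dominatedB _ _ ds dr).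
have le0 x : denergy r x * (s x - r x) <= 0.
  rewrite /s; have /andP[r0 r1] := br.2 x.
  have [p0|p0|<-] := ltgtP 0 (denergy r x); last by rewrite mul0r.
    by rewrite sub0r mulrN oppr_le0 mulr_ge0// ltW.
  by rewrite mulr_le0_ge0 ?subr_ge0// ltW.
have ge0 := minimizer_denergy_ge0 _ _ br bs hm.
pose F := EFin \o (fun x => denergy r x * (s x - r x)).
have : (\int[m]_x `|F x|)%E = 0%E.
  have -> : (\int[m]_x `|F x|)%E = (
     - \int[m]_x (denergy r x * (s x - r x)))%:E.
    rewrite /Rintegral EFinN fineK; last exact: integrable_fin_num i0.
    rewrite -integralN//=.
      by apply: eq_integral => x _ /=; rewrite ler0_norm.
    exact: integrable_add_def.
  apply/eqP; rewrite eqe oppr_eq0 eq_le ge0 andbT.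
  rewrite -oppr_ge0 -mulN1r -RintegralZl//; apply: Rintegral_ge0 => x _.
  by rewrite mulN1r oppr_ge0.
move=> /(ae_eq_integral_abs m measurableT (measurable_int m i0)).1.
apply: filterS => x /= /(_ I) [] /eqP; rewrite mulf_eq0 => /orP[/eqP->|].
  by rewrite ltxx; split.
rewrite subr_eq0 => /eqP <-; rewrite /s; split=> [-> //|p0].
by rewrite ltNge (ltW p0)/= p0.
Qed.

(** By [energyB] the excess energy of [s] is a nonnegative first variation plus half the form at
    [s - r]; no excess forces the form to vanish, and [L_def] concludes. *)
Lemma minimizer_unique r s : between r -> between s -> kkt r ->
  energy s <= energy r -> {ae m, forall x, s x = r x}.
Proof.
move=> br bs hk.
have dr := between_dominated _ br; have ds := between_dominated _ bs.
rewrite (energyB r s)// => he.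
have h1 := kkt_denergy_ge0 _ _ br bs hk.
have dsr := dominatedB _ _ ds dr.
have h2 := L_pos _ dsr.
have : \int[m]_x (L (fun y => s y - r y) x * (s x - r x)) = 0.
  move: he h1 h2; move: (Rintegral _ _ _) (Rintegral _ _ _) => *; lra.
by move=> /(L_def _ dsr); apply: filterS => x /eqP; rewrite subr_eq0 => /eqP.
Qed.

End Variational.

Arguments dominated {d T R} mu r.
Arguments between {d T R} mu r.
Arguments energy {d T R} m V L r.
Arguments denergy {d T R} V L r x.
Arguments kkt {d T R} m mu V L r.

Set Implicit Arguments.
Unset Strict Implicit.

(** * A logarithmic kernel estimate *)

Section FTC.
Context {R : realType}.
Notation mu := (@lebesgue_measure R).

(** The integrand may be unbounded at both ends, as with inverse roots. Monotone convergence along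
    intervals with shrinking margins reduces to the compact case, and continuity of [F] up to the
    ends gives the limit. *)
Lemma ge0_integral_oo_FTC (f F : R -> R) (a b : R) : a < b ->
  {in `]a, b[, continuous f} -> (forall x, a < x < b -> 0 <= f x) ->
  {within `[a, b], continuous F} ->
  (forall x, a < x < b -> derivable F x 1 /\ derive1 F x = f x) ->
  (\int[mu]_(x in `]a, b[) (f x)%:E = (F b - F a)%:E)%E.
Proof.
move=> ab cf f0 cF dF.
(* The denominator [n + 3] leaves a nondegenerate interval for every [n], since
   [2 * e n < b - a]. *)
pose e n : R := (b - a) / (n + 2).+1%:R.
have ba : 0 < b - a by rewrite subr_gt0.
have e0 n : 0 < e n by rewrite divr_gt0.
have e2 n : e n + e n < b - a.
  rewrite /e -mulrDl ltr_pdivrMr// -natr1 natrD mulrDr mulrDr mulr1.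
  have : 0 <= (b - a) * n%:R by rewrite mulr_ge0// ltW.
  move: (_ * n%:R) => ? ?; lra.
have ecvg : e n @[n --> \oo] --> (0 : R).
  have := @cvg_harmonic R; rewrite -(cvg_shiftn 2) => h.
  rewrite -[X in _ --> X](mulr0 (b - a)); apply: cvgM; first exact: cvg_cst.
  exact: h.
pose I n := `[a + e n, b - e n]%classic.
have en n m : (n <= m)%N -> e m <= e n.
  by move=> nm; rewrite ler_pM2l// lef_pV2 ?posrE// ler_nat ltnS leq_add2r.
have mI n : measurable (I n) by exact: measurable_itv.
have subI n x : I n x -> a < x < b.
  by rewrite /I/= in_itv/= => /andP[h1 h2]; have := e0 n => ?; apply/andP; split; lra.
have UI : \bigcup_n I n = `]a, b[%classic.
  apply/seteqP; split => x/=.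
    by move=> [n _] /subI; rewrite in_itv.
  rewrite in_itv/= => /andP[ax xb].
  have m0 : 0 < Num.min (x - a) (b - x) by rewrite lt_min !subr_gt0 ax.
  move/cvgrPdist_lt: ecvg => /(_ _ m0)[N _ /(_ N (leqnn N))].
  rewrite sub0r normrN ger0_norm; last exact/ltW.
  rewrite lt_min => /andP[h1 h2]; exists N => //; rewrite /I/= in_itv/=.
  by apply/andP; split; lra.
have intI n : (\int[mu]_(x in I n) (f x)%:E = (F (b - e n) - F (a + e n))%:E)%E.
  have h2 := e2 n; have h0 := e0 n.
  rewrite EFinB (@continuous_FTC2 _ f F)//.
  - lra.
  - apply: continuous_in_subspaceT => x; rewrite inE => /subI xab.
    by apply: cf; rewrite in_itv.
  - have cc x : a < x < b -> {for x, continuous F}.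
      by move=> xab; apply/differentiable_continuous/derivable1_diffP; exact: (dF _ xab).1.
    split.
    + move=> x; rewrite in_itv/= => /andP[? ?]; apply: (dF x _).1.
      by apply/andP; split; lra.
    + apply: cvg_at_right_filter; apply: cc; apply/andP; split; lra.
    + apply: cvg_at_left_filter; apply: cc; apply/andP; split; lra.
  - move=> x; rewrite in_itv/= => /andP[? ?]; apply: (dF x _).2.
    by apply/andP; split; lra.
have c1 : (\int[mu]_(x in I n) (f x)%:E)%E @[n --> \oo] -->
    (\int[mu]_(x in `]a, b[) (f x)%:E)%E.
  rewrite -UI; apply: ge0_nondecreasing_set_cvg_integral => //.
  - move=> n m nm; apply/subsetPset => x; rewrite /I/= !in_itv/= => /andP[h1 h2].
    by have := en _ _ nm => ?; apply/andP; split; lra.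
  - move=> n; apply/measurable_EFinP.
    apply: (@measurable_funS _ _ _ _ `]a, b[%classic) => //.
      by move=> x /subI; rewrite /= in_itv.
    by apply: open_continuous_measurable_fun => // x; rewrite inE => xab; exact: cf.
  - by move=> n x /subI xab; rewrite lee_fin f0.
have [cab Fa Fb] := proj1 (continuous_within_itvP F ab) cF.
have c2 : (F (b - e n) - F (a + e n))%:E @[n --> \oo] --> (F b - F a)%:E.
  apply: cvg_EFin; first by near=> n.
  rewrite /comp/=; apply: cvgB.
  - move/cvg_at_leftP : Fb; apply; split; first by move=> n; rewrite gtrBl.
    rewrite -[X in _ --> X]subr0; apply: cvgB => //; exact: cvg_cst.
  - move/cvg_at_rightP : Fa; apply; split; first by move=> n; rewrite ltrDl.
    rewrite -[X in _ --> X]addr0; apply: cvgD => //; exact: cvg_cst.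
have c3 : (\int[mu]_(x in I n) (f x)%:E)%E @[n --> \oo] --> (F b - F a)%:E.
  by under eq_fun do rewrite intI.
exact: cvg_unique c1 c3.
Unshelve. all: by end_near. Qed.

Lemma is_derive1P (F : R -> R) (x l : R) : is_derive x 1 F l -> derivable F x 1 /\ derive1 F x = l.
Proof. by move=> h; split => //; rewrite derive1E derive_val. Qed.

Lemma measurable_inv : measurable_fun setT (@GRing.inv R).
Proof.
(* total formula, also right at the junk value [0^-1 = 0] *)
have -> : @GRing.inv R = fun x => x * expR (- ln (x ^+ 2)).
  apply/funext => x; have [->|x0] := eqVneq x 0; first by rewrite invr0 mul0r.
  by rewrite expRN lnK ?posrE ?exprn_even_gt0// expr2 invfM mulrA divff ?mul1r.
apply: measurable_funM => //; apply: measurableT_comp; first exact: measurable_expR.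
apply: measurableT_comp; first exact: measurable_funN.
by apply: measurableT_comp; [exact: measurable_ln|exact: exprn_measurable].
Qed.

Lemma measurable_funV d (T : measurableType d) (D : set T) (f : T -> R) :
  measurable_fun D f -> measurable_fun D (fun x => (f x)^-1).
Proof. by move=> mf; apply: measurableT_comp => //; exact: measurable_inv. Qed.

Implicit Types x y : R.

(** The logarithm is bounded through fourth roots, [ln x <= 4 * rt4 x]: a singularity of order 1/4
    times an inverse square root has order 3/4, still integrable with primitive [4 * rt4]. *)
Definition rt4 x := Num.sqrt (Num.sqrt x).

Lemma rt4_ge0 x : 0 <= rt4 x. Proof. exact: sqrtr_ge0. Qed.
Lemma rt4_gt0 x : 0 < x -> 0 < rt4 x. Proof. by rewrite !sqrtr_gt0. Qed.
Lemma rt4_sqr x : rt4 x ^+ 2 = Num.sqrt x.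
Proof. by rewrite sqr_sqrtr// sqrtr_ge0. Qed.
Lemma rt4K x : 0 <= x -> rt4 x ^+ 4 = x.
Proof. by move=> x0; rewrite (exprM _ 2 2) rt4_sqr sqr_sqrtr. Qed.
Lemma rt4_le x y : x <= y -> rt4 x <= rt4 y.
Proof. by move=> xy; rewrite !ler_wsqrtr. Qed.
Lemma rt4M x y : 0 <= x -> rt4 (x * y) = rt4 x * rt4 y.
Proof. by move=> x0; rewrite /rt4 sqrtrM// sqrtrM// sqrtr_ge0. Qed.
Lemma rt4_cont : continuous rt4.
Proof. by move=> x; apply: continuous_comp; exact: sqrt_continuous. Qed.
Lemma rt4_derive x : 0 < x -> is_derive x 1 rt4 (4^-1 / rt4 x ^+ 3).
Proof.
move=> x0; have s0 : 0 < Num.sqrt x by rewrite sqrtr_gt0.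
have r0 := rt4_gt0 x0.
have := @is_derive1_comp R Num.sqrt Num.sqrt x _ _ (is_derive1_sqrt s0) (is_derive1_sqrt x0).
rewrite -[_ \o _]/rt4 -[Num.sqrt (Num.sqrt x)]/(rt4 x) -(rt4_sqr x).
by move=> /is_derive_eq; apply; field; rewrite gt_eqF.
Qed.

Lemma ln_le_rt4 x : 0 < x -> ln x <= 4 * rt4 x.
Proof.
move=> x0; rewrite -{1}(rt4K (ltW x0)) lnXn ?rt4_gt0// -[leLHS]mulr_natl ler_pM2l//.
by rewrite ltW// ln_sublinear// rt4_gt0.
Qed.

(** Splitting at the singularity [c], each side has the primitive [4 * rt4] of the distance, up to
    sign, and contributes at most [4 * rt4 q]. *)
Lemma integral_sum_rt4N3 (q c : R) : 0 < q -> 0 <= c <= q ->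
  (\int[mu]_(x in `]0%R, q[) ((rt4 `|c - x| ^+ 3)^-1)%:E <= (8 * rt4 q)%:E)%E.
Proof.
move=> q0 /andP[c0 cq].
have mf : measurable_fun setT (fun x : R => (rt4 `|c - x| ^+ 3)^-1).
  apply: measurable_funV; apply: measurable_funX.
  apply: measurableT_comp; first exact: continuous_measurable_fun rt4_cont.
  by apply: measurableT_comp => //; exact: measurable_funB.
have f0 x : (0 <= ((rt4 `|c - x| ^+ 3)^-1)%:E)%E.
  by rewrite lee_fin invr_ge0 exprn_ge0// rt4_ge0.
have Fcont (s u : R) : continuous (fun x : R => s * (4 * rt4 (u * (c - x)))).
  move=> x; apply: cvgM; first exact: cvg_cst.
  apply: cvgM; first exact: cvg_cst.
  apply: (@cvg_comp _ _ _ (fun x => u * (c - x)) rt4 _ (nbhs (u * (c - x)))); last exact: rt4_cont.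
  by apply: cvgM; [exact: cvg_cst|apply: cvgB; [exact: cvg_cst|exact: cvg_id]].
have fcont x : x != c -> {for x, continuous (fun x : R => (rt4 `|c - x| ^+ 3)^-1)}.
  move=> xc; have p : 0 < `|c - x| by rewrite normr_gt0 subr_eq0 eq_sym.
  apply: cvgV; first by rewrite expf_neq0// gt_eqF// rt4_gt0.
  apply: (@cvg_comp _ _ _ (fun x => rt4 `|c - x|) (fun y => y ^+ 3) _ (nbhs (rt4 `|c - x|)));
    last exact: exprn_continuous.
  apply: (@cvg_comp _ _ _ (fun x => `|c - x|) rt4 _ (nbhs (`|c - x|))); last exact: rt4_cont.
  by apply: cvg_norm; apply: cvgB; [exact: cvg_cst|exact: cvg_id].
have Fder (s u : R) x : s * u = -1 -> 0 < u * (c - x) -> u * (c - x) = `|c - x| ->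
    is_derive x 1 (fun x : R => s * (4 * rt4 (u * (c - x)))) ((rt4 `|c - x| ^+ 3)^-1).
  move=> su p pe.
  have h1 : is_derive x 1 (fun x : R => u * (c - x)) (- u).
    by apply: is_derive_eq; rewrite /GRing.scale/=; ring.
  have h2 := @is_derive1_comp R rt4 _ x _ _ (rt4_derive p) h1.
  have -> : (fun x0 : R => s * (4 * rt4 (u * (c - x0)))) =
     (s * 4) \*: (rt4 \o (fun x0 : R => u * (c - x0))).
    by apply/funext => y; rewrite /= mulrA.
  have h3 := @is_deriveZ _ _ _ _ (s * 4) _ _ _ h2.
  apply: (is_derive_eq h3); rewrite /GRing.scale/= pe.
  have rn : rt4 `|c - x| != 0 by rewrite gt_eqF// rt4_gt0// -pe.
  have -> : s * 4 * (4^-1 / rt4 `|c - x| ^+ 3 * - u) = - (s * u) / rt4 `|c - x| ^+ 3.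
    by field.
  by rewrite su opprK mul1r.
have il : (\int[mu]_(x in `]0%R, c[) ((rt4 `|c - x| ^+ 3)^-1)%:E <= (4 * rt4 q)%:E)%E.
  have [c00|c00] := leP c 0.
    by rewrite set_itv_ge ?bnd_simp -?leNgt// integral_set0 lee_fin mulr_ge0// rt4_ge0.
  have := @ge0_integral_oo_FTC (fun x : R => (rt4 `|c - x| ^+ 3)^-1)
    (fun x => -1 * (4 * rt4 (1 * (c - x)))) _ _ c00 => ->.
  - by rewrite lee_fin subrr mulr0 /rt4 !sqrtr0 !mulr0 sub0r mulN1r opprK mul1r subr0 ler_pM2l// rt4_le.
  - by move=> x; rewrite in_itv/= => /andP[_ xc]; apply: fcont; rewrite lt_eqF.
  - by move=> x _; have := f0 x; rewrite lee_fin.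
  - exact: continuous_subspaceT.
  - move=> x /andP[_ xc]; apply: is_derive1P; apply: Fder; rewrite ?mulr1 ?mul1r ?subr_gt0//.
    by rewrite ger0_norm// subr_ge0 ltW.
have ir : (\int[mu]_(x in `]c, q[) ((rt4 `|c - x| ^+ 3)^-1)%:E <= (4 * rt4 q)%:E)%E.
  have [c00|c00] := leP q c.
    by rewrite set_itv_ge ?bnd_simp -?leNgt// integral_set0 lee_fin mulr_ge0// rt4_ge0.
  have := @ge0_integral_oo_FTC (fun x : R => (rt4 `|c - x| ^+ 3)^-1)
    (fun x => 1 * (4 * rt4 (-1 * (c - x)))) _ _ c00 => ->.
  - rewrite lee_fin subrr mulr0 [rt4 0]/rt4 !sqrtr0 !mulr0 subr0 mulN1r opprB mul1r.
    by rewrite ler_pM2l// rt4_le// gerBl.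
  - by move=> x; rewrite in_itv/= => /andP[xc _]; apply: fcont; rewrite gt_eqF.
  - by move=> x _; have := f0 x; rewrite lee_fin.
  - exact: continuous_subspaceT.
  - move=> x /andP[xc _]; apply: is_derive1P; apply: Fder; rewrite ?mul1r// mulN1r ?oppr_gt0 ?subr_lt0//.
    by rewrite ler0_norm// subr_le0 ltW.
have mD : measurable (`]0%R, q[%classic `\ c) by exact: measurableD.
rewrite -(@integral_setD1 _ _ c)//; last first.
  by apply: (@measurable_funS _ _ _ _ setT) => //; exact/measurable_EFinP.
have -> : `]0%R, q[%classic `\ c = `]0%R, c[%classic `|` `]c, q[%classic.
  apply/seteqP; split => x/=; rewrite !in_itv/=.
    move=> [/andP[x0 xq]] /eqP xc; rewrite x0 xq andbT/=.
    by move: xc; rewrite neq_lt => /orP[->|->]; [left|right].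
  by move=> [/andP[x0 xc]|/andP[xc xq]]; (split; last by move=> xE; rewrite xE ltxx in xc);
    apply/andP; split; lra.
rewrite ge0_integral_setU//.
- apply: (le_trans (leeD il ir)); rewrite -EFinD lee_fin; lra.
- by apply: (@measurable_funS _ _ _ _ setT) => //; exact/measurable_EFinP.
- apply/disj_setPS => x/=; rewrite !in_itv/= => -[/andP[_ h1] /andP[h2 _]].
  by have := lt_trans h1 h2; rewrite ltxx.
Qed.

Lemma rt4V x : 0 <= x -> rt4 x^-1 = (rt4 x)^-1.
Proof. by move=> x0; rewrite /rt4 !sqrtrV// sqrtr_ge0. Qed.

Lemma rt4_double x : rt4 (2 * x) <= 2 * rt4 x.
Proof.
rewrite rt4M// ler_wpM2r ?rt4_ge0//.
apply: (@le_trans _ _ (rt4 (2 ^+ 4))).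
  by apply: rt4_le; rewrite !exprS expr0; lra.
by rewrite (exprM _ 2 2) /rt4 sqrtr_sqr ger0_norm// sqrtr_sqr ger0_norm.
Qed.

Lemma log_kernel_pointwise (q k x : R) : 0 < x < q -> 0 <= k ->
  ln ((k + x) / `|k - x|) * (Num.sqrt q / Num.sqrt (q - x)) <=
  8 * rt4 q ^+ 3 * ((rt4 `|q - x| ^+ 3)^-1 + (rt4 `|Num.min k q - x| ^+ 3)^-1).
Proof.
move=> /andP[x0 xq] k0.
have q0 : 0 < q by lra.
have Rge0 : 0 <= 8 * rt4 q ^+ 3 * ((rt4 `|q - x| ^+ 3)^-1 + (rt4 `|Num.min k q - x| ^+ 3)^-1).
  by rewrite mulr_ge0// ?mulr_ge0// ?addr_ge0 ?invr_ge0 ?exprn_ge0// rt4_ge0.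
(* At [k = x] the conventions that division by 0 gives 0 and [ln 0 = 0] make the left side
   vanish. *)
have [kE|kx] := eqVneq k x.
  have -> : ln ((k + x) / `|k - x|) = 0 by rewrite kE subrr normr0 invr0 mulr0 ln0.
  by rewrite mul0r.
(* A singularity beyond [q] is moved back to [q]: for [x < q <= k] the ratio [(k + x) / (k - x)]
   only grows when [k] decreases to [q]. *)
move: Rge0; set c := Num.min k q => Rge0.
have cq : c <= q by rewrite /c ge_min lexx orbT.
have c0 : 0 <= c by rewrite /c le_min k0 ltW.
have cx : 0 < `|c - x|.
  rewrite normr_gt0 subr_eq0 /c; have [//|qk] := leP k q; by rewrite gt_eqF.
have step : ln ((k + x) / `|k - x|) <= ln ((c + x) / `|c - x|).
  have kx0 : 0 < `|k - x| by rewrite normr_gt0 subr_eq0.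
  rewrite ler_ln ?posrE ?divr_gt0 ?ltr_wpDl//.
  rewrite /c; have [//|qk] := leP k q.
  rewrite !gtr0_norm ?subr_gt0//; last exact: lt_trans qk.
  have h1 : 0 < q - x by lra.
  have h2 : 0 < k - x by lra.
  rewrite ler_pdivrMr// mulrAC ler_pdivlMr//; nra.
have step2 : ln ((c + x) / `|c - x|) <= 8 * rt4 q * (rt4 `|c - x|)^-1.
  apply: le_trans (ln_le_rt4 _) _; first by rewrite divr_gt0// ltr_wpDl.
  rewrite rt4M ?rt4V//; last by lra.
  rewrite mulrA ler_wpM2r ?invr_ge0 ?rt4_ge0//.
  have -> : 8 * rt4 q = 4 * (2 * rt4 q) by ring.
  by rewrite ler_pM2l// (le_trans _ (rt4_double q))// rt4_le//; lra.
have qx : 0 < q - x by lra.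
rewrite (gtr0_norm qx) -!rt4_sqr.
have A0 : 0 < (rt4 (q - x))^-1 by rewrite invr_gt0 rt4_gt0.
have B0 : 0 < (rt4 `|c - x|)^-1 by rewrite invr_gt0 rt4_gt0.
have Q0 := rt4_gt0 q0.
rewrite -!exprVn.
move: (le_trans step step2) A0 B0 Q0.
move: (ln _) ((rt4 (q - x))^-1) ((rt4 `|c - x|)^-1) (rt4 q) => l A B Q h A0 B0 Q0.
apply: (@le_trans _ _ (8 * Q * B * (Q ^+ 2 * A ^+ 2))).
  by rewrite ler_wpM2r// mulr_ge0// sqr_ge0.
have -> : 8 * Q * B * (Q ^+ 2 * A ^+ 2) = 8 * Q ^+ 3 * (A ^+ 2 * B) by ring.
rewrite ler_wpM2l//; first by rewrite mulr_ge0// exprn_ge0// ltW.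
(* The inequality [A ^+ 2 * B <= A ^+ 3 + B ^+ 3] separates the two singularities. *)
have [AB|BA] := leP A B.
  have : 0 <= B ^+ 2 - A ^+ 2 by rewrite subr_ge0 ler_pXn2r// nnegrE ltW.
  have : 0 < A ^+ 3 by rewrite exprn_gt0.
  have -> : B ^+ 3 = B ^+ 2 * B by ring.
  nra.
have : 0 < B ^+ 3 by rewrite exprn_gt0.
have -> : A ^+ 3 = A ^+ 2 * A by ring.
have : 0 < A ^+ 2 by rewrite exprn_gt0.
nra.
Qed.

Lemma measurable_log_kernel (k : R) :
  measurable_fun setT (fun x : R => ln ((k + x) / `|k - x|)).
Proof.
apply: measurableT_comp; first exact: measurable_ln.
apply: measurable_funM; first exact: measurable_funD.
by apply: measurable_funV; apply: measurableT_comp => //; exact: measurable_funB.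
Qed.

(** The powers of [rt4 q] recombine into [q], as scaling predicts; 128 is [8 * (8 + 8)]. *)
Lemma integral_log_kernel (q k : R) : 0 < q -> 0 <= k ->
  (\int[mu]_(x in `]0%R, q[)
    (ln ((k + x) / `|k - x|) * (Num.sqrt q / Num.sqrt (q - x)))%:E <= (128 * q)%:E)%E.
Proof.
move=> q0 k0; set c := Num.min k q.
have cq : 0 <= c <= q by rewrite /c le_min k0 ge_min lexx orbT/= ltW.
pose f (c x : R) := (rt4 `|c - x| ^+ 3)^-1.
have mf c' : measurable_fun setT (f c').
  apply: measurable_funV; apply: measurable_funX.
  apply: measurableT_comp; first exact: continuous_measurable_fun rt4_cont.
  by apply: measurableT_comp => //; exact: measurable_funB.
have f0 c' x : 0 <= f c' x by rewrite invr_ge0 exprn_ge0// rt4_ge0.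
have mfD c' : measurable_fun `]0%R, q[ (EFin \o f c').
  by apply/measurable_EFinP; apply: measurable_funTS; exact: mf.
have K0 : 0 <= 8 * rt4 q ^+ 3 by rewrite mulr_ge0// exprn_ge0// rt4_ge0.
apply: (@le_trans _ _ (\int[mu]_(x in `]0%R, q[)
   ((8 * rt4 q ^+ 3)%:E * ((f q x)%:E + (f c x)%:E)))%E).
  apply: ge0_le_integral => //.
  - move=> x/=; rewrite in_itv/= => /andP[x0 xq].
    rewrite lee_fin mulr_ge0// ?divr_ge0 ?sqrtr_ge0//.
    have [->|kx] := eqVneq k x; first by rewrite subrr normr0 invr0 mulr0 ln0.
    rewrite ln_ge0// ler_pdivlMr ?normr_gt0 ?subr_eq0// mul1r ler_norml.
    by apply/andP; split; lra.
  - apply/measurable_EFinP; apply: measurable_funTS; apply: measurable_funM.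
      exact: measurable_log_kernel.
    apply: measurable_funM => //; apply: measurable_funV.
    apply: measurableT_comp; first exact: continuous_measurable_fun (@sqrt_continuous R).
    exact: measurable_funB.
  - by apply: emeasurable_funM => //; apply: emeasurable_funD; exact: mfD.
  - move=> x/=; rewrite in_itv/= => xq.
    by rewrite -EFinD -EFinM lee_fin; exact: log_kernel_pointwise.
rewrite ge0_integralZl//; last 2 first.
- by apply: emeasurable_funD; exact: mfD.
- by move=> x _; rewrite adde_ge0// lee_fin.
rewrite ge0_integralD//; try (by move=> x _; rewrite lee_fin); try exact: mfD.
apply: (@le_trans _ _ ((8 * rt4 q ^+ 3)%:E * ((8 * rt4 q)%:E + (8 * rt4 q)%:E))%E).
  rewrite lee_wpmul2l// leeD// ?integral_sum_rt4N3//.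
  by rewrite lexx andbT ltW.
rewrite -EFinD -EFinM lee_fin -[in leRHS](rt4K (ltW q0)) le_eqVlt; apply/orP; left; apply/eqP.
by ring.
Qed.

End FTC.

(** * The Lambert function and the spectral curve *)

Section cotangent_function.
Context {R : realType}.
Implicit Types x y s t : R.

Lemma is_derive_continuous (f : R -> R) x (l : R) : is_derive x 1 f l -> {for x, continuous f}.
Proof. by move=> h; apply/differentiable_continuous/derivable1_diffP; case: h. Qed.

Lemma is_derive_ge0_le (f df : R -> R) (a b : R) : a <= b ->
  (forall x, a <= x <= b -> is_derive x 1 f (df x)) ->
  (forall x, a <= x <= b -> 0 <= df x) -> f a <= f b.
Proof.
move=> ab hd h0; have sub x : x \in `]a, b[ -> a <= x <= b.
  by rewrite in_itv/= => /andP[? ?]; apply/andP; split; exact: ltW.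
apply: (@ger0_derive1_ndecr R f a b) => //.
- by move=> x /sub /hd [].
- by move=> x /sub xab; have [_ ->] := is_derive1P (hd _ xab); exact: h0.
- apply: continuous_in_subspaceT => x; rewrite inE/= in_itv/= => xab.
  exact: is_derive_continuous (hd _ xab).
Qed.

Lemma sin_sub_ge0 s : 0 <= s <= pi -> 0 <= sin s - s * cos s.
Proof.
move=> /andP[s0 sp].
have := @is_derive_ge0_le (fun x => sin x - x * cos x) (fun x => x * sin x) 0 s s0.
rewrite sin0 mul0r subr0; apply.
- by move=> x _; apply: is_derive_eq; rewrite /GRing.scale/=; ring.
- move=> x /andP[x0 xs]; rewrite mulr_ge0// sin_ge0_pi// x0/=; exact: le_trans sp.
Qed.

Lemma sin_le s : 0 <= s -> sin s <= s.
Proof.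
move=> s0; rewrite -subr_ge0; suff : 0 - sin 0 <= s - sin s by rewrite sin0 subr0.
apply: (@is_derive_ge0_le (fun x => x - sin x) (fun x => 1 - cos x) 0 s s0).
by move=> x _; rewrite subr_ge0 cos_le1.
Qed.

(** At [s = 2 * d * k] this is [2 * d] times E(zeta(k)). Its derivative [deF] is a sum of squares
    divided by [s], whence strict monotonicity on [(0, pi)]. *)
Definition eF s := 1 - s * (cos s / sin s) + ln (s / sin s).
Definition deF s := ((1 - s * (cos s / sin s)) ^+ 2 + s ^+ 2) / s.

Lemma eF_derive s : 0 < s < pi -> is_derive s 1 eF (deF s).
Proof.
move=> /[dup] sp /andP[s0 _]; have sin0 := sin_gt0_pi sp.
have sn : sin s != 0 by rewrite gt_eqF.
have hV : is_derive s 1 (fun x => (sin x)^-1) (- (sin s) ^- 2 *: cos s).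
  exact: is_deriveV.
have h1 : is_derive s 1 (fun x => x / sin x) ((sin s - s * cos s) / sin s ^+ 2).
  apply: (is_derive_eq (is_deriveM (is_derive_id s 1) hV)).
  by rewrite /GRing.scale/=; field.
have h2 := @is_derive1_comp R (@ln R) (fun x => x / sin x) s _ _
   (is_derive1_ln (divr_gt0 s0 sin0)) h1.
have h3 : is_derive s 1 (fun x => 1 - x * (cos x / sin x))
    (- (cos s / sin s) + s / sin s ^+ 2).
  have h3 := is_deriveM (is_derive_cos s) hV.
  have h4 := is_deriveB (is_derive_cst (1 : R^o) (s : R^o) (1 : R^o)) (is_deriveM (is_derive_id s 1) h3).
  apply: (is_derive_eq h4); rewrite /GRing.scale/=.
  have -> : s / sin s ^+ 2 = s * (cos s ^+ 2 + sin s ^+ 2) / sin s ^+ 2.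
    by rewrite cos2Dsin2 mulr1.
  by rewrite fctE; field.
have h4 := is_deriveD h3 h2.
apply: (is_derive_eq h4); rewrite /deF.
have -> : ((1 - s * (cos s / sin s)) ^+ 2 + s ^+ 2) / s =
   1 / s - 2 * (cos s / sin s) + s * (cos s ^+ 2 + sin s ^+ 2) / sin s ^+ 2.
  by field; rewrite sn gt_eqF.
by rewrite cos2Dsin2; field; rewrite sn gt_eqF.
Qed.

Lemma deF_ge s : 0 < s -> s <= deF s.
Proof.
by move=> s0; rewrite /deF ler_pdivlMr// -expr2 lerDr sqr_ge0.
Qed.

Lemma one_sub_scot s : 0 < s < pi -> 0 <= 1 - s * (cos s / sin s) <= s / (1 + cos s).
Proof.
move=> /[dup] sp /andP[s0 sp']; have sin0 := sin_gt0_pi sp.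
have c1 : 0 < 1 + cos s.
  have := @ltr_cos R s pi; rewrite !in_itv/= (ltW s0) (ltW sp') pi_ge0 lexx/= cospi.
  by move=> /(_ isT isT); rewrite sp'; lra.
have -> : 1 - s * (cos s / sin s) = (sin s - s * cos s) / sin s.
  by field; rewrite gt_eqF.
apply/andP; split; first by rewrite divr_ge0 ?sin_sub_ge0 ?(ltW s0) ?ltW.
rewrite ler_pdivrMr// mulrAC ler_pdivlMr//.
have ss := sin_le (ltW s0); have cs := cos2Dsin2 s.
have h : sin s <= 1 by exact: sin_le1.
have c := cos_le1 s.
(* (sin s - s cos s)(1 + cos s) <= s (1 - cos s)(1 + cos s) = s sin^2 s <= s sin s *)
apply: (@le_trans _ _ (s * (1 - cos s) * (1 + cos s))).
  by rewrite ler_pM2r//; lra.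
have -> : s * (1 - cos s) * (1 + cos s) = s * sin s ^+ 2.
  have : sin s ^+ 2 = 1 - cos s ^+ 2 by lra.
  by move=> ->; ring.
by rewrite ler_pM2l// expr2 ler_piMr// ltW.
Qed.

Lemma eF_near0 s : 0 < s < pi -> 0 <= eF s <= 2 * (s / (1 + cos s)).
Proof.
move=> /[dup] sp /andP[s0 sp']; have sin0 := sin_gt0_pi sp.
have /andP[h1 h2] := one_sub_scot sp.
have c1 : 0 < 1 + cos s.
  have := @ltr_cos R s pi; rewrite !in_itv/= (ltW s0) (ltW sp') pi_ge0 lexx/= cospi.
  by move=> /(_ isT isT); rewrite sp'; lra.
have l0 : 0 <= ln (s / sin s) by rewrite ln_ge0// ler_pdivlMr// mul1r sin_le// ltW.
rewrite /eF addr_ge0//=.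
suff : ln (s / sin s) <= s / (1 + cos s) by lra.
have := @le_ln1Dx R (s / sin s - 1).
rewrite addrCA subrr addr0 => le1.
apply: (le_trans (le1 _)); first by rewrite ltrBrDr addNr divr_gt0.
have -> : s / sin s - 1 = (s - sin s) / sin s by field; rewrite gt_eqF.
rewrite ler_pdivrMr// mulrAC ler_pdivlMr//.
have ss := sin_sub_ge0; have := ss s; rewrite (ltW s0) (ltW sp') => /(_ isT) {}ss.
have cs := cos2Dsin2 s; have c := cos_le1 s; have h : sin s <= 1 by exact: sin_le1.
apply: (@le_trans _ _ (s * (1 - cos s) * (1 + cos s))).
  by rewrite ler_pM2r//; lra.
have -> : s * (1 - cos s) * (1 + cos s) = s * sin s ^+ 2.
  have : sin s ^+ 2 = 1 - cos s ^+ 2 by lra.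
  by move=> ->; ring.
by rewrite ler_pM2l// expr2 ler_piMr// ltW.
Qed.

(** Since [deF s >= s], the function [eF s - s ^+ 2 / 2] is nondecreasing. This quadratic growth
    makes the inverse function at most of square root order. *)
Lemma eF_growth s t : 0 < s -> s <= t -> t < pi -> (t ^+ 2 - s ^+ 2) / 2 <= eF t - eF s.
Proof.
move=> s0 st tp.
have := @is_derive_ge0_le (fun x => eF x - x ^+ 2 / 2) (fun x => deF x - x) s t st.
suff h : (forall x, s <= x <= t -> is_derive x 1 (fun x => eF x - x ^+ 2 / 2) (deF x - x)) /\
    (forall x, s <= x <= t -> 0 <= deF x - x).
  by move=> /(_ h.1 h.2); lra.
split=> x /andP[sx xt]; have x0 := lt_le_trans s0 sx.
  have := eF_derive (_ : 0 < x < pi); rewrite x0 (le_lt_trans xt)// => /(_ isT) h.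
  by apply: is_derive_eq; rewrite /GRing.scale/=; field.
by rewrite subr_ge0 deF_ge.
Qed.

Lemma eF_lt s t : 0 < s -> s < t -> t < pi -> eF s < eF t.
Proof.
move=> s0 st tp; have := eF_growth s0 (ltW st) tp.
have : s ^+ 2 < t ^+ 2 by rewrite ltrXn2r// ?nnegrE ltW// (lt_trans s0).
lra.
Qed.

Lemma eF_inj s t : 0 < s < pi -> 0 < t < pi -> eF s = eF t -> s = t.
Proof.
move=> /andP[s0 sp] /andP[t0 tp] e.
have [st|ts|//] := ltgtP s t.
  by have := eF_lt s0 st tp; rewrite e ltxx.
by have := eF_lt t0 ts sp; rewrite e ltxx.
Qed.

Lemma eF_cvg0 : eF x @[x --> 0^'+] --> (0 : R).
Proof.
have h : 2 * (x / (1 + cos x)) @[x --> (0 : R)^'+] --> (0 : R).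
  rewrite [X in _ --> X](_ : 0 = 2 * (0 / (1 + cos 0))); last by rewrite mul0r mulr0.
  apply: cvg_at_right_filter.
  apply: cvgM; first exact: cvg_cst.
  apply: cvgM; first exact: cvg_id.
  apply: cvgV; first by rewrite cos0 gt_eqF.
  by apply: cvgD; [exact: cvg_cst|exact: continuous_cos].
apply: (squeeze_cvgr _ (cvg_cst 0) h).
near=> x; apply: eF_near0; apply/andP; split; near: x.
  exact: nbhs_right_gt.
by apply: nbhs_right_lt; exact: pi_gt0.
Unshelve. all: by end_near. Qed.

(** This is [eF_growth] in the limit at 0. It cannot be read off at the endpoint itself, where the
    formula of [eF] takes the default value 1 instead of 0. *)
Lemma eF_ge s : 0 < s < pi -> s ^+ 2 / 2 <= eF s.
Proof.
move=> /andP[s0 sp].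
have h1 : (s ^+ 2 - x ^+ 2) / 2 @[x --> 0^'+] --> (s ^+ 2 - 0 ^+ 2) / 2.
  apply: cvg_at_right_filter; apply: cvgM; last exact: cvg_cst.
  by apply: cvgB; [exact: cvg_cst|exact: exprn_continuous].
have h2 : eF s - eF x @[x --> 0^'+] --> eF s - 0.
  by apply: cvgB; [exact: cvg_cst|exact: eF_cvg0].
rewrite -[leRHS]subr0 -[X in X / 2]subr0 -[X in (_ - X) / 2](expr0n _ 2).
apply: ler_cvg_to h1 h2 _.
near=> x; apply: eF_growth => //; near: x; exact: nbhs_right_le.
Unshelve. all: by end_near. Qed.

Lemma eF_surj v : 0 < v -> exists2 s, 0 < s < pi & eF s = v.
Proof.
move=> v0.
have [s1 [s10 s11]] : exists s1, 0 < s1 < pi / 2 /\ eF s1 <= v.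
  have /cvgrPdist_le /(_ v v0) := eF_cvg0 => h.
  near (0 : R)^'+ => x; exists x; split.
    apply/andP; split; near: x; first exact: nbhs_right_gt.
    by apply: nbhs_right_lt; rewrite divr_gt0// pi_gt0.
  have : `|0 - eF x| <= v by near: x.
  by rewrite sub0r normrN ler_norml => /andP[].
(* Near [pi] the term [ln (t / sin t)] exceeds [v], because [sin t < expR (- v)] and [t >= 1]. *)
have [t [t1 tp ht]] : exists t, [/\ pi / 2 < t, t < pi & sin t < expR (- v)].
  have ev : 0 < expR (- v) by exact: expR_gt0.
  have hs : sin x @[x --> (pi : R)^'-] --> (0 : R).
    by apply: cvg_at_left_filter; rewrite -(@sinpi R); exact: continuous_sin.
  near (pi : R)^'- => x; exists x; split => //.
  - by near: x; apply: nbhs_left_gt; have := @pi_gt0 R; lra.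
  - have : `|0 - sin x| < expR (- v) by near: x; move/cvgrPdist_lt: hs; apply.
    by rewrite sub0r normrN => /(le_lt_trans (ler_norm _)).
have p2 := @pi_ge2 R.
have t0 : 0 < t < pi by rewrite tp andbT; lra.
have st := sin_gt0_pi t0.
have et : v <= eF t.
  have /andP[h _] := one_sub_scot t0.
  apply: (@le_trans _ _ (ln (t / sin t))); last by rewrite /eF lerDr.
  rewrite ln_div ?posrE//; last by lra.
  have : 0 <= ln t by rewrite ln_ge0//; lra.
  have : ln (sin t) <= - v by rewrite -[leRHS]expRK ler_ln ?posrE ?expR_gt0// ltW.
  lra.
have st1 : s1 <= t by move: s10 => /andP[_ h]; lra.
have [s10' s10''] := andP s10.
have cont : {within `[s1, t], continuous eF}.
  apply: continuous_in_subspaceT => x; rewrite inE/= in_itv/= => /andP[sx xt].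
  apply: is_derive_continuous (eF_derive _).
  by rewrite (lt_le_trans s10' sx) (le_lt_trans xt tp).
have [|c] := IVT st1 cont (v := v).
  by rewrite ge_min s11 le_max et orbT.
rewrite in_itv/= => /andP[c1 c2] ec; exists c => //.
by rewrite (lt_le_trans s10' c1) (le_lt_trans c2 tp).
Unshelve. all: by end_near. Qed.

Lemma one_add_cos_gt0 s : 0 <= s < pi -> 0 < 1 + cos s.
Proof.
move=> /andP[s0 sp]; have := @ltr_cos R s pi.
rewrite !in_itv/= s0 (ltW sp) pi_ge0 lexx/= cospi.
by move=> /(_ isT isT); rewrite sp; lra.
Qed.

(** Linear control away from [pi]: [1 - s cot s <= s / (1 + cos s)], and [cos] decreases. It is
    applied with [t = 2 * d * kappa_max], which is less than [pi]. *)
Lemma deF_le s t : 0 < s -> s <= t -> t < pi -> deF s <= (1 + 1 / (1 + cos t) ^+ 2) * s.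
Proof.
move=> s0 st tp.
have t0 := lt_le_trans s0 st.
have ct : 0 < 1 + cos t by apply: one_add_cos_gt0; rewrite tp ltW.
have cst : cos t <= cos s.
  rewrite le_eqVlt; move: st; rewrite le_eqVlt => /orP[/eqP->|st]; first by rewrite eqxx.
  rewrite ltr_cos ?st ?orbT//; rewrite in_itv/=; apply/andP; split; apply: ltW => //.
  exact: lt_trans st tp.
have /one_sub_scot/andP[h1 h2] : 0 < s < pi by rewrite s0 (le_lt_trans st tp).
rewrite /deF ler_pdivrMr// mulrDl mul1r mulrDl -expr2 addrC lerD2l.
have h3 : 1 - s * (cos s / sin s) <= s / (1 + cos t).
  apply: (le_trans h2); rewrite ler_pM2l// lef_pV2 ?posrE//; lra.
have -> : 1 / (1 + cos t) ^+ 2 * s * s = (s / (1 + cos t)) ^+ 2.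
  by field; rewrite gt_eqF.
by rewrite ler_pXn2r// nnegrE// divr_ge0// ltW.
Qed.

Lemma deF_continuous s : 0 < s < pi -> {for s, continuous deF}.
Proof.
move=> /[dup] sp /andP[s0 _]; have sin0 := sin_gt0_pi sp.
have c1 : {for s, continuous (fun x => 1 - x * (cos x / sin x))}.
  apply: cvgB; first exact: cvg_cst.
  apply: cvgM; first exact: cvg_id.
  apply: cvgM; first exact: continuous_cos.
  by apply: cvgV; [rewrite gt_eqF|exact: continuous_sin].
apply: cvgM; last by apply: cvgV; [rewrite gt_eqF|exact: cvg_id].
apply: cvgD; last exact: exprn_continuous.
rewrite /deF expr2; under eq_fun do rewrite expr2.
exact: cvgM.
Qed.

Lemma measurable_cotM : measurable_fun setT (fun s => s * (cos s / sin s)).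
Proof.
apply: measurable_funM => //; apply: measurable_funM.
  exact: continuous_measurable_fun (@continuous_cos R).
by apply: measurable_funV; exact: continuous_measurable_fun (@continuous_sin R).
Qed.

Lemma measurable_eF : measurable_fun setT eF.
Proof.
apply: measurable_funD; first by apply: measurable_funB => //; exact: measurable_cotM.
apply: measurableT_comp; first exact: measurable_ln.
apply: measurable_funM => //.
by apply: measurable_funV; exact: continuous_measurable_fun (@continuous_sin R).
Qed.

Lemma measurable_deF : measurable_fun setT deF.
Proof.
apply: measurable_funM; last exact: measurable_funV.
apply: measurable_funD => //; apply: measurable_funX.
by apply: measurable_funB => //; exact: measurable_cotM.
Qed.

End cotangent_function.

(** * Branches of the Lambert function on the negative axis *)

Section lambert.
Local Open Scope complex_scope.
Context {R : realType}.
Implicit Types y p s : R.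

(** Parametrizes the negative axis so that the branch point -1/e is [y = 0]: the two real branches
    live over [y >= 0], the conjugate pair over [y < 0]. *)
Definition Warg y : R[i] := (- expR (-1 - y))%:C.

(** Writing [w = - p], the equation [w e^w = a] becomes [p - ln p = 1 + y], and the branch is
    selected by [p <= 1]. *)
Lemma W0_ge0 y : 0 <= y -> exists p, [/\ 0 < p <= 1, p - ln p = 1 + y &
  LambertW0 (Warg y) = (- p)%:C].
Proof.
move=> y0.
set P := fun w : R[i] => w * cexp w = Warg y /\ complex.Im (Warg y) = 0 /\
    ((- expR (-1) <= complex.Re (Warg y) < 0 /\ complex.Im w = 0 /\ -1 <= complex.Re w < 0)
     \/ (complex.Re (Warg y) < - expR (-1) /\ 0 < complex.Im w < pi)).
have ex : exists w, P w.
  (* At [p = expR (- (1 + y))] one has [p - ln p = p + 1 + y], and at 1 the value is 1, so [1 + y]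
     lies between. *)
  have e0 : 0 < expR (- (1 + y)) by exact: expR_gt0.
  have e1 : expR (- (1 + y)) <= 1 by rewrite -[leRHS]expR0 ler_expR; lra.
  have cont : {within `[expR (- (1 + y)), 1], continuous (fun p : R => p - ln p)}.
    apply: continuous_in_subspaceT => x; rewrite inE/= in_itv/= => /andP[x0 _].
    by apply: cvgB; [exact: cvg_id|apply: continuous_ln; exact: lt_le_trans x0].
  have [|p] := IVT e1 cont (v := 1 + y).
    rewrite ln1 subr0 expRK opprK ge_min le_max; apply/andP; split; apply/orP.
      by right; lra.
    by left; rewrite lerDr ltW.
  rewrite in_itv/= => /andP[p0' p1] pE; have p0 := lt_le_trans e0 p0'.
  exists (- p)%:C; rewrite /P; split; last first.
    split => //; left; rewrite /Warg/= lerN2 ler_expR oppr_lt0 expR_gt0; split; first lra.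
    split => //; lra.
  apply/eqP; rewrite eq_complex /= sin0 cos0 !mulr0 !mul0r subr0 addr0 mulr1 eqxx andbT.
  rewrite mulNr eqr_opp -{1}(lnK p0) -expRD; apply/eqP; congr expR; lra.
have := @xgetPex _ 0 P ex; rewrite -/(LambertW0 (Warg y)).
move: (LambertW0 _) => w [we [_ [[_ [iw /andP[w1 w0]]]|]]]; last first.
  by rewrite /Warg/= ltrN2 ltr_expR => -[h _]; exfalso; lra.
exists (- complex.Re w); split.
- by apply/andP; split; lra.
- move: we; case: w iw w1 w0 => a b /= -> a1 a0 /eqP.
  rewrite eq_complex /= sin0 cos0 !mulr0 !mul0r subr0 mulr1 => /andP[/eqP we _].
  have a0' : 0 < - a by lra.
  have : ln (- a * expR a) = ln (expR (-1 - y)) by congr ln; lra.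
  rewrite lnM ?posrE ?expR_gt0// !expRK; lra.
- by apply/eqP; rewrite eq_complex/= opprK eqxx iw eqxx.
Qed.

Lemma Wm1_ge0 y : 0 <= y -> exists p, [/\ 1 <= p, p - ln p = 1 + y &
  LambertWm1 (Warg y) = (- p)%:C].
Proof.
move=> y0.
set P := fun w : R[i] => w * cexp w = Warg y /\ complex.Im (Warg y) = 0 /\
    - expR (-1) <= complex.Re (Warg y) < 0 /\ complex.Im w = 0 /\ complex.Re w <= -1.
have nlt : (complex.Re (Warg y) < - expR (-1)) = false.
  by rewrite /Warg/= ltrN2 ltr_expR; apply/negbTE; rewrite -leNgt; lra.
have ex : exists w, P w.
  (* The right end [2 * (1 + y)] works because [ln 2 <= 1] and [ln (1 + y) <= y] give
     [ln (2 * (1 + y)) <= 1 + y]. *)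
  have e1 : 1 <= 2 * (1 + y) by lra.
  have cont : {within `[1, 2 * (1 + y)], continuous (fun p : R => p - ln p)}.
    apply: continuous_in_subspaceT => x; rewrite inE/= in_itv/= => /andP[x0 _].
    by apply: cvgB; [exact: cvg_id|apply: continuous_ln; lra].
  have [|p] := IVT e1 cont (v := 1 + y).
    rewrite ln1 subr0 ge_min le_max; apply/andP; split; apply/orP.
      by left; lra.
    right; rewrite lnM ?posrE//; last by lra.
    have h1 : ln (1 + 1) <= 1 :> R by apply: le_ln1Dx.
    have h2 : ln (1 + y) <= y by apply: le_ln1Dx; lra.
    have -> : 2 = 1 + 1 :> R by lra.
    lra.
  rewrite in_itv/= => /andP[p1 _] pE; have p0 : 0 < p by lra.
  exists (- p)%:C; rewrite /P; split; last first.
    split => //; rewrite /Warg/= lerN2 ler_expR oppr_lt0 expR_gt0 andbT; split; first lra.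
    split => //; lra.
  apply/eqP; rewrite eq_complex /= sin0 cos0 !mulr0 !mul0r subr0 addr0 mulr1 eqxx andbT.
  rewrite mulNr eqr_opp -{1}(lnK p0) -expRD; apply/eqP; congr expR; lra.
have := @xgetPex _ 0 P ex; have -> : xget 0 P = LambertWm1 (Warg y).
  by rewrite /LambertWm1 nlt.
move: (LambertWm1 _) => w [we [_ [_ [iw w1]]]].
exists (- complex.Re w); split; first lra.
- move: we; case: w iw w1 => a b /= -> a1 /eqP.
  rewrite eq_complex /= sin0 cos0 !mulr0 !mul0r subr0 mulr1 => /andP[/eqP we _].
  have a0' : 0 < - a by lra.
  have : ln (- a * expR a) = ln (expR (-1 - y)) by congr ln; lra.
  rewrite lnM ?posrE ?expR_gt0// !expRK; lra.
- by apply/eqP; rewrite eq_complex/= opprK eqxx iw eqxx.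
Qed.

Lemma expR_eF s : 0 < s < pi ->
  expR (- (s * (cos s / sin s))) * (s / sin s) = expR (eF s - 1).
Proof.
move=> /[dup] sp /andP[s0 _]; have sin0 := sin_gt0_pi sp.
rewrite -{1}(@lnK _ (s / sin s)) ?posrE ?divr_gt0// -expRD /eF; congr expR; lra.
Qed.

(** For [w = s' + i s], reality of [w e^w] forces [s' = - s cot s], and the product is then
    [- expR (eF s - 1)]; so the imaginary part of the branch inverts [eF]. *)
Lemma W0_lt0 y : y < 0 -> exists s, [/\ 0 < s < pi, eF s = - y &
  LambertW0 (Warg y) = (- (s * (cos s / sin s))) +i* s].
Proof.
move=> y0.
set P := fun w : R[i] => w * cexp w = Warg y /\ complex.Im (Warg y) = 0 /\
    ((- expR (-1) <= complex.Re (Warg y) < 0 /\ complex.Im w = 0 /\ -1 <= complex.Re w < 0)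
     \/ (complex.Re (Warg y) < - expR (-1) /\ 0 < complex.Im w < pi)).
have key s : 0 < s < pi -> sin s != 0 by move=> /sin_gt0_pi h; rewrite gt_eqF.
have main s : 0 < s < pi -> let r := - (s * (cos s / sin s)) in
   r * (expR r * cos s) - s * (expR r * sin s) = - expR (eF s - 1).
  move=> sp r; have sn := key s sp.
  rewrite -expR_eF// -/r.
  have -> : s / sin s = s * (cos s ^+ 2 + sin s ^+ 2) / sin s by rewrite cos2Dsin2 mulr1.
  move: (expR r) => E; rewrite /r; by field.
have ex : exists w, P w.
  have [s sp es] : exists2 s, 0 < s < pi & eF s = - y by apply: eF_surj; lra.
  exists ((- (s * (cos s / sin s))) +i* s); rewrite /P; split; last first.
    split => //; right; rewrite /Warg/= ltrN2 ltr_expR; split => //; lra.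
  apply/eqP; rewrite eq_complex /= main// es; apply/andP; split.
    by apply/eqP; congr (- expR _); lra.
  have sn := key s sp; apply/eqP; move: (expR _) => E; by field.
have := @xgetPex _ 0 P ex; rewrite -/(LambertW0 (Warg y)).
move: (LambertW0 _) => w [we [_ [[]|]]].
  by rewrite /Warg/= lerN2 ler_expR => /andP[h _]; exfalso; lra.
move=> [_ sp]; exists (complex.Im w).
move: we sp; case: w => r s /= /eqP; rewrite eq_complex/= => /andP[/eqP e1 /eqP e2] sp.
have sn := key s sp.
have rE : r = - (s * (cos s / sin s)).
  have : expR r * (r * sin s + s * cos s) = 0 by rewrite -e2; ring.
  move/eqP; rewrite mulf_eq0 gt_eqF ?expR_gt0//= => /eqP h.
  apply: (mulIf sn); have -> : r * sin s = - (s * cos s) by lra.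
  by field.
split => //; last by rewrite rE.
have := main s sp; rewrite /= -rE e1 => /eqP; rewrite eqr_opp => /eqP /expR_inj; lra.
Qed.

(** The inverse of [eF] on positive arguments, extended by 0 where the branch is real. *)
Definition sigmaW y : R := complex.Im (LambertW0 (Warg (- y))).
(** For [y >= 0], [P1 <= 1 <= P2] are the two roots of [p - ln p = 1 + y]; for [y < 0] both are
    minus the common real part of a conjugate pair, so their difference vanishes. *)
Definition P1 y : R := - complex.Re (LambertW0 (Warg y)).
Definition P2 y : R := - complex.Re (LambertWm1 (Warg y)).

Lemma Wm1_lt0 y : y < 0 -> LambertWm1 (Warg y) = cconj (LambertW0 (Warg y)).
Proof.
move=> y0; rewrite /LambertWm1 ifT// /Warg/= ltrN2 ltr_expR; lra.
Qed.

Lemma sigmaW_gt0 v : 0 < v -> 0 < sigmaW v < pi /\ eF (sigmaW v) = v.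
Proof.
move=> v0; have [|s [sp es we]] := @W0_lt0 (- v); first by lra.
by rewrite /sigmaW we/=; split => //; rewrite es opprK.
Qed.

Lemma sigmaW_le0 v : v <= 0 -> sigmaW v = 0.
Proof.
by move=> v0; have [|p [_ _ we]] := @W0_ge0 (- v); [lra|rewrite /sigmaW we].
Qed.

Lemma ImWm1 y : complex.Im (LambertWm1 (Warg y)) = - sigmaW (- y).
Proof.
have [y0|y0] := leP 0 y; last by rewrite Wm1_lt0// /sigmaW opprK.
have [p [_ _ ->]] := Wm1_ge0 y0.
by rewrite sigmaW_le0 ?oppr0//; lra.
Qed.

Lemma sigmaW_eF s : 0 < s < pi -> sigmaW (eF s) = s.
Proof.
move=> /[dup] sp /andP[s0 _].
have e0 : 0 < eF s by apply: lt_le_trans (eF_ge sp); rewrite divr_gt0// exprn_gt0.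
by have [h1 h2] := sigmaW_gt0 e0; exact: eF_inj.
Qed.

Lemma sigmaW_ge0 v : 0 <= sigmaW v.
Proof.
have [v0|v0] := leP v 0; first by rewrite sigmaW_le0.
by have [/andP[/ltW]] := sigmaW_gt0 v0.
Qed.

Lemma sigmaW_nd v w : v <= w -> sigmaW v <= sigmaW w.
Proof.
move=> vw; have [v0|v0] := leP v 0; first by rewrite (sigmaW_le0 v0) sigmaW_ge0.
have [/andP[a1 a2] a3] := sigmaW_gt0 v0.
have [/andP[b1 b2] b3] := sigmaW_gt0 (lt_le_trans v0 vw).
rewrite leNgt; apply/negP => /(eF_lt b1) /(_ a2); rewrite a3 b3 => h.
by have := lt_le_trans h vw; rewrite ltxx.
Qed.

Lemma measurable_sigmaW : measurable_fun setT sigmaW.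
Proof. by apply: nondecreasing_measurable => // v w *; exact: sigmaW_nd. Qed.

Lemma sigmaW_sqr v : sigmaW v ^+ 2 <= 2 * Num.max 0 v.
Proof.
have [v0|v0] := leP v 0; first by rewrite sigmaW_le0// expr0n mulr0.
have [h1 h2] := sigmaW_gt0 v0; have := eF_ge h1; rewrite h2; lra.
Qed.

End lambert.

(** * The gap between the two branches *)

Section lambert_gap.
Context {R : realType}.
Implicit Types x y p q : R.

Lemma ln_le_sqrt x : 0 < x -> ln x <= 2 * (Num.sqrt x - 1).
Proof.
move=> x0; have s0 : 0 < Num.sqrt x by rewrite sqrtr_gt0.
rewrite -{1}(sqr_sqrtr (ltW x0)) lnXn// -[leLHS]mulr_natl ler_pM2l//.
have := @le_ln1Dx R (Num.sqrt x - 1); rewrite addrCA subrr addr0; apply; lra.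
Qed.

Lemma ln_lt x : 0 < x -> x != 1 -> ln x < x - 1.
Proof.
move=> x0 x1; apply: le_lt_trans (ln_le_sqrt x0) _.
have : 0 < (Num.sqrt x - 1) ^+ 2.
  rewrite exprn_even_gt0//= subr_eq0; apply: contra x1 => /eqP s1.
  by rewrite -(sqr_sqrtr (ltW x0)) s1 expr1n.
rewrite sqrrB mulr1 expr1n sqr_sqrtr ?ltW//; lra.
Qed.

Lemma sub_ln_lt p q : 1 <= p -> p < q -> p - ln p < q - ln q.
Proof.
move=> p1 pq; have p0 : 0 < p by lra.
have q0 : 0 < q by lra.
have := @ln_lt (q / p) (divr_gt0 q0 p0).
have -> : q / p != 1 by rewrite gt_eqF// ltr_pdivlMr ?mul1r.
move=> /(_ isT); rewrite ln_div ?posrE//.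
have -> : q / p - 1 = (q - p) / p by field; rewrite gt_eqF.
have : (q - p) / p <= q - p by rewrite ler_pdivrMr// ler_peMr//; lra.
lra.
Qed.

Lemma sub_ln_gt p q : 0 < p -> p < q -> q <= 1 -> q - ln q < p - ln p.
Proof.
move=> p0 pq q1; have q0 : 0 < q by lra.
have := @ln_lt (p / q) (divr_gt0 p0 q0).
have -> : p / q != 1 by rewrite lt_eqF// ltr_pdivrMr ?mul1r.
move=> /(_ isT); rewrite ln_div ?posrE//.
have -> : p / q - 1 = - ((q - p) / q) by field; rewrite gt_eqF.
have : q - p <= (q - p) / q by rewrite ler_pdivlMr// ler_piMr//; lra.
lra.
Qed.

Lemma P2P y : 0 <= y -> 1 <= P2 y /\ P2 y - ln (P2 y) = 1 + y.
Proof. by move=> /Wm1_ge0[p [p1 pe we]]; rewrite /P2 we/= opprK. Qed.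

Lemma P1P y : 0 <= y -> 0 < P1 y <= 1 /\ P1 y - ln (P1 y) = 1 + y.
Proof. by move=> /W0_ge0[p [p1 pe we]]; rewrite /P1 we/= opprK. Qed.

Lemma P2_sub_ln p : 1 <= p -> P2 (p - ln p - 1) = p.
Proof.
move=> p1; have y0 : 0 <= p - ln p - 1.
  have := @le_ln1Dx R (p - 1); rewrite addrCA subrr addr0; lra.
have [q1 qe] := P2P y0; set q := P2 _ in q1 qe *.
have [pq|qp|//] := ltgtP p q.
  by have := sub_ln_lt p1 pq; lra.
by have := sub_ln_lt q1 qp; lra.
Qed.

Lemma P1_sub_ln p : 0 < p <= 1 -> P1 (p - ln p - 1) = p.
Proof.
move=> /andP[p0 p1]; have y0 : 0 <= p - ln p - 1.
  have := @le_ln1Dx R (p - 1); rewrite addrCA subrr addr0; lra.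
have [/andP[q0 q1] qe] := P1P y0; set q := P1 _ in q0 q1 qe *.
have [pq|qp|//] := ltgtP p q.
  by have := sub_ln_gt p0 pq q1; lra.
by have := sub_ln_gt q0 qp p1; lra.
Qed.

Lemma P2_gt1 y : 0 < y -> 1 < P2 y.
Proof.
move=> y0; have [h1 h2] := P2P (ltW y0); rewrite lt_neqAle h1 andbT.
by apply/eqP => h; move: h2; rewrite -h ln1; lra.
Qed.

Lemma P1_lt1 y : 0 < y -> P1 y < 1.
Proof.
move=> y0; have [/andP[_ h1] h2] := P1P (ltW y0); rewrite lt_neqAle h1 andbT.
by apply/eqP => h; move: h2; rewrite h ln1; lra.
Qed.

Lemma is_derive_sub_ln p : 0 < p -> is_derive p 1 (fun x : R => x - ln x - 1) (1 - p^-1).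
Proof.
move=> p0; have h := is_derive1_ln p0.
apply: (is_derive_eq (is_deriveB (is_deriveB (is_derive_id p 1) h) (is_derive_cst (1 : R^o) (p : R^o) (1 : R^o)))).
by rewrite subr0.
Qed.

Lemma P2_derive y : 0 < y -> is_derive y 1 P2 (P2 y / (P2 y - 1)).
Proof.
move=> y0; have [_ e] := P2P (ltW y0); have p1 := P2_gt1 y0.
set p := P2 y in p1 e *; have p0 : 0 < p by lra.
have -> : y = (fun x : R => x - ln x - 1) p by rewrite /= e; lra.
have -> : p / (p - 1) = (1 - p^-1)^-1.
  have -> : 1 - p^-1 = (p - 1) / p by field; rewrite gt_eqF.
  by rewrite invf_div.
apply: (@is_derive_inverse R (fun x : R => x - ln x - 1) P2 _ p).
- near=> x => /=; apply: P2_sub_ln; near: x; exact: lt_le_nbhsr.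
- near=> x; apply: is_derive_continuous (is_derive_sub_ln _); near: x.
  exact: lt_nbhsr.
- exact: is_derive_sub_ln.
- by rewrite subr_eq0 eq_sym invr_eq1 gt_eqF.
Unshelve. all: by end_near. Qed.

Lemma P1_derive y : 0 < y -> is_derive y 1 P1 (- (P1 y / (1 - P1 y))).
Proof.
move=> y0; have [/andP[p0 _] e] := P1P (ltW y0); have p1 := P1_lt1 y0.
set p := P1 y in p0 p1 e *.
have -> : y = (fun x : R => x - ln x - 1) p by rewrite /= e; lra.
have -> : - (p / (1 - p)) = (1 - p^-1)^-1.
  have -> : 1 - p^-1 = - ((1 - p) / p) by field; rewrite gt_eqF.
  by rewrite invrN invf_div.
apply: (@is_derive_inverse R (fun x : R => x - ln x - 1) P1 _ p).
- near=> x => /=; apply: P1_sub_ln; apply/andP; split; near: x; first exact: lt_nbhsr.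
  exact: lt_le_nbhsl.
- near=> x; apply: is_derive_continuous (is_derive_sub_ln _); near: x.
  exact: lt_nbhsr.
- exact: is_derive_sub_ln.
- by rewrite subr_eq0 eq_sym invr_eq1 lt_eqF.
Unshelve. all: by end_near. Qed.

Definition gapW y := P2 y - P1 y.
Definition dgapW y := P2 y / (P2 y - 1) + P1 y / (1 - P1 y).

Lemma gapW_derive y : 0 < y -> is_derive y 1 gapW (dgapW y).
Proof.
move=> y0; have h2 := P2_derive y0; have h1 := P1_derive y0.
by apply: (is_derive_eq (is_deriveB h2 h1)); rewrite opprK.
Qed.

Lemma gapW_le0 y : y <= 0 -> gapW y = 0.
Proof.
rewrite /gapW; have [y0 _|y0|-> _] := ltgtP y 0.
- by rewrite /P2 /P1 Wm1_lt0// /cconj; case: (LambertW0 _) => a b /=; rewrite subrr.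
- by [].
- have /P2P[a1 a2] : (0 : R) <= 0 by [].
  have /P1P[/andP[b0 b1] b2] : (0 : R) <= 0 by [].
  have := P2_sub_ln (lexx (1 : R)); have := @P1_sub_ln 1; rewrite ltr01 lexx => /(_ isT).
  by rewrite ln1 subr0 subrr => -> ->; rewrite subrr.
Qed.

(** The bound [ln p <= 2 * (Num.sqrt p - 1)] gives [(Num.sqrt p - 1) ^+ 2 <= y] for both roots, so
    each square root differs from 1 by at most [Num.sqrt y]. *)
Lemma gapW_bounds y : 0 <= y -> 0 <= gapW y <= 4 * Num.sqrt y + y.
Proof.
move=> y0; have [a1 ae] := P2P y0; have [/andP[b0 b1] be] := P1P y0.
have a0 : 0 < P2 y by lra.
have ha := ln_le_sqrt a0; have hb := ln_le_sqrt b0.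
have sa := sqr_sqrtr (ltW a0); have sb := sqr_sqrtr (ltW b0).
have sy := sqr_sqrtr y0.
have sa0 := sqrtr_ge0 (P2 y); have sb0 := sqrtr_ge0 (P1 y); have sy0 := sqrtr_ge0 y.
have sa1 : 1 <= Num.sqrt (P2 y) by rewrite -[leLHS]sqrtr1 ler_wsqrtr.
have sb1 : Num.sqrt (P1 y) <= 1 by rewrite -[leRHS]sqrtr1 ler_wsqrtr.
have h1 : Num.sqrt (P2 y) - 1 <= Num.sqrt y.
  rewrite -ler_sqr ?nnegrE ?subr_ge0// sy sqrrB1 sa; lra.
have h2 : 1 - Num.sqrt (P1 y) <= Num.sqrt y.
  rewrite -ler_sqr ?nnegrE ?subr_ge0// sy -sqrrN opprB sqrrB1 sb; lra.
apply/andP; split; first by rewrite /gapW; lra.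
rewrite /gapW -sa -sb; move: sy h1 h2 sa1 sb1 sa0 sb0 sy0; rewrite !expr2.
move: (Num.sqrt (P2 y)) (Num.sqrt (P1 y)) (Num.sqrt y) => A B S *; nra.
Qed.

Lemma gapW_ge0 y : 0 <= gapW y.
Proof.
have [y0|/ltW y0] := leP y 0; first by rewrite gapW_le0.
by have /andP[] := gapW_bounds y0.
Qed.

Lemma gapW_continuous : continuous gapW.
Proof.
move=> y; have [y0|y0|->] := ltgtP y 0.
- rewrite /continuous_at gapW_le0 ?ltW//; apply: cvg_near_cst.
  by near=> x; rewrite gapW_le0//; near: x; exact: lt_le_nbhsl.
- exact: is_derive_continuous (gapW_derive y0).
- rewrite /continuous_at gapW_le0//.
  have h : 4 * Num.sqrt `|x| + `|x| @[x --> (0 : R)] --> 4 * Num.sqrt `|0 : R| + `|0 : R|.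
    apply: cvgD; last exact: (@norm_continuous _ R^o 0).
    apply: cvgM; first exact: cvg_cst.
    have c : continuous ((@Num.sqrt R) \o (@Num.norm R R^o)).
      by move=> z; apply: continuous_comp; [exact: norm_continuous|exact: sqrt_continuous].
    exact: (c 0).
  rewrite normr0 sqrtr0 mulr0 addr0 in h.
  apply: (squeeze_cvgr _ (cvg_cst 0) h).
  near=> x; rewrite gapW_ge0/=.
  have [x0|x0] := leP x 0; first by rewrite gapW_le0// addr_ge0// mulr_ge0// sqrtr_ge0.
  by rewrite (ger0_norm (ltW x0)); have /andP[] := gapW_bounds (ltW x0).
Unshelve. all: by end_near. Qed.

Lemma dgapW_ge0 y : 0 < y -> 0 <= dgapW y.
Proof.
move=> y0; have [/andP[b0 _] _] := P1P (ltW y0).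
have p1 := P2_gt1 y0; have p2 := P1_lt1 y0.
by rewrite /dgapW addr_ge0// divr_ge0//; lra.
Qed.

(** From [p - ln p - 1 <= (p - 1) ^+ 2 / p] at both roots, [1 / (P2 - 1)] and [P1 / (1 - P1)] are
    each at most [1 / Num.sqrt y]. *)
Lemma dgapW_le y : 0 < y -> dgapW y <= 1 + 2 / Num.sqrt y.
Proof.
move=> y0; have [a1 ae] := P2P (ltW y0); have [/andP[b0 b1] be] := P1P (ltW y0).
have a0 : 0 < P2 y by lra.
have p1 := P2_gt1 y0; have p2 := P1_lt1 y0.
have s0 : 0 < Num.sqrt y by rewrite sqrtr_gt0.
have lnV_le p : 0 < p -> p - ln p - 1 <= (p - 1) ^+ 2 / p.
  move=> p0; have := @le_ln1Dx R (p^-1 - 1); rewrite addrCA subrr addr0 lnV ?posrE//.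
  have -> : (p - 1) ^+ 2 / p = p - 2 + p^-1 by field; rewrite gt_eqF.
  have : 0 < p^-1 by rewrite invr_gt0.
  move=> h1 h2; have := h2 _; lra.
have ha : Num.sqrt y <= P2 y - 1.
  rewrite -[leRHS](@ger0_norm _ (P2 y - 1)); last by lra.
  rewrite -sqrtr_sqr ler_wsqrtr//; have := lnV_le _ a0.
  have : (P2 y - 1) ^+ 2 / P2 y <= (P2 y - 1) ^+ 2.
    by rewrite ler_pdivrMr// ler_peMr ?sqr_ge0.
  lra.
have hb : Num.sqrt y * P1 y <= 1 - P1 y.
  have sb := sqr_sqrtr (ltW b0); have sb0 : 0 < Num.sqrt (P1 y) by rewrite sqrtr_gt0.
  have sb1 : Num.sqrt (P1 y) <= 1 by rewrite -[leRHS]sqrtr1 ler_wsqrtr.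
  have h : Num.sqrt y * Num.sqrt (P1 y) <= 1 - P1 y.
    rewrite -[leRHS](@ger0_norm _ (1 - P1 y)); last by lra.
    rewrite -sqrtr_sqr -(sqrtrM _ (ltW y0)) ler_wsqrtr//.
    have := lnV_le _ b0; rewrite ler_pdivlMr// -sqrrN opprB; nra.
  apply: le_trans h; rewrite ler_pM2l// -{1}sb expr2 ler_piMl//; exact: ltW.
have -> : 1 + 2 / Num.sqrt y = (1 + (Num.sqrt y)^-1) + (Num.sqrt y)^-1 by field; rewrite gt_eqF.
rewrite /dgapW lerD//.
- have -> : P2 y / (P2 y - 1) = 1 + (P2 y - 1)^-1 by field; rewrite gt_eqF// subr_gt0.
  by rewrite lerD2l lef_pV2 ?posrE// subr_gt0.
- by rewrite ler_pdivrMr ?subr_gt0// mulrC ler_pdivlMr// mulrC.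
Qed.

Lemma dgapW_continuous y : 0 < y -> {for y, continuous dgapW}.
Proof.
move=> y0; have c2 := is_derive_continuous (P2_derive y0).
have c1 := is_derive_continuous (P1_derive y0).
have p1 := P2_gt1 y0; have p2 := P1_lt1 y0.
apply: cvgD; apply: cvgM; try exact: c1; try exact: c2.
- apply: cvgV; first by rewrite subr_eq0 gt_eqF.
  by apply: cvgB; [exact: c2|exact: cvg_cst].
- apply: cvgV; first by rewrite subr_eq0 gt_eqF.
  by apply: cvgB; [exact: cvg_cst|exact: c1].
Qed.

Lemma measurable_dgapW : measurable_fun setT (fun y => if 0 < y then dgapW y else 0).
Proof.
have -> : (fun y => if 0 < y then dgapW y else 0) = dgapW \_ `]0, +oo[%classic.
  by apply/funext => y; rewrite patchE mem_setE in_itv/= andbT.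
apply/(measurable_restrictT _ _).1 => //.
by apply: open_continuous_measurable_fun => // y; rewrite inE/= in_itv/= andbT; exact: dgapW_continuous.
Qed.

End lambert_gap.

(** * The function E along the curve zeta, and its inverse *)

Section spectral_curve.
Local Open Scope complex_scope.
Context {R : realType}.
Implicit Types d k u s : R.

Definition Ek d k : R := eF (2 * d * k) / (2 * d).

Lemma cos_sin_uniq s t : 0 < s < pi -> - pi < t <= pi ->
  cos t = cos s -> sin t = sin s -> t = s :> R.
Proof.
move=> /[dup] sp /andP[s0 s1] /andP[t0 t1] ct st.
have ss := sin_gt0_pi sp.
have tp : 0 <= t.
  rewrite leNgt; apply/negP => tn.
  have : 0 <= sin (- t) by apply: sin_ge0_pi; apply/andP; split; lra.
  by rewrite sinN st; lra.
by apply: cos_inj => //; rewrite in_itv/= ?tp ?t1// !ltW.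
Qed.

Lemma zeta_scaled d k : 0 < d -> 0 < 2 * d * k < pi ->
  (2 * d)%:C * zeta d k = (2 * d * k * (cos (2 * d * k) / sin (2 * d * k))) +i* (2 * d * k).
Proof.
move=> d0 /andP[s0 _]; have k0 : k != 0.
  by apply: contraTneq s0 => ->; rewrite mulr0 ltxx.
rewrite /zeta (negbTE k0); apply/eqP; rewrite eq_complex/= /cot.
by apply/andP; split; apply/eqP; ring.
Qed.

(** In polar form [2 d zeta = (s / sin s) (cos s + i sin s)] with [s = 2 * d * k] in [(0, pi)], so
    the principal argument is [s] itself. *)
Lemma cLog_zeta d k : 0 < d -> 0 < 2 * d * k < pi ->
  cLog ((2 * d)%:C * zeta d k) =
  ln (2 * d * k / sin (2 * d * k)) +i* (2 * d * k).
Proof.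
move=> d0 sp; rewrite zeta_scaled//; set s := 2 * d * k in sp *.
have /andP[s0 s1] := sp; have ss := sin_gt0_pi sp.
have nE : cabs ((s * (cos s / sin s)) +i* s) = s / sin s.
  rewrite /cabs/=; have -> : (s * (cos s / sin s)) ^+ 2 + s ^+ 2 = (s / sin s) ^+ 2.
    have -> : (s * (cos s / sin s)) ^+ 2 + s ^+ 2 =
      s ^+ 2 * (cos s ^+ 2 + sin s ^+ 2) / sin s ^+ 2 by field; rewrite gt_eqF.
    by rewrite cos2Dsin2; field; rewrite gt_eqF.
  by rewrite sqrtr_sqr ger0_norm// divr_ge0// ltW.
rewrite /cLog nE; congr (_ +i* _).
rewrite /cArg; apply: xget_subset1.
- split; first by apply/andP; split; lra.
  rewrite nE; apply/eqP; rewrite eq_complex/=.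
  by apply/andP; split; apply/eqP; field; rewrite gt_eqF.
- have key t : - pi < t <= pi /\ (s * (cos s / sin s)) +i* s =
     (cabs ((s * (cos s / sin s)) +i* s) * cos t) +i* (cabs ((s * (cos s / sin s)) +i* s) * sin t) -> t = s.
    move=> [tp]; rewrite nE => -[e1 e2]; apply: cos_sin_uniq => //.
      apply: (@mulfI _ (s / sin s)); first by rewrite gt_eqF// divr_gt0.
      by rewrite -e1; ring.
    apply: (@mulfI _ (s / sin s)); first by rewrite gt_eqF// divr_gt0.
    by rewrite -e2; field; rewrite gt_eqF.
  by move=> t1 t2 /key -> /key ->.
Qed.

(** The imaginary parts cancel: [- k] from [- zeta] against [2 * d * k / (2 * d)] from the
    logarithm. *)
Lemma Efn_zeta d k : 0 < d -> 0 < 2 * d * k < pi -> Efn d (zeta d k) = (Ek d k)%:C.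
Proof.
move=> d0 sp; rewrite /Efn cLog_zeta//.
have k0 : k != 0 by move: sp => /andP[+ _]; apply: contraTneq => ->; rewrite mulr0 ltxx.
have ss := sin_gt0_pi sp.
rewrite /zeta (negbTE k0) /Ek /eF /cot; apply/eqP; rewrite eq_complex/=.
have dn : d != 0 by rewrite gt_eqF.
move: (ln _) => l; apply/andP; split; apply/eqP.
  by field; rewrite dn gt_eqF.
by field.
Qed.

(** The phase [- 2 d k] of the exponential cancels the argument of zeta, so the Lambert argument is
    real and depends on [k] and [u] only through [u - Ek d k]. *)
Lemma aW_Warg d k u : 0 < d -> 0 < 2 * d * k < pi ->
  aW d k u = Warg (2 * d * (u - Ek d k)).
Proof.
move=> d0 sp; have ss := sin_gt0_pi sp.
have k0 : k != 0 by move: sp => /andP[+ _]; apply: contraTneq => ->; rewrite mulr0 ltxx.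
have dn : d != 0 by rewrite gt_eqF.
have sn : sin (2 * d * k) != 0 by rewrite gt_eqF.
rewrite /aW /Warg.
have -> : -1 - 2 * d * (u - Ek d k) = (eF (2 * d * k) - 1) - 2 * d * u.
  by rewrite /Ek; field.
rewrite expRD -expR_eF// /zeta (negbTE k0) /cot.
apply/eqP; rewrite eq_complex/=.
have -> : - (2 * d) * (k * (cos (2 * d * k) / sin (2 * d * k)) + u) - - 0 * (k + 0) =
  - (2 * d * k * (cos (2 * d * k) / sin (2 * d * k))) - 2 * d * u by ring.
have -> : - (2 * d) * (k + 0) + - 0 * (k * (cos (2 * d * k) / sin (2 * d * k)) + u) =
  - (2 * d * k) by ring.
rewrite cosN sinN expRD.
move: (expR _) (expR _) => E1 E2.
have -> : 2 * d * k / sin (2 * d * k) =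
  2 * d * k * (cos (2 * d * k) ^+ 2 + sin (2 * d * k) ^+ 2) / sin (2 * d * k).
  by rewrite cos2Dsin2 mulr1.
by apply/andP; split; apply/eqP; field.
Qed.

Lemma kappa_maxE d u : 0 < d -> kappa_max d u = sigmaW (2 * d * u) / (2 * d).
Proof.
move=> d0; rewrite /kappa_max.
have -> : (- expR (2 * d * u - 1))%:C = Warg (- (2 * d * u)).
  by rewrite /Warg opprK addrC.
have := @ImWm1 R (- (2 * d * u)); rewrite opprK; case: (LambertWm1 _) => a b /= ->.
have dn : d != 0 by rewrite gt_eqF.
by field.
Qed.

Section fixed_depth.
Variables (d umax : R).
Hypotheses (d0 : 0 < d) (umax0 : 0 < umax).
Let km := kappa_max d umax.

Lemma kappa_max_pi : 0 < 2 * d * km < pi /\ Ek d km = umax.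
Proof.
have u0 : 0 < 2 * d * umax by rewrite !mulr_gt0.
have [h1 h2] := sigmaW_gt0 u0.
have e : 2 * d * km = sigmaW (2 * d * umax).
  by rewrite /km kappa_maxE//; field; rewrite gt_eqF.
by rewrite e; split => //; rewrite /Ek e h2; field; rewrite gt_eqF.
Qed.

Lemma kappa_max_gt0 : 0 < km.
Proof. by have [/andP[+ _] _] := kappa_max_pi; rewrite pmulr_rgt0// mulr_gt0. Qed.

Lemma kappa_pi k : 0 < k <= km -> 0 < 2 * d * k < pi.
Proof.
move=> /andP[k0 kk]; have [/andP[_ h] _] := kappa_max_pi.
rewrite !mulr_gt0//=; apply: le_lt_trans h; rewrite ler_pM2l// mulr_gt0//.
Qed.

Lemma Ek_growth k l : 0 < k -> k <= l -> l <= km ->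
  d * (l ^+ 2 - k ^+ 2) <= Ek d l - Ek d k.
Proof.
move=> k0 kl lk; have dd : 0 < 2 * d by rewrite mulr_gt0.
have kp : 0 < 2 * d * k < pi by apply: kappa_pi; rewrite k0 (le_trans kl).
have lp : 0 < 2 * d * l < pi by apply: kappa_pi; rewrite lk andbT (lt_le_trans k0).
have := @eF_growth R (2 * d * k) (2 * d * l).
move: kp lp => /andP[-> _] /andP[_ ->]; rewrite ler_pM2l// => /(_ isT kl isT).
rewrite /Ek -mulrBl ler_pdivlMr//; apply: le_trans.
by apply/eqP/eqP; rewrite le_eqVlt; apply/orP; left; apply/eqP; field.
Qed.

Lemma Ek_lt k l : 0 < k -> k < l -> l <= km -> Ek d k < Ek d l.
Proof.
move=> k0 kl lk; have := Ek_growth k0 (ltW kl) lk.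
have : 0 < d * (l ^+ 2 - k ^+ 2).
  by rewrite mulr_gt0// subr_gt0 ltrXn2r// ?nnegrE ltW// (lt_trans k0).
lra.
Qed.

Lemma Ek_gt0 k : 0 < k <= km -> 0 < Ek d k.
Proof.
move=> kk; have kp := kappa_pi kk; rewrite divr_gt0//; last by rewrite mulr_gt0.
by apply: lt_le_trans (eF_ge kp); rewrite divr_gt0// exprn_gt0//; case/andP: kp.
Qed.

Lemma Ek_derive k : 0 < 2 * d * k < pi -> is_derive k 1 (Ek d) (deF (2 * d * k)).
Proof.
move=> kp; have h1 : is_derive k 1 (fun x : R => 2 * d * x) (2 * d).
  by apply: is_derive_eq; rewrite /GRing.scale/= mulr1.
have h2 := @is_derive1_comp R eF _ k _ _ (eF_derive kp) h1.
have -> : Ek d = (2 * d)^-1 \*: (eF \o (fun x : R => 2 * d * x)).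
  by apply/funext => x; rewrite /Ek /= mulrC.
apply: (is_derive_eq (@is_deriveZ _ _ _ _ (2 * d)^-1 _ _ _ h2)).
by rewrite /GRing.scale/=; field; rewrite gt_eqF.
Qed.

(* inverse of [Ek d] on positive arguments, and [0] on nonpositive ones *)
Definition Kinv u := sigmaW (2 * d * u) / (2 * d).

Lemma Kinv_gt0 u : 0 < u <= umax -> 0 < Kinv u <= km /\ Ek d (Kinv u) = u.
Proof.
move=> /andP[u0 uu]; have du : 0 < 2 * d * u by rewrite !mulr_gt0.
have [/andP[h1 h1'] h2] := sigmaW_gt0 du; split.
  rewrite /Kinv divr_gt0 ?mulr_gt0//= /km kappa_maxE// ler_pM2r ?invr_gt0 ?mulr_gt0//.
  by apply: sigmaW_nd; rewrite ler_pM2l// mulr_gt0.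
rewrite /Ek /Kinv; have -> : 2 * d * (sigmaW (2 * d * u) / (2 * d)) = sigmaW (2 * d * u).
  by field; rewrite gt_eqF.
by rewrite h2; field; rewrite gt_eqF.
Qed.

Lemma Kinv_Ek k : 0 < k <= km -> Kinv (Ek d k) = k.
Proof.
move=> /kappa_pi kp; rewrite /Kinv /Ek.
have -> : 2 * d * (eF (2 * d * k) / (2 * d)) = eF (2 * d * k) by field; rewrite gt_eqF.
by rewrite sigmaW_eF//; field; rewrite gt_eqF.
Qed.

Lemma Kinv_le0 u : u <= 0 -> Kinv u = 0.
Proof. by move=> u0; rewrite /Kinv sigmaW_le0 ?mul0r// pmulr_rle0// mulr_gt0. Qed.

Lemma Kinv_ge0 u : 0 <= Kinv u.
Proof. by rewrite divr_ge0 ?sigmaW_ge0// mulr_ge0// ltW. Qed.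

Lemma Kinv_nd u v : u <= v -> Kinv u <= Kinv v.
Proof.
move=> uv; rewrite ler_pM2r ?invr_gt0 ?mulr_gt0//; apply: sigmaW_nd.
by rewrite ler_pM2l// mulr_gt0.
Qed.

Lemma Kinv_le_sqrt u : 0 <= u -> Kinv u <= Num.sqrt (1 / d) * Num.sqrt u.
Proof.
move=> u0; rewrite -sqrtrM; last by rewrite divr_ge0// ltW.
rewrite -[leLHS](ger0_norm (Kinv_ge0 u)) -sqrtr_sqr ler_wsqrtr//.
rewrite /Kinv expr_div_n ler_pdivrMr ?exprn_gt0 ?mulr_gt0//.
have := @sigmaW_sqr R (2 * d * u); rewrite max_r; last by rewrite !mulr_ge0// ltW.
move=> /le_trans; apply; rewrite le_eqVlt; apply/orP; left; apply/eqP.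
by field; rewrite gt_eqF.
Qed.

(* the integrand of [thetaplus] *)
Lemma Ek_Kinv_bound k u : 0 < k <= km -> 0 <= u ->
  0 <= k - Kinv (Ek d k - u) <= Num.sqrt (1 / d) * Num.sqrt u.
Proof.
move=> kk u0; have /andP[k0 kk'] := kk; apply/andP; split.
  rewrite subr_ge0 -[leRHS](Kinv_Ek kk); apply: Kinv_nd; lra.
rewrite -sqrtrM; last by rewrite divr_ge0// ltW.
have [le0|gt0] := leP (Ek d k - u) 0.
  rewrite Kinv_le0// subr0 -[leLHS](ger0_norm (ltW k0)) -sqrtr_sqr ler_wsqrtr//.
  have Ee : k ^+ 2 * d <= Ek d k.
    have kp := kappa_pi kk; have := eF_ge kp.
    rewrite /Ek ler_pdivlMr ?mulr_gt0//; apply: le_trans.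
    by rewrite le_eqVlt; apply/orP; left; apply/eqP; field.
  by rewrite mul1r mulrC ler_pdivlMr//; lra.
have EkU : Ek d k <= umax.
  have [_ <-] := kappa_max_pi; move: kk'; rewrite le_eqVlt => /orP[/eqP->//|kk''].
  exact: ltW (Ek_lt k0 kk'' (lexx _)).
have [|/andP[l0 l1] le] := @Kinv_gt0 (Ek d k - u); first by apply/andP; split; lra.
set l := Kinv _ in l0 l1 le *.
have lk : l <= k by rewrite -[leRHS](Kinv_Ek kk); apply: Kinv_nd; lra.
have := Ek_growth l0 lk kk'; rewrite le => h.
rewrite -[leLHS]ger0_norm ?subr_ge0// -sqrtr_sqr ler_wsqrtr//.
rewrite mul1r mulrC ler_pdivlMr//; nra.
Qed.

End fixed_depth.
End spectral_curve.

(** * The initial profile and its turning points *)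

Section profile.
Local Open Scope complex_scope.
Context {R : realType}.
Notation leb := (@lebesgue_measure R).
Variables (d : R) (u0 : R -> R) (xmax : R).
Hypotheses (d0 : 0 < d) (adm : admissible u0 xmax).
Let km := kappa_max d (u0 xmax).

Lemma u0_derivable x : derivable u0 x 1. Proof. exact: adm.1. Qed.
Lemma u0_gt0 x : 0 < u0 x. Proof. exact: adm.2.2.1. Qed.
Lemma u0_le x : u0 x <= u0 xmax. Proof. exact: adm.2.2.2.2.2.2.1. Qed.
Lemma u0_crit x : derive1 u0 x = 0 -> x = xmax.
Proof. by move/(adm.2.2.2.2.2.2.2.1 x).1. Qed.
Lemma sqrt_u0_int : leb.-integrable setT (fun x => (Num.sqrt (u0 x))%:E).
Proof. exact: adm.2.2.2.2.2.2.2.2. Qed.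

Lemma u0_continuous : continuous u0.
Proof. by move=> x; apply/differentiable_continuous/derivable1_diffP/u0_derivable. Qed.

Lemma u0_measurable : measurable_fun setT u0.
Proof. exact: continuous_measurable_fun u0_continuous. Qed.

Lemma u0_no_Rolle x y : x < y -> u0 x = u0 y -> x < xmax < y.
Proof.
move=> xy e; have [||c] := @Rolle R u0 x y xy _ _ e.
- by move=> z _; exact: u0_derivable.
- exact/continuous_subspaceT/u0_continuous.
rewrite in_itv/= => cxy [_ dc]; suff <- : c = xmax by [].
by apply: u0_crit; rewrite derive1E.
Qed.

(** A reversed inequality would, by the intermediate value theorem between [y] and [xmax], produce
    two points not beyond [xmax] with equal values, which [u0_no_Rolle] excludes. *)
Lemma u0_incr x y : x < y -> y <= xmax -> u0 x < u0 y.
Proof.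
move=> xy yx; rewrite ltNge; apply/negP; rewrite le_eqVlt => /orP[/eqP e|lt].
  by have /andP[_] := u0_no_Rolle xy (esym e); rewrite ltNge yx.
have [|z] := @IVT R u0 y xmax (u0 x) yx (continuous_subspaceT u0_continuous).
  by rewrite ge_min le_max (ltW lt) u0_le orbT.
rewrite in_itv/= => /andP[yz zx] e; have xz := lt_le_trans xy yz.
by have /andP[_] := u0_no_Rolle xz (esym e); rewrite ltNge zx.
Qed.

Lemma u0_decr x y : xmax <= x -> x < y -> u0 y < u0 x.
Proof.
move=> xx xy; rewrite ltNge; apply/negP; rewrite le_eqVlt => /orP[/eqP e|lt].
  by have /andP[] := u0_no_Rolle xy e; rewrite ltNge xx.
have [|z] := @IVT R u0 xmax x (u0 y) xx (continuous_subspaceT u0_continuous).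
  by rewrite ge_min le_max (ltW lt) u0_le orbT.
rewrite in_itv/= => /andP[xz zx] e; have zy := le_lt_trans zx xy.
by have /andP[] := u0_no_Rolle zy e; rewrite ltNge xz.
Qed.

Lemma u0_pinfty v : 0 < v -> exists x, xmax <= x /\ u0 x <= v.
Proof.
move=> v0; have /cvgrPdist_le /(_ _ v0) h := adm.2.2.2.1.
near (pinfty_nbhs R) => x; exists x; split.
  by near: x; apply: nbhs_pinfty_ge; exact: num_real.
have : `|0 - u0 x| <= v by near: x.
by rewrite sub0r normrN => /(le_trans (ler_norm _)).
Unshelve. all: by end_near. Qed.

Lemma u0_ninfty v : 0 < v -> exists x, x <= xmax /\ u0 x <= v.
Proof.
move=> v0; have /cvgrPdist_le /(_ _ v0) h := adm.2.2.2.2.1.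
near (ninfty_nbhs R) => x; exists x; split.
  by near: x; apply: nbhs_ninfty_le; exact: num_real.
have : `|0 - u0 x| <= v by near: x.
by rewrite sub0r normrN => /(le_trans (ler_norm _)).
Unshelve. all: by end_near. Qed.

Lemma umax_gt0 : 0 < u0 xmax. Proof. exact: u0_gt0. Qed.

Lemma Ek_le_umax k : 0 < k <= km -> Ek d k <= u0 xmax.
Proof.
move=> /andP[k0 kk]; have [_ <-] := kappa_max_pi d0 umax_gt0.
move: kk; rewrite le_eqVlt => /orP[/eqP->//|kk].
exact: ltW (Ek_lt d0 umax_gt0 k0 kk (lexx _)).
Qed.

Lemma xplusP k : 0 < k <= km ->
  xmax <= xplus d u0 xmax k /\ u0 (xplus d u0 xmax k) = Ek d k.
Proof.
move=> kk; have E0 := Ek_gt0 d0 umax_gt0 kk.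
have kp := kappa_pi d0 umax_gt0 kk.
have [|h1] := @xgetPex R 0 (fun x : R => xmax <= x /\ (u0 x)%:C = Efn d (zeta d k)).
  have [x [xx ux]] := u0_pinfty E0.
  have [|z] := @IVT R u0 xmax x (Ek d k) xx (continuous_subspaceT u0_continuous).
    by rewrite ge_min le_max ux Ek_le_umax// orbT.
  rewrite in_itv/= => /andP[xz _] e; exists z; split => //.
  by rewrite Efn_zeta// e.
by rewrite -/(xplus d u0 xmax k) in h1 * => + ; rewrite Efn_zeta// => -[h2].
Qed.

Lemma xminusP k : 0 < k <= km ->
  xminus d u0 xmax k <= xmax /\ u0 (xminus d u0 xmax k) = Ek d k.
Proof.
move=> kk; have E0 := Ek_gt0 d0 umax_gt0 kk.
have kp := kappa_pi d0 umax_gt0 kk.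
have [|h1] := @xgetPex R 0 (fun x : R => x <= xmax /\ (u0 x)%:C = Efn d (zeta d k)).
  have [x [xx ux]] := u0_ninfty E0.
  have [|z] := @IVT R u0 x xmax (Ek d k) xx (continuous_subspaceT u0_continuous).
    by rewrite ge_min le_max ux Ek_le_umax// orbT.
  rewrite in_itv/= => /andP[_ zx] e; exists z; split => //.
  by rewrite Efn_zeta// e.
by rewrite -/(xminus d u0 xmax k) in h1 * => + ; rewrite Efn_zeta// => -[h2].
Qed.

(** Outside the turning points [u0 x < Ek d k], where the conjugate branches have equal real parts;
    the integrand thus extends by 0 to a domain independent of [k]. *)
Lemma RWyl_gapW k : 0 < k <= km ->
  RWyl d u0 xmax k = 1 / (4 * d) * \int[leb]_x (gapW (2 * d * (u0 x - Ek d k))).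
Proof.
move=> kk; have kp := kappa_pi d0 umax_gt0 kk.
have [hp ep] := xplusP kk; have [hm em] := xminusP kk.
rewrite /RWyl; congr (_ * _); rewrite Rintegral_mkcond; apply: eq_Rintegral => x _.
have k0 : k == 0 = false by rewrite gt_eqF//; case/andP: kk.
rewrite /xdom k0 patchE mem_setE in_itv/= aW_Warg//.
case: ifPn => [_|].
  by rewrite /gapW /P1 /P2; case: (LambertW0 _) (LambertWm1 _) => a b [a' b']/=; rewrite opprK addrC.
rewrite negb_and -!ltNge => h; rewrite gapW_le0// pmulr_rle0 ?mulr_gt0// subr_le0.
case/orP: h => h.
  by rewrite -em ltW// u0_incr.
by rewrite -ep ltW// u0_decr.
Qed.

(** Closed form of the imaginary part integrated in [thetaplus], obtained from [ImWm1]. Between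
    [xmax] and the turning point it is constantly [k]. *)
Definition theta_integrand k x := k - Kinv d (Ek d k - u0 x).

Lemma measurable_Kinv : measurable_fun setT (Kinv d).
Proof.
apply: measurable_funM => //; apply: measurableT_comp; first exact: measurable_sigmaW.
exact: measurable_funM.
Qed.

Lemma measurable_Ek : measurable_fun setT (Ek d).
Proof.
apply: measurable_funM => //; apply: measurableT_comp; first exact: measurable_eF.
exact: measurable_funM.
Qed.

Lemma theta_integrand_bound k x : 0 < k <= km ->
  0 <= theta_integrand k x <= Num.sqrt (1 / d) * Num.sqrt (u0 x).
Proof. by move=> kk; apply: (Ek_Kinv_bound d0 umax_gt0 kk); rewrite ltW// u0_gt0. Qed.

Lemma theta_integrand_int k (D : set R) : measurable D -> 0 < k <= km ->
  leb.-integrable D (EFin \o theta_integrand k).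
Proof.
move=> mD kk; apply: (@le_integrable _ _ _ leb D mD _
   (fun x => (Num.sqrt (1 / d))%:E * (Num.sqrt (u0 x))%:E)%E).
- apply/measurable_EFinP; apply: measurable_funTS; apply: measurable_funB => //.
  apply: measurableT_comp; first exact: measurable_Kinv.
  by apply: measurable_funB => //; exact: u0_measurable.
- move=> x _ /=; have /andP[h1 h2] := theta_integrand_bound x kk.
  by rewrite lee_fin (ger0_norm h1) (le_trans h2)// ler_norm.
- apply: integrableZl => //; apply: integrableS sqrt_u0_int => //.
Qed.

(** The constant value [k] of the integrand between [xmax] and [xplus] absorbs [k * xplus] and
    removes the moving endpoint; the bound and the measurability in [k] are read off this form. *)
Lemma thetaplusE k : 0 < k <= km ->
  thetaplus d u0 xmax k = k * xmax + \int[leb]_(x in `[xmax, +oo[) theta_integrand k x.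
Proof.
move=> kk; have kp := kappa_pi d0 umax_gt0 kk.
have k0 : k == 0 = false by rewrite gt_eqF//; case/andP: kk.
have [hp ep] := xplusP kk; rewrite /thetaplus.
set xp := xplus _ _ _ _ in hp ep *.
have -> : `[xmax, +oo[%classic = `[xmax, xp[%classic `|` `[xp, +oo[%classic.
  apply/seteqP; split=> x/=; rewrite !in_itv/= !andbT.
    by move=> ->; have [h|h] := ltP x xp; [left|right].
  by move=> [/andP[]//|h]; exact: le_trans h.
rewrite Rintegral_setU//; last 2 first.
- by apply: theta_integrand_int => //; exact: measurableU.
- apply/disj_setPS => x/=; rewrite !in_itv/= andbT => -[/andP[_ h1] h2].
  by have := lt_le_trans h1 h2; rewrite ltxx.
have -> : \int[leb]_(x in `[xmax, xp[) theta_integrand k x = k * (xp - xmax).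
  transitivity (\int[leb]_(x in `[xmax, xp[) (cst k x)).
    apply: eq_Rintegral => x; rewrite inE/= in_itv/= => /andP[x1 x2].
    rewrite /theta_integrand Kinv_le0 ?subr0// subr_le0 -ep.
    by rewrite ltW// u0_decr.
  rewrite Rintegral_cst//; congr (k * _).
  rewrite [X in fine X](_ : _ = (xp - xmax)%:E)//.
    transitivity (if (xmax%:E < xp%:E)%E then xp%:E - xmax%:E else 0)%E.
      exact: (lebesgue_measure_itv `[xmax, xp[).
    rewrite lte_fin; case: ltP => // h.
    by have -> : xp = xmax; [apply/eqP; rewrite eq_le h hp|rewrite subrr].
rewrite addrA; congr (_ + _); first by ring.
apply: eq_Rintegral => x _.
rewrite aW_Warg// /theta_integrand /Kinv.
have := ImWm1 (2 * d * (u0 x - Ek d k)).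
rewrite -[- (2 * d * _)]mulrN opprB /zeta k0; case: (LambertWm1 _) => a b /= ->; ring.
Qed.

Definition theta_bound := km * `|xmax| + Num.sqrt (1 / d) * \int[leb]_x Num.sqrt (u0 x).

Lemma thetaplus_bound k : 0 < k <= km -> `|thetaplus d u0 xmax k| <= theta_bound.
Proof.
move=> kk; rewrite thetaplusE// (le_trans (ler_normD _ _))// lerD//.
  rewrite normrM ler_wpM2r// gtr0_norm; by case/andP: kk.
have i1 : leb.-integrable setT (EFin \o (fun x => Num.sqrt (u0 x))) := sqrt_u0_int.
rewrite ger0_norm; last first.
  by apply: Rintegral_ge0 => x _; have /andP[] := theta_integrand_bound x kk.
rewrite -RintegralZl// Rintegral_mkcond; apply: le_Rintegral => //.
- rewrite -restrict_EFin; apply/integrable_restrict => //=; rewrite setTI.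
  exact: theta_integrand_int.
- by have := @integrableZl _ _ _ leb setT measurableT (Num.sqrt (1 / d)) _ i1.
- move=> x _; have /andP[h1 h2] := theta_integrand_bound x kk.
  by rewrite patchE; case: ifP => // _; exact: le_trans h2.
Qed.

Lemma measurable_thetaplus : measurable_fun `]0, km[ (thetaplus d u0 xmax).
Proof.
(* Truncation at 0 makes the integrand nonnegative for all real [k], as Tonelli measurability
   requires; it changes nothing for [0 < k <= km]. *)
pose h (z : R * R) := (Num.max 0 (theta_integrand z.1 z.2) * \1_(`[xmax, +oo[%classic : set R) z.2)%:E.
have mh : measurable_fun setT h.
  apply/measurable_EFinP; apply: measurable_funM.
    apply: measurable_maxr => //; apply: measurable_funB; first exact: measurable_fst.
    apply: measurableT_comp; first exact: measurable_Kinv.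
    apply: measurable_funB.
      by apply: measurableT_comp; [exact: measurable_Ek|exact: measurable_fst].
    by apply: measurableT_comp; [exact: u0_measurable|exact: measurable_snd].
  by apply: measurableT_comp; [exact: measurable_indic|exact: measurable_snd].
have h0 z : (0 <= h z)%E.
  by rewrite lee_fin mulr_ge0// le_max lexx.
have mH := measurable_fun_fubini_tonelli_F (m2 := leb) h mh h0.
apply: (@eq_measurable_fun _ _ _ _ `]0, km[%classic
   (fun k => k * xmax + fine (fubini_F leb h k))).
  move=> k; rewrite inE/= in_itv/= => /andP[k0 kk].
  have kk' : 0 < k <= km by rewrite k0 ltW.
  rewrite thetaplusE//; congr (_ + _); rewrite /fubini_F /Rintegral [in RHS]integral_mkcond.
  congr fine; apply: eq_integral => x _; rewrite /h/= patchE indicE.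
  case: ifP => _; last by rewrite mulr0.
  by rewrite mulr1 max_r//; have /andP[] := theta_integrand_bound x kk'.
apply: measurable_funTS; apply: measurable_funD; first exact: measurable_funM.
by apply: measurableT_comp; first exact: fine_measurable.
Qed.

End profile.

(** * The Weyl density *)

Section weyl_density.
Context {R : realType}.
Notation leb := (@lebesgue_measure R).
Variables (d umax : R).
Hypotheses (d0 : 0 < d) (umax0 : 0 < umax).
Let km := kappa_max d umax.

(* contribution to the Weyl density at [eta] of a point where the profile has height [u] *)
Definition weyl_dens (u eta : R) : R :=
  1 / 2 * (if 0 < 2 * d * (u - Ek d eta) then dgapW (2 * d * (u - Ek d eta)) else 0)
  * deF (2 * d * eta).

Lemma weyl_dens_eq0 u eta : u <= Ek d eta -> weyl_dens u eta = 0.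
Proof.
move=> h; rewrite /weyl_dens ifF ?mulr0 ?mul0r//.
by apply/negbTE; rewrite -leNgt pmulr_rle0 ?mulr_gt0// subr_le0.
Qed.

Lemma weyl_dens_ge0 u eta : 0 < eta -> 0 <= weyl_dens u eta.
Proof.
move=> e0; rewrite /weyl_dens mulr_ge0//.
  by rewrite mulr_ge0//; case: ifPn => // h; exact: dgapW_ge0.
have e1 : 0 < 2 * d * eta by rewrite !mulr_gt0.
exact: le_trans (ltW e1) (deF_ge e1).
Qed.

Lemma Kinv_bounds u eta : 0 < u <= umax -> 0 < eta <= km ->
  (eta < Kinv d u) = (Ek d eta < u).
Proof.
move=> uu ee; have [/andP[q0 qk] qe] := Kinv_gt0 d0 uu.
have /andP[e0 ek] := ee.
have [h|h|h] := ltgtP eta (Kinv d u).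
- by rewrite -qe (Ek_lt d0 umax0 e0 h qk).
- by apply/esym/negbTE; rewrite -leNgt -qe ltW// (Ek_lt d0 umax0 q0 h ek).
- by rewrite h qe ltxx.
Qed.

(** By the chain rule [weyl_dens u] is minus the derivative in [k] of the right side; both vanish
    from [Kinv d u] on, where the gap has closed. *)
Lemma weyl_dens_FTC u k : 0 < u <= umax -> 0 < k <= km ->
  (\int[leb]_(eta in `]k, km[) (weyl_dens u eta)%:E =
   (1 / (4 * d) * gapW (2 * d * (u - Ek d k)))%:E)%E.
Proof.
move=> uu kk; have /andP[k0 kk'] := kk.
have [/andP[q0 qk] qe] := Kinv_gt0 d0 uu.
have [kq|qk'] := ltP k (Kinv d u); last first.
  rewrite gapW_le0; last first.
    by rewrite pmulr_rle0 ?mulr_gt0// subr_le0 leNgt -Kinv_bounds// -leNgt.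
  rewrite mulr0 integral0_eq// => eta/=; rewrite in_itv/= => /andP[ke ek].
  have ee : 0 < eta <= km by rewrite (lt_trans k0 ke) ltW.
  by rewrite weyl_dens_eq0// leNgt -Kinv_bounds// -leNgt (le_trans qk')// ltW.
set q := Kinv d u in q0 qk qe kq *.
have -> : (\int[leb]_(eta in `]k, km[) (weyl_dens u eta)%:E =
   \int[leb]_(eta in `]k, q[) (weyl_dens u eta)%:E)%E.
  rewrite [LHS]integral_mkcond [RHS]integral_mkcond; apply: eq_integral => eta _.
  rewrite !patchE !mem_setE !in_itv/=; have [ke|//] := ltP k eta => /=.
  have [eq|qe'] := ltP eta q; first by rewrite (lt_le_trans eq qk).
  case: ifP => // ek; congr EFin; apply: weyl_dens_eq0.
  have ee : 0 < eta <= km by rewrite (lt_trans k0 ke) ltW.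
  by rewrite leNgt -Kinv_bounds// -leNgt.
have inside x : k <= x <= q -> 0 < 2 * d * x < pi.
  move=> /andP[kx xq]; apply: (kappa_pi d0 umax0).
  by rewrite (lt_le_trans k0 kx) (le_trans xq qk).
have dEk x : k <= x <= q -> is_derive x 1 (Ek d) (deF (2 * d * x)).
  by move=> /inside; exact: Ek_derive.
have posE x : k < x < q -> 0 < 2 * d * (u - Ek d x).
  move=> /andP[kx xq]; rewrite mulr_gt0 ?mulr_gt0// subr_gt0 -Kinv_bounds//.
  by rewrite (lt_trans k0 kx) (le_trans (ltW xq) qk).
have dy x : k <= x <= q -> is_derive x 1 (fun x => 2 * d * (u - Ek d x)) (- (2 * d * deF (2 * d * x))).
  move=> kx; have h := dEk x kx.
  apply: (is_derive_eq (@is_deriveZ _ _ _ _ (2 * d) _ _ _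
    (is_deriveB (is_derive_cst (u : R^o) (x : R^o) (1 : R^o)) h))).
  by rewrite /GRing.scale/= sub0r mulrN.
pose F := fun x : R => - (1 / (4 * d)) * gapW (2 * d * (u - Ek d x)).
have := @ge0_integral_oo_FTC R (weyl_dens u) F k q kq.
have -> : F q = 0 by rewrite /F qe subrr mulr0 gapW_le0// mulr0.
rewrite sub0r /F mulNr opprK; apply.
- move=> x; rewrite in_itv/= => kxq.
  have kxq' : k <= x <= q by case/andP: kxq => ? ?; rewrite !ltW.
  have c : {for x, continuous (fun x => 1 / 2 * dgapW (2 * d * (u - Ek d x)) * deF (2 * d * x))}.
    apply: cvgM; last first.
      apply: (@continuous_comp _ _ _ (fun x : R => 2 * d * x) deF x).
        by apply: cvgM; [exact: cvg_cst|exact: cvg_id].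
      by apply: deF_continuous; exact: inside.
    apply: cvgM; first exact: cvg_cst.
    apply: (@continuous_comp _ _ _ (fun x : R => 2 * d * (u - Ek d x)) dgapW x).
      exact: is_derive_continuous (dy x kxq').
    by apply: dgapW_continuous; exact: posE.
  move: c; rewrite /continuous_at /weyl_dens posE// => c.
  apply: cvg_trans c; apply: near_eq_cvg; near=> z.
  rewrite posE//; near: z; have := @near_in_itvoo R k q x.
  rewrite in_itv/= => /(_ kxq); apply: filterS => z; by rewrite in_itv.
- by move=> x /andP[kx _]; apply: weyl_dens_ge0; exact: lt_trans kx.
- apply: continuous_in_subspaceT => x; rewrite inE/= in_itv/= => kx.
  apply: cvgM; first exact: cvg_cst.
  apply: (@continuous_comp _ _ _ (fun x : R => 2 * d * (u - Ek d x)) gapW x).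
    exact: is_derive_continuous (dy x kx).
  exact: gapW_continuous.
- move=> x kxq; apply: is_derive1P.
  have kxq' : k <= x <= q by case/andP: kxq => ? ?; rewrite !ltW.
  have h := @is_derive1_comp R gapW _ x _ _ (gapW_derive (posE x kxq)) (dy x kxq').
  apply: (is_derive_eq (@is_deriveZ _ _ _ _ (- (1 / (4 * d))) _ _ _ h)).
  rewrite /GRing.scale/= /weyl_dens posE//; field; rewrite gt_eqF//.
Unshelve. all: by end_near. Qed.

(** The first factor bounds [deF] on the spectral interval; in [d * km + 2] the two terms come from
    the constant and the inverse square root in [dgapW_le]. *)
Definition dens_cst := (1 + 1 / (1 + cos (2 * d * km)) ^+ 2) * (d * km + 2).

Lemma dens_cst_ge0 : 0 <= dens_cst.
Proof.
have k0 := kappa_max_gt0 d0 umax0.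
rewrite /dens_cst mulr_ge0// addr_ge0// ?mulr_ge0 ?ltW//. 
Qed.

(** With [q = Kinv d u], [Ek_growth] gives [2 * d * (u - Ek d eta) >= d ^+ 2 * (q * (q - eta))],
    which turns the inverse square root singularity of [dgapW] into one in [q - eta]. *)
Lemma weyl_dens_bound u eta : 0 < u <= umax -> 0 < eta < Kinv d u ->
  weyl_dens u eta <= dens_cst * (Num.sqrt (Kinv d u) / Num.sqrt (Kinv d u - eta)).
Proof.
move=> uu /andP[e0 eq]; have [/andP[q0 qk] qe] := Kinv_gt0 d0 uu.
set q := Kinv d u in q0 qk qe eq *.
have k0 := kappa_max_gt0 d0 umax0.
have ek : eta <= km by rewrite (le_trans (ltW eq)).
have [/andP[_ kp] _] := kappa_max_pi d0 umax0.
have dd : 0 < 2 * d by rewrite mulr_gt0.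
have hF := @deF_le R (2 * d * eta) (2 * d * km).
rewrite ler_pM2l// mulr_gt0// in hF; move: (hF isT ek kp) => {}hF.
set c1 := 1 + 1 / _ in hF.
have c1ge : 0 <= c1 by rewrite /c1 addr_ge0// divr_ge0// sqr_ge0.
have growth := Ek_growth d0 umax0 e0 (ltW eq) qk; rewrite qe in growth.
have y0 : 0 < 2 * d * (u - Ek d eta).
  by rewrite mulr_gt0// subr_gt0 -qe (Ek_lt d0 umax0 e0 eq qk).
have qeta : 0 < q - eta by rewrite subr_gt0.
have s1 : 0 < Num.sqrt q by rewrite sqrtr_gt0.
have s2 : 0 < Num.sqrt (q - eta) by rewrite sqrtr_gt0.
have ys : d * (Num.sqrt q * Num.sqrt (q - eta)) <= Num.sqrt (2 * d * (u - Ek d eta)).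
  rewrite -[X in X * _ <= _](ger0_norm (ltW d0)) -sqrtr_sqr -!sqrtrM ?sqr_ge0 ?(ltW q0)//.
  rewrite ler_wsqrtr//.
  apply: (@le_trans _ _ (2 * d * (d * (q ^+ 2 - eta ^+ 2)))); last by rewrite ler_pM2l.
  have : 0 <= d ^+ 2 * (q - eta) * (q + 2 * eta).
    have a1 := sqr_ge0 d; have a2 : 0 <= q + 2 * eta by lra.
    by apply: mulr_ge0 => //; apply: mulr_ge0 => //; exact: ltW.
  have -> : 2 * d * (d * (q ^+ 2 - eta ^+ 2)) = d ^+ 2 * (q * (q - eta)) +
      d ^+ 2 * (q - eta) * (q + 2 * eta) by ring.
  by rewrite lerDl.
have gp : dgapW (2 * d * (u - Ek d eta)) <= 1 + 2 / (d * (Num.sqrt q * Num.sqrt (q - eta))).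
  apply: (le_trans (dgapW_le y0)); rewrite lerD2l ler_pM2l// lef_pV2 ?posrE//.
    by rewrite sqrtr_gt0.
  by rewrite !mulr_gt0.
rewrite /weyl_dens y0.
have g0 := dgapW_ge0 y0.
have D0 : 0 <= deF (2 * d * eta).
  have e1 : 0 < 2 * d * eta by rewrite mulr_gt0.
  exact: le_trans (ltW e1) (deF_ge e1).
apply: (@le_trans _ _ (1 / 2 * (1 + 2 / (d * (Num.sqrt q * Num.sqrt (q - eta)))) * (c1 * (2 * d * eta)))).
  by rewrite ler_pM// ?mulr_ge0// ler_pM2l.
rewrite /dens_cst -/c1.
have -> : 1 / 2 * (1 + 2 / (d * (Num.sqrt q * Num.sqrt (q - eta)))) * (c1 * (2 * d * eta)) =
   c1 * (d * eta + 2 * eta / (Num.sqrt q * Num.sqrt (q - eta))).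
  by field; rewrite !gt_eqF.
rewrite -[leRHS]mulrA ler_wpM2l// [leRHS]mulrDl lerD//.
- apply: (@le_trans _ _ (d * km)); first by rewrite ler_pM2l.
  rewrite ler_peMr ?mulr_ge0 ?(ltW d0) ?(ltW k0)//.
  by rewrite ler_pdivlMr// mul1r ler_wsqrtr// gerBl ltW.
- rewrite -mulrA ler_pM2l// ler_pdivrMr ?mulr_gt0//.
  have -> : Num.sqrt q / Num.sqrt (q - eta) * (Num.sqrt q * Num.sqrt (q - eta)) = Num.sqrt q ^+ 2.
    by field; rewrite gt_eqF.
  by rewrite sqr_sqrtr ltW.
Qed.

Lemma measurable_weyl_dens disp (T : measurableType disp) (f h : T -> R) :
  measurable_fun setT f -> measurable_fun setT h ->
  measurable_fun setT (fun z => weyl_dens (f z) (h z)).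
Proof.
move=> mf mh; apply: measurable_funM; last first.
  by apply: measurableT_comp; [exact: measurable_deF|exact: measurable_funM].
apply: measurable_funM => //.
apply: (measurableT_comp (f := fun y : R => if 0 < y then dgapW y else 0)).
  exact: measurable_dgapW.
apply: measurable_funM => //; apply: measurable_funB => //.
by apply: measurableT_comp; first exact: measurable_Ek.
Qed.

Lemma integral_inv_sqrt (q : R) : 0 < q ->
  (\int[leb]_(x in `]0%R, q[) (Num.sqrt q / Num.sqrt (q - x))%:E = (2 * q)%:E)%E.
Proof.
move=> q0; pose F := fun x : R => - (2 * Num.sqrt q) * Num.sqrt (q - x).
have dq (x : R) : is_derive x 1 (fun x : R => q - x) (-1).
  apply: (is_derive_eq (is_deriveB (is_derive_cst (q : R^o) (x : R^o) (1 : R^o)) (is_derive_id x 1))).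
  by rewrite sub0r.
have cs x : {for x, continuous (fun x : R => Num.sqrt (q - x))}.
  apply: (@continuous_comp _ _ _ (fun x : R => q - x) (@Num.sqrt R) x).
    exact: is_derive_continuous (dq x).
  exact: sqrt_continuous.
have := @ge0_integral_oo_FTC R (fun x => Num.sqrt q / Num.sqrt (q - x)) F 0 q q0.
have -> : F q - F 0 = 2 * q.
  rewrite /F subrr sqrtr0 mulr0 sub0r subr0 mulNr opprK -mulrA -expr2 sqr_sqrtr// ltW//.
apply.
- move=> x; rewrite in_itv/= => /andP[x0 xq].
  apply: cvgM; first exact: cvg_cst.
  by apply: cvgV; [rewrite gt_eqF// sqrtr_gt0 subr_gt0|exact: cs].
- by move=> x _; rewrite divr_ge0// sqrtr_ge0.
- by apply: continuous_subspaceT => x; apply: cvgM; [exact: cvg_cst|exact: cs].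
- move=> x /andP[x0 xq]; apply: is_derive1P.
  have p : 0 < q - x by rewrite subr_gt0.
  have h := @is_derive1_comp R (@Num.sqrt R) _ x _ _ (is_derive1_sqrt p) (dq x).
  apply: (is_derive_eq (@is_deriveZ _ _ _ _ (- (2 * Num.sqrt q)) _ _ _ h)).
  by rewrite /GRing.scale/=; field; rewrite gt_eqF// sqrtr_gt0.
Qed.

(* the truncation at [km] is harmless since the density of height [u] lives on [(0, Kinv u)] *)
Lemma weyl_dens_patch_le (w : R -> R) (C u : R) : 0 < u <= umax ->
  measurable_fun setT w -> (forall x, 0 < x -> 0 <= w x) ->
  (\int[leb]_(x in `]0%R, Kinv d u[)
     (w x * (Num.sqrt (Kinv d u) / Num.sqrt (Kinv d u - x)))%:E <= (C * Kinv d u)%:E)%E ->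
  (\int[leb]_(x in `]0%R, km[) (w x * weyl_dens u x)%:E <= (dens_cst * C * Kinv d u)%:E)%E.
Proof.
move=> uu mw w0 hC; have [/andP[q0 qk] qe] := Kinv_gt0 d0 uu.
set q := Kinv d u in q0 qk qe hC *.
have -> : (\int[leb]_(x in `]0%R, km[) (w x * weyl_dens u x)%:E =
   \int[leb]_(x in `]0%R, q[) (w x * weyl_dens u x)%:E)%E.
  rewrite [LHS]integral_mkcond [RHS]integral_mkcond; apply: eq_integral => eta _.
  rewrite !patchE !mem_setE !in_itv/=; have [ke|//] := ltP 0 eta => /=.
  have [eq|qe'] := ltP eta q; first by rewrite (lt_le_trans eq qk).
  case: ifP => // ek; rewrite weyl_dens_eq0 ?mulr0//.
  have ee : 0 < eta <= km by rewrite ke ltW.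
  by rewrite leNgt -Kinv_bounds// -leNgt.
apply: (@le_trans _ _ (\int[leb]_(x in `]0%R, q[)
   (dens_cst%:E * (w x * (Num.sqrt q / Num.sqrt (q - x)))%:E))%E).
  apply: ge0_le_integral => //.
  - move=> x/=; rewrite in_itv/= => /andP[x0 xq].
    by rewrite lee_fin mulr_ge0 ?w0 ?weyl_dens_ge0.
  - apply/measurable_EFinP; apply: measurable_funTS; apply: measurable_funM => //.
    exact: measurable_weyl_dens.
  - apply/measurable_EFinP; apply: measurable_funTS; apply: measurable_funM => //.
    apply: measurable_funM => //; apply: measurable_funM => //; apply: measurable_funV.
    apply: measurableT_comp; first exact: continuous_measurable_fun (@sqrt_continuous R).
    exact: measurable_funB.
  - move=> x/=; rewrite in_itv/= => xq; have /andP[x0 _] := xq.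
    rewrite -EFinM lee_fin [leRHS]mulrCA ler_wpM2l ?w0//; exact: weyl_dens_bound.
rewrite ge0_integralZl//; last 3 first.
- apply/measurable_EFinP; apply: measurable_funTS.
  apply: measurable_funM => //; apply: measurable_funM => //; apply: measurable_funV.
  apply: measurableT_comp; first exact: continuous_measurable_fun (@sqrt_continuous R).
  exact: measurable_funB.
- move=> x/=; rewrite in_itv/= => /andP[x0 _].
  by rewrite lee_fin mulr_ge0 ?w0// divr_ge0// sqrtr_ge0.
- by rewrite lee_fin dens_cst_ge0.
have -> : (dens_cst * C * q)%:E = (dens_cst%:E * (C * q)%:E)%E.
  by rewrite -EFinM; congr EFin; rewrite -[LHS]mulrA.
by rewrite lee_wpmul2l// lee_fin dens_cst_ge0.
Qed.

End weyl_density.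

Lemma ae_lebesgueS {R : realType} (P Q : R -> Prop) : (forall x, P x -> Q x) ->
  {ae @lebesgue_measure R, forall x, P x} -> {ae @lebesgue_measure R, forall x, Q x}.
Proof.
move=> PQ; apply: filterS; first exact: (ae_filter_ringOfSetsType (@lebesgue_measure R)).
exact: PQ.
Qed.

Lemma ae_lebesgueI {R : realType} (P Q : R -> Prop) : {ae @lebesgue_measure R, forall x, P x} ->
  {ae @lebesgue_measure R, forall x, Q x} -> {ae @lebesgue_measure R, forall x, P x /\ Q x}.
Proof. by apply: filterI; exact: (ae_filter_ringOfSetsType (@lebesgue_measure R)). Qed.

(** * The Weyl density as a superposition over the line *)

Section weyl_law.
Context {R : realType}.
Notation leb := (@lebesgue_measure R).
Variables (d : R) (u0 : R -> R) (xmax : R).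
Hypotheses (d0 : 0 < d) (adm : admissible u0 xmax).
Let umax := u0 xmax.
Let km := kappa_max d umax.
Let umax0 : 0 < umax := umax_gt0 adm.

Definition weyl_joint (z : R * R) : R :=
  weyl_dens d (u0 z.1) z.2 * \1_(`]0, km[%classic : set R) z.2.

Lemma weyl_joint_ge0 z : 0 <= weyl_joint z.
Proof.
rewrite /weyl_joint indicE mem_setE in_itv/=.
case: (ltP 0 z.2) => [z0|]; last by rewrite mulr0.
by rewrite mulr_ge0// weyl_dens_ge0.
Qed.

Lemma measurable_weyl_joint : measurable_fun setT weyl_joint.
Proof.
apply: measurable_funM; last first.
  by apply: measurableT_comp; [exact: measurable_indic|exact: measurable_snd].
apply: measurable_weyl_dens; last exact: measurable_snd.
by apply: measurableT_comp; [exact: (u0_measurable adm)|exact: measurable_fst].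
Qed.

(** Everywhere defined candidate for [rhoWyl], obtained by differentiating under the integral over
    [x]. It may be infinite on a null set, where [weyl_g] takes the value 0. *)
Definition weyl_gE (eta : R) : \bar R := (\int[leb]_x (weyl_joint (x, eta))%:E)%E.
Definition weyl_g (eta : R) : R := fine (weyl_gE eta).

Lemma weyl_gE_ge0 eta : (0 <= weyl_gE eta)%E.
Proof. by apply: integral_ge0 => x _; rewrite lee_fin weyl_joint_ge0. Qed.

Lemma weyl_g_ge0 eta : 0 <= weyl_g eta.
Proof. exact: fine_ge0 (weyl_gE_ge0 eta). Qed.

Lemma weyl_gE_out eta : eta \notin `]0, km[ -> weyl_gE eta = 0%E.
Proof.
move=> h; apply: integral0_eq => x _; rewrite /weyl_joint indicE mem_setE/=.
by rewrite (negbTE h) mulr0.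
Qed.

Lemma weyl_g_out eta : eta \notin `]0, km[ -> weyl_g eta = 0.
Proof. by move=> h; rewrite /weyl_g weyl_gE_out. Qed.

Lemma measurable_weyl_gE : measurable_fun setT weyl_gE.
Proof.
apply: (measurable_fun_fubini_tonelli_G (m1 := leb) (fun z : R * R => (weyl_joint z)%:E)) => //=.
- by apply/measurable_EFinP; exact: measurable_weyl_joint.
- by move=> z; rewrite lee_fin weyl_joint_ge0.
Qed.

Lemma measurable_weyl_g : measurable_fun setT weyl_g.
Proof. by apply: measurableT_comp measurable_weyl_gE; exact: fine_measurable. Qed.

Lemma weyl_tonelli (w : R -> R) : measurable_fun setT w ->
  (forall x, 0 < x -> 0 <= w x) ->
  (\int[leb]_eta ((w eta)%:E * weyl_gE eta) =
   \int[leb]_x \int[leb]_(eta in `]0%R, km[) (w eta * weyl_dens d (u0 x) eta)%:E)%E.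
Proof.
move=> mw w0.
pose f (z : R * R) := (w z.2 * weyl_joint z)%:E.
have mf : measurable_fun setT f.
  apply/measurable_EFinP; apply: measurable_funM; last exact: measurable_weyl_joint.
  by apply: measurableT_comp => //; exact: measurable_snd.
have f0 z : (0 <= f z)%E.
  rewrite lee_fin; have [z0|z0] := ltP 0 z.2.
    by rewrite mulr_ge0 ?w0// weyl_joint_ge0.
  by rewrite /weyl_joint indicE mem_setE in_itv/= ltNge z0/= !mulr0.
transitivity (\int[leb]_eta \int[leb]_x f (x, eta))%E.
  apply: eq_integral => eta _; have [eta0|eta0] := ltP 0 eta.
    rewrite /weyl_gE -ge0_integralZl//.
    - by apply/measurable_EFinP; apply: measurableT_comp; [exact: measurable_weyl_joint|exact: pair2_measurable].
    - by move=> x _; rewrite lee_fin weyl_joint_ge0.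
    - by rewrite lee_fin w0.
  rewrite weyl_gE_out ?in_itv/= ?ltNge ?eta0// mule0 integral0_eq// => x _.
  by rewrite /f /weyl_joint indicE mem_setE in_itv/= ltNge eta0/= !mulr0.
rewrite -(fubini_tonelli (m1 := leb) (m2 := leb) f)//; apply: eq_integral => x _.
rewrite [RHS]integral_mkcond; apply: eq_integral => eta _.
by rewrite /f/= /weyl_joint/= patchE indicE; case: ifP => _; rewrite ?mulr1// !mulr0.
Qed.

Definition width_cst := Num.sqrt (1 / d) * \int[leb]_x Num.sqrt (u0 x).

(** One estimate serves twice: weight 1 gives integrability of the density, the logarithmic weight
    gives boundedness of the interaction. The bound [C * q] at [q = Kinv d (u0 x)] is integrated
    over [x] by integrability of [Num.sqrt (u0 x)]. *)
Lemma weyl_weight_bound (w : R -> R) (C : R) : measurable_fun setT w -> 0 <= C ->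
  (forall x, 0 < x -> 0 <= w x) ->
  (forall q, 0 < q -> (\int[leb]_(x in `]0%R, q[)
     (w x * (Num.sqrt q / Num.sqrt (q - x)))%:E <= (C * q)%:E)%E) ->
  (\int[leb]_eta ((w eta)%:E * weyl_gE eta) <= (dens_cst d umax * C * width_cst)%:E)%E.
Proof.
move=> mw C0 w0 hw; rewrite weyl_tonelli//.
have Cd : 0 <= dens_cst d umax * C by rewrite mulr_ge0// dens_cst_ge0.
have i1 : leb.-integrable setT (EFin \o (fun x => Num.sqrt (u0 x))) := sqrt_u0_int adm.
apply: (@le_trans _ _ (\int[leb]_x ((dens_cst d umax * C * Num.sqrt (1 / d))%:E * (Num.sqrt (u0 x))%:E))%E).
  apply: ge0_le_integral => //.
  - move=> x _; apply: integral_ge0 => eta/=; rewrite in_itv/= => /andP[e0 _].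
    by rewrite lee_fin mulr_ge0 ?w0 ?weyl_dens_ge0.
  - pose f (z : R * R) := (w z.2 * weyl_joint z)%:E.
    have mf : measurable_fun setT f.
      apply/measurable_EFinP; apply: measurable_funM; last exact: measurable_weyl_joint.
      by apply: measurableT_comp => //; exact: measurable_snd.
    have f0 z : (0 <= f z)%E.
      rewrite lee_fin; have [z0|z0] := ltP 0 z.2.
        by rewrite mulr_ge0 ?w0// weyl_joint_ge0.
      by rewrite /weyl_joint indicE mem_setE in_itv/= ltNge z0/= !mulr0.
    have := measurable_fun_fubini_tonelli_F (m2 := leb) f mf f0.
    congr measurable_fun; apply/funext => x; rewrite /fubini_F [RHS]integral_mkcond.
    apply: eq_integral => eta _.
    by rewrite /f/= /weyl_joint/= patchE indicE; case: ifP => _; rewrite ?mulr1// !mulr0.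
  - apply: emeasurable_funM => //; exact: (measurable_int leb i1).
  - move=> x _.
    have uu : 0 < u0 x <= umax by rewrite (u0_gt0 adm) (u0_le adm).
    have [/andP[q0 _] _] := Kinv_gt0 d0 uu.
    apply: (le_trans (weyl_dens_patch_le d0 umax0 uu mw w0 (hw _ q0))).
    rewrite -EFinM lee_fin -mulrA -[leRHS]mulrA -[leRHS]mulrA ler_wpM2l ?dens_cst_ge0//.
    by rewrite ler_wpM2l// Kinv_le_sqrt// ltW// (u0_gt0 adm).
rewrite integralZl// /width_cst /Rintegral.
have fin := integrable_fin_num measurableT i1.
by rewrite -{1}(fineK fin) -EFinM lee_fin mulrA.
Qed.

Lemma weyl_gE_int : leb.-integrable setT weyl_gE.
Proof.
apply/integrableP; split; first exact: measurable_weyl_gE.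
under eq_integral do rewrite gee0_abs ?weyl_gE_ge0//.
have -> : (\int[leb]_x weyl_gE x = \int[leb]_x ((cst 1 x : R)%:E * weyl_gE x))%E.
  by apply: eq_integral => x _; rewrite mul1e.
apply: le_lt_trans (@weyl_weight_bound (cst 1) 2 _ _ _ _) _ => //; last by rewrite ltry.
move=> q q0; rewrite -(integral_inv_sqrt q0) le_eqVlt; apply/orP; left; apply/eqP.
by apply: eq_integral => x _; rewrite mul1r.
Qed.

Lemma weyl_gE_ae : {ae leb, forall eta, weyl_gE eta = (weyl_g eta)%:E}.
Proof.
have := integrable_ae measurableT weyl_gE_int; apply: filterS => eta /(_ I) h.
by rewrite /weyl_g fineK.
Qed.

Lemma weyl_g_weight (w : R -> R) : measurable_fun setT w ->
  (forall x, 0 < x -> 0 <= w x) ->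
  (\int[leb]_eta ((w eta)%:E * weyl_gE eta) = \int[leb]_eta (w eta * weyl_g eta)%:E)%E.
Proof.
move=> mw w0; apply: ae_eq_integral => //.
- apply: emeasurable_funM; last exact: measurable_weyl_gE.
  exact/measurable_EFinP.
- by apply/measurable_EFinP; apply: measurable_funM => //; exact: measurable_weyl_g.
- by have := weyl_gE_ae; apply: ae_lebesgueS => eta -> _; rewrite -EFinM.
Qed.

Lemma weyl_g_int : leb.-integrable setT (EFin \o weyl_g).
Proof.
apply/integrableP; split; first by apply/measurable_EFinP; exact: measurable_weyl_g.
have /integrableP[_] := weyl_gE_int; apply: le_lt_trans.
rewrite le_eqVlt; apply/orP; left; apply/eqP; apply: ae_eq_integral => //.
- by apply: measurableT_comp => //; apply/measurable_EFinP; exact: measurable_weyl_g.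
- by apply: measurableT_comp => //; exact: measurable_weyl_gE.
- by have := weyl_gE_ae; apply: ae_lebesgueS => eta /= ->.
Qed.

Definition log_cst := dens_cst d umax * 128 * width_cst.

Lemma weyl_g_log (k : R) : 0 <= k ->
  (\int[leb]_eta (ln ((k + eta) / `|k - eta|) * weyl_g eta)%:E <= log_cst%:E)%E.
Proof.
move=> k0; have w0 (x : R) : 0 < x -> 0 <= ln ((k + x) / `|k - x|).
  move=> x0; have [->|kx] := eqVneq k x; first by rewrite subrr normr0 invr0 mulr0 ln0.
  rewrite ln_ge0// ler_pdivlMr ?normr_gt0 ?subr_eq0// mul1r ler_norml.
  by apply/andP; split; lra.
rewrite -weyl_g_weight//; last exact: measurable_log_kernel.
apply: weyl_weight_bound => //; first exact: measurable_log_kernel.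
by move=> q q0; exact: integral_log_kernel.
Qed.

Lemma fine_EFinM (r : R) (x : \bar R) : 0 < r -> fine (r%:E * x) = r * fine x.
Proof.
move=> r0; case: x => [x| |] //=.
- by rewrite mulry gtr0_sg// mul1e mulr0.
- by rewrite mulrNy gtr0_sg// mul1e mulr0.
Qed.

(** Tonelli with the indicator of []k, km[] as weight; the inner integral over [eta] is
    [weyl_dens_FTC]. *)
Lemma RWyl_weyl_g k : 0 < k <= km ->
  RWyl d u0 xmax k = \int[leb]_(eta in `]k, km[) weyl_g eta.
Proof.
move=> kk; have /andP[k0 _] := kk.
rewrite (RWyl_gapW d0 adm)// /Rintegral -fine_EFinM; last by rewrite divr_gt0// mulr_gt0.
rewrite -ge0_integralZl//; last 3 first.
- apply/measurable_EFinP; apply: measurableT_comp.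
    exact: continuous_measurable_fun (@gapW_continuous R).
  by apply: measurable_funM => //; apply: measurable_funB => //; exact: (u0_measurable adm).
- by move=> x _; rewrite lee_fin gapW_ge0.
- by rewrite lee_fin divr_ge0// mulr_ge0// ltW.
pose w : R -> R := \1_(`]k, km[%classic : set R).
have mw : measurable_fun setT w by exact: measurable_indic.
have w0 x : 0 < x -> 0 <= w x by move=> _; rewrite /w indicE.
congr fine; rewrite [RHS]integral_mkcond.
transitivity (\int[leb]_eta (w eta * weyl_g eta)%:E)%E; last first.
  apply: eq_integral => eta _; rewrite patchE /w indicE.
  by case: ifP => _; rewrite ?mul1r ?mul0r.
rewrite -weyl_g_weight// weyl_tonelli//; apply: eq_integral => x _.
have uu : 0 < u0 x <= umax by rewrite (u0_gt0 adm) (u0_le adm).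
rewrite -EFinM -(weyl_dens_FTC d0 umax0 uu kk).
rewrite [LHS]integral_mkcond [RHS]integral_mkcond; apply: eq_integral => eta _.
rewrite !patchE !mem_setE /w indicE mem_setE !in_itv/=.
have [ke|ke] := ltP k eta => /=; last by case: ifP => _; rewrite ?mul0r.
by rewrite (lt_trans k0 ke)/=; case: ifP => _; rewrite ?mul1r.
Qed.

(** [RWyl] is a constant minus a primitive of an integrable function, so Lebesgue differentiation
    identifies its derivative almost everywhere. *)
Lemma rhoWyl_weyl_g : {ae leb, forall k, 0 < k < km -> rhoWyl d u0 xmax k = weyl_g k}.
Proof.
have ig (D : set R) : measurable D -> leb.-integrable D (EFin \o weyl_g).
  by move=> mD; apply: integrableS weyl_g_int.
have locg : locally_integrable setT weyl_g.
  by apply: open_integrable_locally => //; [exact: openT|exact: ig].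
have := @FTC1 R weyl_g (BRight 0) (fun y => ig _ (measurable_itv _)) locg.
apply: ae_lebesgueS => k /= h /andP[k0 kk]; have {h}[] := h; first by rewrite lte_fin.
set G := fun x : R => _; move=> dG G'.
(* [RWyl_weyl_g] covers only [0 < k <= km]; a derivative sees only nearby values, so agreement near
   an interior point is enough. *)
have near_eq : \forall z \near k, G km - G z = RWyl d u0 xmax z.
  near=> z.
  have zz : 0 < z < km.
    near: z; have := @near_in_itvoo R 0 km k; rewrite in_itv/= k0 kk => /(_ isT).
    by apply: filterS => z; rewrite in_itv.
  have /andP[z0 zk] := zz.
  rewrite RWyl_weyl_g ?z0 ?ltW// /G Rintegral_itvB//; last 2 first.
  - by rewrite bnd_simp ltW.
  - by rewrite bnd_simp ltW.
  - by rewrite Rintegral_itv_bndo_bndc//; exact: ig.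
  - exact: ig.
have derive_cstB (f : R -> R) c : derivable f k 1 -> 'D_1 (fun z => c - f z) k = - 'D_1 f k.
  by move=> df; rewrite (deriveB (derivable_cst _ _ _) df) derive_cst sub0r.
by rewrite /rhoWyl derive1E -(near_eq_derive _ near_eq) (derive_cstB _ _ dG) opprK -derive1E.
Unshelve. all: by end_near. Qed.

End weyl_law.

(** * Gram representation and definiteness of the interaction *)

(* The library's sigma-finite structure on [m1 \x m2] is shadowed by the one for
   subprobabilities, so it is attached to an alias. *)
Section sigma_finite_product.
Context d1 d2 (T1 : measurableType d1) (T2 : measurableType d2) (R : realType).
Variables (m1 : {sigma_finite_measure set T1 -> \bar R}).
Variables (m2 : {sigma_finite_measure set T2 -> \bar R}).

Definition mprod : set (T1 * T2) -> \bar R := (m1 \x m2)%E.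

HB.instance Definition _ := Measure.on mprod.

Lemma mprod_sigma_finite : sigma_finite setT mprod.
Proof.
have /sigma_finiteP[F [TF ndF Foo]] := sigma_finiteT m1.
have /sigma_finiteP[G [TG ndG Goo]] := sigma_finiteT m2.
exists (fun n => F n `*` G n).
  apply/esym; rewrite -subTset => -[x y] _.
  have [n _ Fx] : (\bigcup_n F n) x by rewrite -TF.
  have [k _ Gy] : (\bigcup_n G n) y by rewrite -TG.
  exists (n + k)%N => //; split => /=.
    by have /subsetPset := ndF _ _ (leq_addr k n); exact.
  by have /subsetPset := ndG _ _ (leq_addl n k); exact.
move=> n; have [mF Fy] := Foo n; have [mG Gy] := Goo n.
by split; [exact: measurableX|rewrite /mprod product_measure1E// lte_mul_pinfty// ge0_fin_numE].
Qed.

HB.instance Definition _ := Measure_isSigmaFinite.Build _ _ _ mprod mprod_sigma_finite.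

End sigma_finite_product.

(** * Quadratic forms of Gram kernels *)

Section gram_kernel.
Context d1 d2 (T : measurableType d1) (Z : measurableType d2) (R : realType).
Variables (m : {sigma_finite_measure set T -> \bar R}).
Variables (n : {sigma_finite_measure set Z -> \bar R}).
Variables (p q fe : T * Z -> R) (K K0 w : T * T -> R).
Hypotheses (mp : measurable_fun setT p) (mq : measurable_fun setT q).
Hypotheses (mfe : measurable_fun setT fe) (mK0 : measurable_fun setT K0).
Hypothesis mw : measurable_fun setT w.
Hypothesis (p_le : forall z, `|p z| <= fe z) (q_le : forall z, `|q z| <= fe z).
Hypothesis fe_le : forall z, 0 <= fe z <= 1.
Hypothesis w01 : forall z, w z = 0 \/ w z = 1.
Hypothesis w_ae : forall x, {ae m, forall y, w (x, y) = 1}.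
Hypothesis K0_ge0 : forall z, 0 <= K0 z.
Hypothesis K_w0 : forall z, w z = 0 -> K z = 0.
Variable D : set T.
Hypothesis K_gram : forall x y, D x -> D y -> w (x, y) = 1 ->
  (\int[n]_z (p (x, z) * p (y, z) + q (x, z) * q (y, z))%:E = (K (x, y))%:E)%E.
Hypothesis K0_gram : forall x y, D x -> D y -> w (x, y) = 1 ->
  (\int[n]_z (fe (x, z) * fe (y, z))%:E <= (K0 (x, y))%:E)%E.

Section pair.
Variables (r s : T -> R).
Hypothesis (r_int : m.-integrable setT (EFin \o r)).
Hypothesis (s_int : m.-integrable setT (EFin \o s)).
Hypothesis (rD : forall x, r x != 0 -> D x) (sD : forall x, s x != 0 -> D x).
Hypothesis K0_int :
  (\int[m]_x \int[m]_y (K0 (x, y) * (`|r x| * `|s y|))%:E < +oo)%E.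
Hypothesis Ks_int : forall x, D x -> m.-integrable setT (EFin \o (fun y => K (x, y) * s y)).

Let mr : measurable_fun setT r.
Proof. by apply/measurable_EFinP; exact: measurable_int r_int. Qed.
Let ms : measurable_fun setT s.
Proof. by apply/measurable_EFinP; exact: measurable_int s_int. Qed.

(** Integrating out [z] gives the kernel form, integrating out the pair gives the Gram products. The
    factor [w] is there to delete the diagonal, where in the application the feature integral
    diverges while the kernel has the default value 0. *)
Let F (z : (T * T) * Z) : \bar R :=
  (w z.1 * ((p (z.1.1, z.2) * p (z.1.2, z.2) + q (z.1.1, z.2) * q (z.1.2, z.2))
     * (r z.1.1 * s z.1.2)))%:E.

Let m11 : measurable_fun setT (fun z : (T * T) * Z => z.1.1).
Proof. by apply: measurableT_comp; [exact: measurable_fst|exact: measurable_fst]. Qed.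
Let m12 : measurable_fun setT (fun z : (T * T) * Z => z.1.2).
Proof. by apply: measurableT_comp; [exact: measurable_snd|exact: measurable_fst]. Qed.

Let mF : measurable_fun setT F.
Proof.
have m1 : measurable_fun setT (fun z : (T * T) * Z => (z.1.1, z.2)).
  by apply: measurable_fun_pair => //; exact: measurable_snd.
have m2 : measurable_fun setT (fun z : (T * T) * Z => (z.1.2, z.2)).
  by apply: measurable_fun_pair => //; exact: measurable_snd.
apply/measurable_EFinP; apply: measurable_funM.
  by apply: measurableT_comp => //; exact: measurable_fst.
apply: measurable_funM; last by apply: measurable_funM; exact: measurableT_comp.
by apply: measurable_funD; apply: measurable_funM; exact: measurableT_comp.
Qed.

Let pq_le x y z : `|p (x, z) * p (y, z) + q (x, z) * q (y, z)| <= 2 * (fe (x, z) * fe (y, z)).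
Proof.
rewrite (le_trans (ler_normD _ _))// !normrM.
have h1 : `|p (x, z)| * `|p (y, z)| <= fe (x, z) * fe (y, z) by rewrite ler_pM.
have h2 : `|q (x, z)| * `|q (y, z)| <= fe (x, z) * fe (y, z) by rewrite ler_pM.
lra.
Qed.

Let fe_ge0 z : 0 <= fe z. Proof. by have /andP[] := fe_le z. Qed.

Let pair1m {d3 d4} (A : measurableType d3) (B : measurableType d4) (f : A * B -> R) x :
  measurable_fun setT f -> measurable_fun setT (fun y => f (x, y)).
Proof. by move=> mf; apply: measurableT_comp => //; exact: pair1_measurable. Qed.

(** Integrating [|F|] over [z] first leaves at most [2 * K0] times [|r| |s|], whose double integral
    is finite by [K0_int]. *)
Let F_int : (mprod m m \x n)%E.-integrable setT F.
Proof.
apply/integrable12ltyP => //.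
have mB : measurable_fun setT (fun z : T * T => (K0 z * (`|r z.1| * `|s z.2|))%:E).
  apply/measurable_EFinP; apply: measurable_funM => //; apply: measurable_funM.
    by apply: measurableT_comp => //; apply: measurableT_comp => //; exact: measurable_fst.
  by apply: measurableT_comp => //; apply: measurableT_comp => //; exact: measurable_snd.
have B0 (z : T * T) : (0 <= (K0 z * (`|r z.1| * `|s z.2|))%:E)%E.
  by rewrite lee_fin mulr_ge0// mulr_ge0.
apply: (@le_lt_trans _ _ (\int[m \x m]_z (2%:E * (K0 z * (`|r z.1| * `|s z.2|))%:E))%E); last first.
  rewrite ge0_integralZl// (fubini_tonelli1 _ mB)//.
  by rewrite lte_mul_pinfty// K0_int.
apply: ge0_le_integral => //.
- by move=> z _; apply: integral_ge0 => y _; exact: abse_ge0.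
- exact: (measurable_fun_fubini_tonelli_F (fun z => `|F z|)%E (measurableT_comp _ mF)).
- exact: emeasurable_funM.
move=> [x y] _ /=; rewrite /F /=.
have [->|wE] := w01 (x, y).
  under eq_integral do rewrite mul0r normr0.
  by rewrite integral0 mule_ge0// B0.
have [rs0|rs0] := eqVneq (r x * s y) 0.
  under eq_integral do rewrite rs0 !mulr0 normr0.
  by rewrite integral0 mule_ge0// (B0 (x, y)).
move: rs0; rewrite mulf_eq0 negb_or => /andP[/rD Dx /sD Dy].
apply: (@le_trans _ _ (\int[n]_z ((2 * (`|r x| * `|s y|))%:E * (fe (x, z) * fe (y, z))%:E))%E).
  apply: ge0_le_integral => //.
  - apply/measurable_EFinP; apply: measurableT_comp => //.
    apply: measurable_funM => //; apply: measurable_funM => //.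
    by apply: measurable_funD; apply: measurable_funM; exact: pair1m.
  - apply: emeasurable_funM => //; apply/measurable_EFinP.
    by apply: measurable_funM; exact: pair1m.
  - move=> z _; rewrite wE mul1r -EFinM lee_fin normrM [`|r x * s y|]normrM.
    have -> : 2 * (`|r x| * `|s y|) * (fe (x, z) * fe (y, z)) =
      2 * (fe (x, z) * fe (y, z)) * (`|r x| * `|s y|) by ring.
    by rewrite ler_wpM2r// mulr_ge0.
rewrite ge0_integralZl//; last 2 first.
- by apply/measurable_EFinP; apply: measurable_funM; exact: pair1m.
- by move=> z _; rewrite lee_fin mulr_ge0.
have -> : (2%:E * (K0 (x, y) * (`|r x| * `|s y|))%:E =
    (2 * (`|r x| * `|s y|))%:E * (K0 (x, y))%:E)%E by rewrite -!EFinM; congr EFin; ring.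
by rewrite lee_wpmul2l ?K0_gram// lee_fin mulr_ge0// mulr_ge0.
Qed.

Let left_z x y : (\int[n]_z F ((x, y), z) = (K (x, y) * (r x * s y))%:E)%E.
Proof.
rewrite /F/=; have [wE|wE] := w01 (x, y).
  under eq_integral do rewrite wE mul0r.
  by rewrite integral0 K_w0// mul0r.
have [rs0|rs0] := eqVneq (r x * s y) 0.
  under eq_integral do rewrite rs0 !mulr0.
  by rewrite integral0 rs0 mulr0.
move: (rs0); rewrite mulf_eq0 negb_or => /andP[/rD Dx /sD Dy].
have Kxy := K_gram Dx Dy wE.
have mpq : measurable_fun setT (fun z => p (x, z) * p (y, z) + q (x, z) * q (y, z)).
  by apply: measurable_funD; apply: measurable_funM; exact: pair1m.
under eq_integral do rewrite wE mul1r mulrC EFinM.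
rewrite integralZl//; first by rewrite Kxy -EFinM mulrC.
apply/integrableP; split; first exact/measurable_EFinP.
apply: (@le_lt_trans _ _ (\int[n]_z (2%:E * (fe (x, z) * fe (y, z))%:E))%E).
  apply: ge0_le_integral => //.
  - by apply: measurableT_comp => //; exact/measurable_EFinP.
  - apply: emeasurable_funM => //; apply/measurable_EFinP.
    by apply: measurable_funM; exact: pair1m.
  - by move=> z _; rewrite -EFinM lee_fin.
rewrite ge0_integralZl//; last 2 first.
- by apply/measurable_EFinP; apply: measurable_funM; exact: pair1m.
- by move=> z _; rewrite lee_fin mulr_ge0.
by rewrite lte_mul_pinfty// (le_lt_trans (K0_gram Dx Dy wE))// ltry.
Qed.

Let P (f : T -> R) z := \int[m]_x (p (x, z) * f x).
Let Q (f : T -> R) z := \int[m]_x (q (x, z) * f x).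

Let pair2m {d3 d4} (A : measurableType d3) (B : measurableType d4) (f : A * B -> R) y :
  measurable_fun setT f -> measurable_fun setT (fun x => f (x, y)).
Proof. by move=> mf; apply: measurableT_comp => //; exact: pair2_measurable. Qed.

Let bounded_int (h f : T -> R) : measurable_fun setT h -> (forall x, `|h x| <= 1) ->
  m.-integrable setT (EFin \o f) -> m.-integrable setT (EFin \o (fun x => h x * f x)).
Proof.
move=> mh h1 fi; apply: (le_integrable measurableT _ _ fi).
  apply/measurable_EFinP; apply: measurable_funM => //.
  by apply/measurable_EFinP; exact: measurable_int fi.
by move=> x _; rewrite lee_fin normrM ler_piMl.
Qed.

Let p1 z : `|p z| <= 1. Proof. by apply: le_trans (p_le z) _; have /andP[] := fe_le z. Qed.
Let q1 z : `|q z| <= 1. Proof. by apply: le_trans (q_le z) _; have /andP[] := fe_le z. Qed.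

Let pf_int f z : m.-integrable setT (EFin \o f) ->
  m.-integrable setT (EFin \o (fun x => p (x, z) * f x)).
Proof. by apply: bounded_int => //; exact: pair2m. Qed.
Let qf_int f z : m.-integrable setT (EFin \o f) ->
  m.-integrable setT (EFin \o (fun x => q (x, z) * f x)).
Proof. by apply: bounded_int => //; exact: pair2m. Qed.

Let lin_int (a b : R) (f g : T -> R) : m.-integrable setT (EFin \o f) ->
  m.-integrable setT (EFin \o g) ->
  (\int[m]_x (a * f x + b * g x)%:E = (a * \int[m]_x f x + b * \int[m]_x g x)%:E)%E.
Proof.
move=> fi gi.
have ai := @integrableZl _ _ _ m setT measurableT a _ fi.
have bi := @integrableZl _ _ _ m setT measurableT b _ gi.
under eq_integral do rewrite EFinD !EFinM.
rewrite integralD// !integralZl// /Rintegral EFinD !EFinM !fineK//;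
  exact: integrable_fin_num.
Qed.

(** For fixed [z] the features are bounded by 1, so the double integral converges and factorizes;
    the set deleted by [w] is null in [y] for each [x]. *)
Let right_xy z : (\int[mprod m m]_xy F (xy, z) = (P r z * P s z + Q r z * Q s z)%:E)%E.
Proof.
have mFz : measurable_fun setT (fun xy => F (xy, z)).
  by apply: measurableT_comp mF _; exact: pair2_measurable.
rewrite -[LHS](integral12_prod_meas1 (m1 := m) (m2 := m)); last first.
  apply/integrable12ltyP => //.
  pose B (xy : T * T) := (2%:E * (`|r xy.1| * `|s xy.2|)%:E)%E.
  have mB' : measurable_fun setT (fun xy : T * T => (`|r xy.1| * `|s xy.2|)%:E).
    apply/measurable_EFinP; apply: measurable_funM.
      by apply: measurableT_comp => //; apply: measurableT_comp => //; exact: measurable_fst.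
    by apply: measurableT_comp => //; apply: measurableT_comp => //; exact: measurable_snd.
  have mB : measurable_fun setT B by exact: emeasurable_funM.
  have B0 xy : (0 <= B xy)%E by rewrite mule_ge0// lee_fin mulr_ge0.
  apply: (@le_lt_trans _ _ (\int[m]_x \int[m]_y B (x, y))%E).
    apply: ge0_le_integral => //.
    - by move=> x _; exact: integral_ge0.
    - exact: (measurable_fun_fubini_tonelli_F (fun z0 => `|F (z0, z)|)%E (measurableT_comp _ mFz)).
    - exact: measurable_fun_fubini_tonelli_F.
    move=> x _; apply: ge0_le_integral => //.
    - by apply: measurableT_comp => //; exact: (measurableT_comp mFz (pair1_measurable x)).
    - by apply: measurableT_comp => //; exact: pair1_measurable.
    move=> y _; rewrite /F /B /= -EFinM lee_fin normrM [`|_ * (r x * s y)|]normrM [`|r x * s y|]normrM.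
    have h1 : `|w (x, y)| <= 1 by case: (w01 (x, y)) => ->; rewrite ?normr0 ?normr1.
    have h2 := pq_le x y z.
    have h3 : fe (x, z) * fe (y, z) <= 1.
      have /andP[? ?] := fe_le (x, z); have /andP[? ?] := fe_le (y, z).
      by rewrite mulr_ile1.
    have h4 : 0 <= `|r x| * `|s y| by rewrite mulr_ge0.
    rewrite mulrA ler_wpM2r//; apply: (@le_trans _ _ (1 * (2 * 1))); last by lra.
    by rewrite ler_pM//; lra.
  have sabs := integrable_fin_num measurableT (integrable_abse s_int).
  have /integrableP[_ rabs] := r_int.
  have Bx x : (\int[m]_y B (x, y) = (2 * fine (\int[m]_y `|(EFin \o s) y|))%:E * `|(EFin \o r) x|)%E.
    transitivity (\int[m]_y ((2 * `|r x|)%:E * `|(EFin \o s) y|))%E.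
      by apply: eq_integral => y _; rewrite /B/= -!EFinM; congr EFin; ring.
    rewrite ge0_integralZl//; last first.
      by apply/measurable_EFinP; exact: measurableT_comp.
    by rewrite -{1}(fineK sabs) -!EFinM; congr EFin; rewrite /=; ring.
  under eq_integral do rewrite Bx.
  have s0 : 0 <= fine (\int[m]_y `|(EFin \o s) y|)%E.
    by apply: fine_ge0; apply: integral_ge0 => y _; exact: abse_ge0.
  rewrite ge0_integralZl//; last 2 first.
  - by apply/measurable_EFinP; exact: measurableT_comp.
  - by rewrite lee_fin mulr_ge0.
  by rewrite lte_mul_pinfty// lee_fin mulr_ge0.
rewrite /fubini_F.
transitivity (\int[m]_x (r x * (p (x, z) * P s z + q (x, z) * Q s z))%:E)%E.
  apply: eq_integral => x _.
  transitivity (\int[m]_y (r x * p (x, z) * (p (y, z) * s y) + r x * q (x, z) * (q (y, z) * s y))%:E)%E.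
    apply: ae_eq_integral => //.
    - exact: (measurableT_comp mFz (pair1_measurable x)).
    - apply/measurable_EFinP; apply: measurable_funD; apply: measurable_funM => //;
      by apply: measurable_funM => //; exact: pair2m.
    - apply: filterS (w_ae x) => y wE _; rewrite /F/= wE; congr EFin; ring.
  rewrite lin_int; [|exact: pf_int|exact: qf_int].
  by congr EFin; rewrite /P /Q; ring.
transitivity (\int[m]_x (P s z * (p (x, z) * r x) + Q s z * (q (x, z) * r x))%:E)%E.
  by apply: eq_integral => x _; congr EFin; ring.
rewrite lin_int; [|exact: pf_int|exact: qf_int].
by congr EFin; rewrite /P /Q; ring.
Qed.

Lemma gram_integrable :
  n.-integrable setT (EFin \o (fun z => P r z * P s z + Q r z * Q s z)).
Proof.
have GE : EFin \o (fun z => P r z * P s z + Q r z * Q s z) = fubini_G (mprod m m) F.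
  by apply/funext => z; rewrite /fubini_G right_xy.
have mG : measurable_fun setT (fubini_G (mprod m m) F) := measurable_fubini_G F_int.
rewrite GE; apply/integrableP; split => //.
have := (integrable21ltyP _ _ mF).1 F_int; apply: le_lt_trans.
apply: ge0_le_integral => //.
- exact: measurableT_comp.
- exact: (measurable_fun_fubini_tonelli_G (m1 := mprod m m) (fun z => `|F z|)%E (measurableT_comp _ mF)).
- move=> z _; apply: le_abse_integral => //.
  by apply: measurableT_comp mF _; exact: pair2_measurable.
Qed.

(** Fubini for [F], with [left_z] computing one iterated integral and [right_xy] the other. *)
Lemma gram_form : \int[m]_x ((\int[m]_y (K (x, y) * s y)) * r x) =
  \int[n]_z (P r z * P s z + Q r z * Q s z).
Proof.
rewrite /Rintegral; congr fine.
transitivity (\int[n]_z \int[mprod m m]_xy F (xy, z))%E; last first.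
  by apply: eq_integral => z _; rewrite right_xy.
rewrite -(Fubini F_int).
transitivity (\int[m]_x \int[m]_y (K (x, y) * (r x * s y))%:E)%E.
  apply: eq_integral => x _.
  have [r0|r0] := eqVneq (r x) 0.
    rewrite r0 mulr0 integral0_eq// => y _; by rewrite mul0r mulr0.
  have Ki := Ks_int (rD r0).
  rewrite mulrC EFinM fineK; last exact: integrable_fin_num Ki.
  rewrite -integralZl//; apply: eq_integral => y _.
  by rewrite -EFinM; congr EFin; ring.
have Ki : (m \x m)%E.-integrable setT (fun xy => (K xy * (r xy.1 * s xy.2))%:E).
  have := integrable_fubini_F F_int; apply: eq_integrable => // -[x y] _.
  by rewrite /fubini_F left_z.
transitivity (\int[m \x m]_xy (K xy * (r xy.1 * s xy.2))%:E)%E.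
  by rewrite -(integral12_prod_meas1 Ki).
by apply: eq_integral => -[x y] _; rewrite left_z.
Qed.

End pair.
End gram_kernel.

(** * Laplace features of the logarithmic kernel *)

Section laplace.
Context {R : realType}.
Notation leb := (@lebesgue_measure R).

Lemma expRN_cvgy (P : R) : 0 < P -> expR (- (x * P)) @[x --> +oo] --> (0 : R).
Proof.
move=> P0; have h : expR (- x) @[x --> +oo] --> (0 : R) by exact: cvgr_expR.
apply: (@cvg_comp _ _ _ (fun x : R => x * P) (fun y => expR (- y)) _ (pinfty_nbhs R)) => //.
by apply: gt0_cvgMly => //; exact: cvg_id.
Qed.

Lemma is_derive_expRN (P x : R) : is_derive x 1 (fun y : R => expR (- (y * P))) (- P * expR (- (x * P))).
Proof.
have h1 : is_derive x 1 (fun y : R => - (y * P)) (- P).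
  by apply: is_derive_eq; rewrite /GRing.scale/=; ring.
have h2 : is_derive (- (x * P)) 1 (@expR R) (expR (- (x * P))) by exact: is_derive_expR.
have h3 : is_derive x 1 (fun y : R => expR (- (y * P))) (expR (- (x * P)) * - P).
  exact: (@is_derive1_comp R (@expR R) (fun y : R => - (y * P)) x _ _ h2 h1).
by apply: (is_derive_eq h3); rewrite mulrC.
Qed.

Lemma integral_expR_cos (P A : R) : 0 < P ->
  leb.-integrable `[0, +oo[ (EFin \o (fun x => expR (- (x * P)) * cos (x * A))) /\
  (\int[leb]_(x in `[0%R, +oo[) (expR (- (x * P)) * cos (x * A))%:E = (P / (P ^+ 2 + A ^+ 2))%:E)%E.
Proof.
move=> P0; have N0 : 0 < P ^+ 2 + A ^+ 2 by rewrite ltr_wpDr ?sqr_ge0// exprn_gt0.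
have Nn : P ^+ 2 + A ^+ 2 != 0 by rewrite gt_eqF.
have Pn : P != 0 by rewrite gt_eqF.
pose f2 (x : R) : R := expR (- (x * P)); pose F2 (x : R) : R := - P^-1 * expR (- (x * P)).
(* Adding 1 to the cosine makes the integrand nonnegative, so that the fundamental theorem on the
   half line applies; the pure exponential [f2] is subtracted afterwards. *)
pose f1 (x : R) : R := expR (- (x * P)) * (1 + cos (x * A)).
pose G (x : R) : R := (- P * cos (x * A) + A * sin (x * A)) / (P ^+ 2 + A ^+ 2) - P^-1.
pose F1 (x : R) : R := expR (- (x * P)) * G x.
have dE (x : R) := is_derive_expRN P x.
have dcos (x : R) : is_derive x 1 (fun y : R => cos (y * A)) (- sin (x * A) * A).
  have h1 : is_derive x 1 (fun y : R => y * A) A.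
    by apply: is_derive_eq; rewrite /GRing.scale/=; ring.
  exact: (@is_derive1_comp R (@cos R) (fun y : R => y * A) x _ _ (is_derive_cos (x * A)) h1).
have dsin (x : R) : is_derive x 1 (fun y : R => sin (y * A)) (cos (x * A) * A).
  have h1 : is_derive x 1 (fun y : R => y * A) A.
    by apply: is_derive_eq; rewrite /GRing.scale/=; ring.
  exact: (@is_derive1_comp R (@sin R) (fun y : R => y * A) x _ _ (is_derive_sin (x * A)) h1).
have dF2 (x : R) : is_derive x 1 F2 (f2 x).
  apply: (is_derive_eq (@is_deriveZ _ _ _ _ (- P^-1) _ _ _ (dE x))).
  by rewrite /GRing.scale/= /f2; field.
have dG (x : R) : is_derive x 1 G ((P * sin (x * A) * A + A * (cos (x * A) * A)) / (P ^+ 2 + A ^+ 2)).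
  have a1 := @is_deriveZ _ _ _ _ (- P) _ _ _ (dcos x).
  have a2 := @is_deriveZ _ _ _ _ A _ _ _ (dsin x).
  have a3 := @is_deriveZ _ _ _ _ (P ^+ 2 + A ^+ 2)^-1 _ _ _ (is_deriveD a1 a2).
  have a4 := is_deriveB a3 (is_derive_cst (P^-1 : R^o) (x : R^o) (1 : R^o)).
  have -> : G = (P ^+ 2 + A ^+ 2)^-1 \*: (((- P) \*: (fun y : R => cos (y * A))) + (A \*: (fun y : R => sin (y * A)))) - cst (P^-1 : R^o).
    by apply/funext => y; rewrite /G mulrC.
  by apply: (is_derive_eq a4); rewrite /GRing.scale/=; field.
have dF1 (x : R) : is_derive x 1 F1 (f1 x).
  apply: (is_derive_eq (is_deriveM (dE x) (dG x))).
  by rewrite /GRing.scale/= /f1 /G; field; rewrite Pn.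
have cF1 (x : R) : {for x, continuous F1} := is_derive_continuous (dF1 x).
have cF2 (x : R) : {for x, continuous F2} := is_derive_continuous (dF2 x).
have cf2 (x : R) : {for x, continuous f2} := is_derive_continuous (dE x).
have cf1 (x : R) : {for x, continuous f1}.
  apply: cvgM; first exact: cf2.
  by apply: cvgD; [exact: cvg_cst|exact: is_derive_continuous (dcos x)].
have i2 : (\int[leb]_(x in `[0%R, +oo[) (f2 x)%:E = (0 : R)%:E - (F2 0)%:E)%E.
  apply: ge0_continuous_FTC2y.
  - by move=> x _; exact: expR_ge0.
  - exact: continuous_subspaceT.
  - rewrite -(mulr0 (- P^-1)); apply: cvgM; [exact: cvg_cst|exact: expRN_cvgy].
  - by move=> x _; have [] := dF2 x.
  - by apply: cvg_at_right_filter; exact: cF2.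
  - by move=> x _; exact: (is_derive1P (dF2 x)).2.
have i1 : (\int[leb]_(x in `[0%R, +oo[) (f1 x)%:E = (0 : R)%:E - (F1 0)%:E)%E.
  apply: ge0_continuous_FTC2y.
  - move=> x _; rewrite mulr_ge0 ?expR_ge0//; have := cos_geN1 (x * A); lra.
  - exact: continuous_subspaceT.
  - pose C := (P + `|A|) / (P ^+ 2 + A ^+ 2) + P^-1.
    have GC x : `|G x| <= C.
      rewrite (le_trans (ler_normB _ _))// lerD//.
        rewrite normrM (ger0_norm (x := _^-1)) ?invr_ge0 ?(ltW N0)// ler_pM2r ?invr_gt0//.
        rewrite (le_trans (ler_normD _ _))// !normrM normrN (gtr0_norm P0) lerD//.
          by rewrite ler_piMr ?(ltW P0)// cos_max.
        by rewrite ler_piMr// sin_max.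
      by rewrite ger0_norm// invr_ge0 ltW.
    have h0 : expR (- (x * P)) * C @[x --> +oo] --> (0 : R).
      by rewrite -(mul0r C); apply: cvgM; [exact: expRN_cvgy|exact: cvg_cst].
    have h1 : - (expR (- (x * P)) * C) @[x --> +oo] --> (0 : R).
      by rewrite -oppr0; exact: cvgN.
    apply: (squeeze_cvgr _ h1 h0); near=> x.
    by rewrite -ler_norml normrM (ger0_norm (expR_ge0 _)) ler_wpM2l// expR_ge0.
  - by move=> x _; have [] := dF1 x.
  - by apply: cvg_at_right_filter; exact: cF1.
  - by move=> x _; exact: (is_derive1P (dF1 x)).2.
have mf1 : measurable_fun setT f1 by exact: continuous_measurable_fun cf1.
have mf2 : measurable_fun setT f2 by exact: continuous_measurable_fun cf2.
have int1 : leb.-integrable `[0, +oo[ (EFin \o f1).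
  apply/integrableP; split; first by apply/measurable_EFinP; exact: measurable_funTS.
  apply: (@le_lt_trans _ _ (\int[leb]_(x in `[0%R, +oo[) (f1 x)%:E)%E); last first.
    by rewrite i1 -EFinB ltry.
  rewrite le_eqVlt; apply/orP; left; apply/eqP; apply: eq_integral => x _ /=.
  by rewrite ger0_norm// mulr_ge0 ?expR_ge0//; have := cos_geN1 (x * A); lra.
have int2 : leb.-integrable `[0, +oo[ (EFin \o f2).
  apply/integrableP; split; first by apply/measurable_EFinP; exact: measurable_funTS.
  apply: (@le_lt_trans _ _ (\int[leb]_(x in `[0%R, +oo[) (f2 x)%:E)%E); last first.
    by rewrite i2 -EFinB ltry.
  rewrite le_eqVlt; apply/orP; left; apply/eqP; apply: eq_integral => x _ /=.
  by rewrite ger0_norm// expR_ge0.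
have fE (x : R) : expR (- (x * P)) * cos (x * A) = f1 x - f2 x by rewrite /f1 /f2; ring.
split.
  have -> : EFin \o (fun x => expR (- (x * P)) * cos (x * A)) = ((EFin \o f1) \- (EFin \o f2))%E.
    by apply/funext => x; rewrite /= fE EFinB.
  exact: integrableB.
under eq_integral do rewrite fE.
rewrite integralB_EFin// i1 i2 -!EFinB; congr EFin.
rewrite /F1 /F2 /G !mul0r oppr0 expR0 cos0 sin0; field; rewrite Pn Nn//.
Unshelve. all: by end_near. Qed.

End laplace.

Section laplace_features.
Context {R : realType}.
Notation leb := (@lebesgue_measure R).

(** The argument is read as [(k, (s, xi))]; this is the common envelope of the cosine and sine
    features. *)
Definition feat (z : R * (R * R)) : R :=
  if [&& 0 < z.2.1, z.2.1 < z.1 & 0 < z.2.2] then expR (- (z.2.2 * (z.1 - z.2.1))) else 0.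

Lemma feat01 z : 0 <= feat z <= 1.
Proof.
rewrite /feat; case: ifPn => [/and3P[h1 h2 h3]|_]; last by rewrite lexx ler01.
rewrite expR_ge0/= -[leRHS]expR0 ler_expR oppr_le0 mulr_ge0 ?ltW// subr_gt0//.
Qed.

Lemma measurable_feat : measurable_fun setT feat.
Proof.
have m1 : measurable_fun setT (fun z : R * (R * R) => z.1) by exact: measurable_fst.
have m2 : measurable_fun setT (fun z : R * (R * R) => z.2.1).
  by apply: measurableT_comp; [exact: measurable_fst|exact: measurable_snd].
have m3 : measurable_fun setT (fun z : R * (R * R) => z.2.2).
  by apply: measurableT_comp; [exact: measurable_snd|exact: measurable_snd].
apply: measurable_fun_ifT => //.
  apply: measurable_and; first exact: measurable_fun_ltr.
  by apply: measurable_and; exact: measurable_fun_ltr.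
apply: measurableT_comp; first exact: measurable_expR.
by apply: measurable_funN; apply: measurable_funM => //; exact: measurable_funB.
Qed.

Definition half_kernel (k e A : R) : R :=
  1 / 2 * ln (Num.sqrt ((k + e) ^+ 2 + A ^+ 2) / Num.sqrt ((k - e) ^+ 2 + A ^+ 2)).

Lemma feat_inner (k e A s : R) :
  (\int[leb]_xi (feat (k, (s, xi)) * feat (e, (s, xi)) * cos (xi * A))%:E =
   (if 0 < s < Num.min k e then (k + e - 2 * s) / ((k + e - 2 * s) ^+ 2 + A ^+ 2) else 0)%:E)%E.
Proof.
case: ifPn => [/andP[s0]|]; last first.
  rewrite negb_and -leNgt lt_min negb_and => h; apply: integral0_eq => xi _.
  rewrite /feat/=; case: (ltP 0 s) h => //= s0; last by rewrite !mul0r.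
  by case: (ltP s k) => //=; case: (ltP s e) => //= *; rewrite ?mulr0 ?mul0r.
rewrite lt_min => /andP[sk se].
have P0 : 0 < k + e - 2 * s by lra.
have [i0 <-] := integral_expR_cos A P0.
rewrite -integral_itv_obnd_cbnd; last first.
  apply: measurable_funS (measurable_int leb i0) => //.
  by apply: subset_itvr; rewrite bnd_simp.
rewrite [RHS]integral_mkcond; apply: eq_integral => xi _.
rewrite patchE mem_setE in_itv/= andbT /feat/= s0 sk se/=.
case: ifPn => x0; last by rewrite !mul0r.
congr (_ * _)%:E; rewrite -expRD; congr expR; ring.
Qed.

(** With [P = k + e - 2 * s] the primitive is [- (1 / 4) * ln (P ^+ 2 + A ^+ 2)]; [P] decreases from
    [k + e] to [|k - e|], and [k != e] keeps it positive. *)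
Lemma feat_outer (k e A : R) : 0 < k -> 0 < e -> k != e ->
  (\int[leb]_s (if 0 < s < Num.min k e then
      (k + e - 2 * s) / ((k + e - 2 * s) ^+ 2 + A ^+ 2) else 0)%:E = (half_kernel k e A)%:E)%E.
Proof.
move=> k0 e0 ke; set mn := Num.min k e.
have mn0 : 0 < mn by rewrite lt_min k0.
have mk : mn <= k by rewrite /mn ge_min lexx.
have me : mn <= e by rewrite /mn ge_min lexx orbT.
have Ppos s : 0 <= s <= mn -> 0 < k + e - 2 * s.
  move=> /andP[_ sm]; move: ke; rewrite neq_lt => /orP[h|h].
    have : mn = k by rewrite /mn min_l// ltW.
    lra.
  have : mn = e by rewrite /mn min_r// ltW.
  lra.
pose P (s : R) : R := k + e - 2 * s.
pose N (s : R) : R := P s ^+ 2 + A ^+ 2.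
have Npos s : 0 <= s <= mn -> 0 < N s.
  by move=> h; rewrite /N ltr_wpDr ?sqr_ge0// exprn_gt0// Ppos.
have dP (s : R) : is_derive s 1 P (- 2).
  have h := is_deriveB (is_derive_cst (k + e : R^o) (s : R^o) (1 : R^o)) (@is_deriveZ _ _ _ _ 2 _ _ _ (is_derive_id s 1)).
  by apply: (is_derive_eq h); rewrite /GRing.scale/= sub0r mulr1.
have dN (s : R) : is_derive s 1 N (- 4 * P s).
  have h1 := is_deriveM (dP s) (dP s).
  have h := is_deriveD h1 (is_derive_cst (A ^+ 2 : R^o) (s : R^o) (1 : R^o)).
  have -> : N = P * P + cst (A ^+ 2 : R^o) by apply/funext => y; rewrite /N expr2.
  by apply: (is_derive_eq h); rewrite /GRing.scale/=; ring.
pose F (s : R) : R := - (1 / 4) * ln (N s).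
have dF (s : R) : 0 <= s <= mn -> is_derive s 1 F (P s / N s).
  move=> h; have h1 := @is_derive1_comp R (@ln R) N s _ _ (is_derive1_ln (Npos s h)) (dN s).
  apply: (is_derive_eq (@is_deriveZ _ _ _ _ (- (1 / 4)) _ _ _ h1)).
  by rewrite /GRing.scale/=; field; rewrite gt_eqF// Npos.
transitivity (\int[leb]_(s in `]0%R, mn[) (P s / N s)%:E)%E.
  rewrite [RHS]integral_mkcond; apply: eq_integral => s _.
  by rewrite patchE mem_setE in_itv/=; case: ifP.
have -> : half_kernel k e A = F mn - F 0.
  have N0 := Npos 0; have Nm := Npos mn.
  have ln_sqrt x : 0 < x -> ln (Num.sqrt x) = ln x / 2.
    move=> x0; rewrite -{2}(sqr_sqrtr (ltW x0)) lnXn ?sqrtr_gt0// -[X in _ = X / 2]mulr_natl; by field.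
  have E1 : (k + e) ^+ 2 + A ^+ 2 = N 0 by rewrite /N /P mulr0 subr0.
  have E2 : (k - e) ^+ 2 + A ^+ 2 = N mn.
    rewrite /N /P /mn; case: (leP k e) => _; ring.
  have -> : half_kernel k e A = 1 / 2 * ln (Num.sqrt (N 0) / Num.sqrt (N mn)).
    by rewrite -E1 -E2.
  rewrite ln_div ?posrE ?sqrtr_gt0 ?N0 ?Nm ?lexx ?ltW//.
  rewrite !ln_sqrt ?N0 ?Nm ?lexx ?ltW// /F; by field.
have := @ge0_integral_oo_FTC R (fun s => P s / N s) F 0 mn mn0; apply.
- move=> s; rewrite in_itv/= => /andP[s0 sm].
  have sm' : 0 <= s <= mn by rewrite !ltW.
  apply: cvgM; first exact: is_derive_continuous (dP s).
  by apply: cvgV; [rewrite gt_eqF// Npos|exact: is_derive_continuous (dN s)].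
- move=> s /andP[s0 sm]; have sm' : 0 <= s <= mn by rewrite !ltW.
  by rewrite divr_ge0// ltW ?Npos ?Ppos.
- apply: continuous_in_subspaceT => s; rewrite inE/= in_itv/= => h.
  exact: is_derive_continuous (dF s h).
- move=> s /andP[s0 sm]; have sm' : 0 <= s <= mn by rewrite !ltW.
  exact: is_derive1P (dF s sm').
Qed.

Variable aR : R -> R.
Hypothesis maR : measurable_fun setT aR.

Definition featc (z : R * (R * R)) := feat z * cos (z.2.2 * aR z.1).
Definition feats (z : R * (R * R)) := feat z * sin (z.2.2 * aR z.1).

Let mphase : measurable_fun setT (fun z : R * (R * R) => z.2.2 * aR z.1).
Proof.
apply: measurable_funM; last by apply: measurableT_comp => //; exact: measurable_fst.
by apply: measurableT_comp; [exact: measurable_snd|exact: measurable_snd].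
Qed.

Lemma measurable_featc : measurable_fun setT featc.
Proof.
apply: measurable_funM; first exact: measurable_feat.
apply: measurableT_comp => //; exact: continuous_measurable_fun (@continuous_cos R).
Qed.

Lemma measurable_feats : measurable_fun setT feats.
Proof.
apply: measurable_funM; first exact: measurable_feat.
apply: measurableT_comp => //; exact: continuous_measurable_fun (@continuous_sin R).
Qed.

Lemma featc_le z : `|featc z| <= feat z.
Proof.
have /andP[h0 h1] := feat01 z.
by rewrite normrM (ger0_norm h0) ler_piMr// cos_max.
Qed.

Lemma feats_le z : `|feats z| <= feat z.
Proof.
have /andP[h0 h1] := feat01 z.
by rewrite normrM (ger0_norm h0) ler_piMr// sin_max.
Qed.

Let pair1m {d3 d4} (A : measurableType d3) (B : measurableType d4) (f : A * B -> R) x :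
  measurable_fun setT f -> measurable_fun setT (fun y => f (x, y)).
Proof. by move=> mf; apply: measurableT_comp => //; exact: pair1_measurable. Qed.

Lemma feat_gram (k e : R) : 0 < k -> 0 < e -> k != e ->
  (\int[mprod leb leb]_z (feat (k, z) * feat (e, z))%:E = (half_kernel k e 0)%:E)%E.
Proof.
move=> k0 e0 ke; rewrite -(feat_outer 0 k0 e0 ke).
rewrite [LHS](fubini_tonelli1 (m1 := leb) (m2 := leb) (fun z => (feat (k, z) * feat (e, z))%:E)); last 2 first.
- by apply/measurable_EFinP; apply: measurable_funM; apply: pair1m; exact: measurable_feat.
- by move=> z; rewrite lee_fin mulr_ge0//; [have /andP[] := feat01 (k, z)|have /andP[] := feat01 (e, z)].
apply: eq_integral => s _; rewrite -feat_inner /fubini_F; apply: eq_integral => xi _.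
by rewrite mulr0 cos0 mulr1.
Qed.

Lemma featcs_gram (k e : R) : 0 < k -> 0 < e -> k != e ->
  (\int[mprod leb leb]_z (featc (k, z) * featc (e, z) + feats (k, z) * feats (e, z))%:E =
   (half_kernel k e (aR k - aR e))%:E)%E.
Proof.
move=> k0 e0 ke; rewrite -(feat_outer _ k0 e0 ke).
have mcs : measurable_fun setT (fun z => featc (k, z) * featc (e, z) + feats (k, z) * feats (e, z)).
  by apply: measurable_funD; apply: measurable_funM; apply: pair1m;
    [exact: measurable_featc..|exact: measurable_feats|exact: measurable_feats].
have csE z : featc (k, z) * featc (e, z) + feats (k, z) * feats (e, z) =
    feat (k, z) * feat (e, z) * cos (z.2 * (aR k - aR e)).
  by rewrite /featc /feats /= mulrBr cosB; ring.
rewrite -[LHS](integral12_prod_meas1 (m1 := leb) (m2 := leb)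
   (f := fun z => (featc (k, z) * featc (e, z) + feats (k, z) * feats (e, z))%:E)); last first.
  apply/integrableP; split; first exact/measurable_EFinP.
  apply: (@le_lt_trans _ _ (\int[mprod leb leb]_z (feat (k, z) * feat (e, z))%:E)%E); last first.
    by rewrite feat_gram// ltry.
  apply: ge0_le_integral => //.
  - by apply: measurableT_comp => //; exact/measurable_EFinP.
  - by apply/measurable_EFinP; apply: measurable_funM; apply: pair1m; exact: measurable_feat.
  - move=> z _; rewrite lee_fin csE normrM ger0_norm.
      have /andP[h1 _] := feat01 (k, z); have /andP[h2 _] := feat01 (e, z).
      by rewrite ler_piMr ?cos_max// mulr_ge0.
    have /andP[h1 _] := feat01 (k, z); have /andP[h2 _] := feat01 (e, z).
    by rewrite mulr_ge0.
apply: eq_integral => s _; rewrite -feat_inner /fubini_F; apply: eq_integral => xi _.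
by rewrite csE.
Qed.

End laplace_features.

(** * Injectivity of the feature transform *)

Section transform_injective.
Context {R : realType}.
Notation leb := (@lebesgue_measure R).

Lemma ae_itvoo (P : R -> Prop) (a b : R) : a < b -> {ae leb, forall x, P x} ->
  exists2 x, a < x < b & P x.
Proof.
move=> ab [N [mN N0 hN]]; apply: contrapT => /forall2NP h.
have sub : `]a, b[%classic `<=` N.
  move=> x /= xab; apply: hN => /= Px; move: xab; rewrite in_itv/= => xab.
  by have [] := h x.
have mab : measurable (`]a, b[%classic : set R) by [].
have : (leb `]a, b[%classic <= leb N)%E by rewrite le_measure ?inE.
by rewrite N0 lebesgue_measure_itv/= lte_fin ab -EFinB lee_fin leNgt subr_gt0 ab.
Qed.

(** The primitive of [h] equals the total integral at almost every [s > 0]. At a differentiability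
    point with [h s != 0] its difference quotients would be nonzero on a punctured neighbourhood,
    which contains further points with that same value. *)
Lemma tail_integral_eq0 (h : R -> R) : leb.-integrable setT (EFin \o h) ->
  {ae leb, forall s, 0 < s -> \int[leb]_(x in `]s, +oo[) h x = 0} ->
  {ae leb, forall s, 0 < s -> h s = 0}.
Proof.
move=> hi h0.
have ig (D : set R) : measurable D -> leb.-integrable D (EFin \o h).
  by move=> mD; apply: integrableS hi.
have locg : locally_integrable setT h.
  by apply: open_integrable_locally => //; exact: openT.
have := @FTC1Ny R h (fun y => ig _ (measurable_itv _)) locg.
set G := fun x : R => _; move=> dG.
pose C := \int[leb]_x h x.
have GC : {ae leb, forall s, 0 < s -> G s = C}.
  move: h0; apply: ae_lebesgueS => s /[apply] h0.
  have TE : setT = `]-oo, s] `|` `]s, +oo[ :> set R.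
    by apply/seteqP; split => x //= _; rewrite !in_itv/= andbT; have [] := leP x s; [left|right].
  rewrite /C TE Rintegral_setU ?h0 ?addr0//; first by apply: ig; exact: measurableU.
  by apply/disj_setPS => x /= []; rewrite !in_itv/= andbT => xs sx; move: (le_lt_trans xs sx); rewrite ltxx.
have : {ae leb, forall s, (derivable G s 1 /\ derive1 G s = h s) /\ (0 < s -> G s = C)}.
  by apply: filterI => //; exact: (ae_filter_ringOfSetsType leb).
apply: ae_lebesgueS => s [[dGs Gs] GsC] s0; apply/eqP/negPn/negP => hs.
have Gs' : lim ((fun u : R => u^-1 *: (G (u *: 1 + s) - G s)) @ 0^') != 0.
  by move: hs; rewrite -Gs derive1E.
have := @cvgr_neq0 _ _ _ _ (dnbhs_filter (0 : R)) _ _ dGs Gs'.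
rewrite near_withinE => /nbhs_ballP[e/= e0 he].
have se : s < s + e by rewrite ltrDl.
have [u /andP[su ue] Gu] := ae_itvoo se GC.
have bu : ball (0 : R) e (u - s).
  by rewrite /ball/= sub0r normrN gtr0_norm ?subr_gt0// ltrBlDl.
have us : u - s != 0 by rewrite subr_eq0 gt_eqF.
by move: (he _ bu us); rewrite /= scaler1 subrK GsC// Gu ?(lt_trans s0 su)// subrr scaler0 eqxx.
Qed.

Variable aR : R -> R.
Hypothesis maR : measurable_fun setT aR.

Let pair1m {d3 d4} (A : measurableType d3) (B : measurableType d4) (f : A * B -> R) y :
  measurable_fun setT f -> measurable_fun setT (fun x => f (x, y)).
Proof. by move=> mf; apply: measurableT_comp => //; exact: pair2_measurable. Qed.

(** For fixed [xi] the factor [expR (xi * s)] pulls out of the transform, leaving the tail integral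
    of a function independent of [s]. *)
Lemma laplace_tail (g r : R -> R) (xi : R) : 0 < xi -> (forall k, `|g k| <= 1) ->
  measurable_fun setT g -> leb.-integrable setT (EFin \o r) ->
  {ae leb, forall s, \int[leb]_k (feat (k, (s, xi)) * g k * r k) = 0} ->
  {ae leb, forall s, 0 < s -> g s * r s = 0}.
Proof.
move=> xi0 g1 mg ri h0.
have mr : measurable_fun setT r by apply/measurable_EFinP; exact: measurable_int ri.
pose h (k : R) : R := if 0 < k then expR (- (xi * k)) * g k * r k else 0.
have mh : measurable_fun setT h.
  apply: measurable_fun_ifT => //; first exact: measurable_fun_ltr.
  apply: measurable_funM => //; apply: measurable_funM => //.
  apply: measurableT_comp; first exact: measurable_expR.
  by apply: measurable_funN; exact: measurable_funM.
have hi : leb.-integrable setT (EFin \o h).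
  apply: (le_integrable measurableT _ _ ri); first exact/measurable_EFinP.
  move=> k _; rewrite lee_fin /h; case: ifPn => k0; last by rewrite normr0.
  rewrite normrM ler_piMl// normrM mulr_ile1//.
  by rewrite ger0_norm ?expR_ge0// -[leRHS]expR0 ler_expR oppr_le0 mulr_ge0// ltW.
have h0' : {ae leb, forall s, 0 < s -> \int[leb]_(x in `]s, +oo[) h x = 0}.
  move: h0; apply: ae_lebesgueS => s hs s0.
  have : \int[leb]_k (feat (k, (s, xi)) * g k * r k) =
      expR (xi * s) * \int[leb]_(k in `]s, +oo[) h k.
    rewrite -RintegralZl//; last exact: integrableS hi.
    rewrite [RHS]Rintegral_mkcond; apply: eq_Rintegral => k _.
    rewrite patchE mem_setE in_itv/= andbT /feat/= s0 xi0 andbT/= /h.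
    case: ifPn => sk; last by rewrite !mul0r.
    rewrite (lt_trans s0 sk) !mulrA -expRD; congr (expR _ * _ * _); ring.
  by rewrite hs => /esym/eqP; rewrite mulf_eq0 gt_eqF ?expR_gt0//= => /eqP.
have := tail_integral_eq0 hi h0'; apply: ae_lebesgueS => s /[swap] s0 /(_ s0).
by rewrite /h s0 -mulrA => /eqP; rewrite mulf_eq0 gt_eqF ?expR_gt0//= => /eqP.
Qed.

(** A single [xi] suffices: [cos ^+ 2 + sin ^+ 2 = 1] eliminates the phase [xi * aR k], whatever the
    measurable function [aR] is. *)
Lemma feat_transform_inj (r : R -> R) : leb.-integrable setT (EFin \o r) ->
  (forall k, k <= 0 -> r k = 0) ->
  let P z := \int[leb]_k (featc aR (k, z) * r k) in
  let Q z := \int[leb]_k (feats aR (k, z) * r k) in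
  (mprod leb leb).-integrable setT (EFin \o (fun z => P z * P z + Q z * Q z)) ->
  \int[mprod leb leb]_z (P z * P z + Q z * Q z) = 0 ->
  {ae leb, forall k, r k = 0}.
Proof.
move=> ri r0 P Q Gi G0.
pose G z : \bar R := (P z * P z + Q z * Q z)%:E.
have Gge z : (0 <= G z)%E by rewrite lee_fin addr_ge0// -expr2 sqr_ge0.
have mG : measurable_fun setT G := measurable_int _ Gi.
have : (\int[mprod leb leb]_z G z = 0)%E.
  have := integrable_fin_num measurableT Gi => /fineK <-.
  by move: G0; rewrite /Rintegral => ->.
rewrite /mprod (fubini_tonelli2 (m1 := leb) (m2 := leb) G mG Gge) => Gxi.
have mGG : measurable_fun setT (fubini_G leb G) by exact: (measurable_fun_fubini_tonelli_G (m1 := leb) G mG Gge).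
have := (ae_eq_integral_abs leb measurableT mGG).1.
under eq_integral do rewrite gee0_abs ?integral_ge0//.
move=> /(_ Gxi) aexi.
have [xi /andP[xi0 _] /(_ I) Gx] := ae_itvoo (@ltr01 R) aexi.
have mGx : measurable_fun setT (fun s => G (s, xi)).
  by apply: measurableT_comp mG _; exact: pair2_measurable.
have := (ae_eq_integral_abs leb measurableT mGx).1.
under eq_integral do rewrite gee0_abs//.
move=> /(_ Gx) aes.
have PQ0 (s : R) : G (s, xi) = 0%E -> P (s, xi) = 0 /\ Q (s, xi) = 0.
  move=> [] /eqP; rewrite -!expr2 paddr_eq0 ?sqr_ge0// !sqrf_eq0 => /andP[/eqP ? /eqP ?].
  by split.
have mph : measurable_fun setT (fun k => xi * aR k) by exact: measurable_funM.
have cr := @laplace_tail (fun k => cos (xi * aR k)) r xi xi0 (fun k => cos_max _) _ ri.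
have sr := @laplace_tail (fun k => sin (xi * aR k)) r xi xi0 (fun k => sin_max _) _ ri.
have {}cr : {ae leb, forall s, 0 < s -> cos (xi * aR s) * r s = 0}.
  apply: cr; first by apply: measurableT_comp => //; exact: continuous_measurable_fun (@continuous_cos R).
  by move: aes; apply: ae_lebesgueS => s /(_ I)/PQ0[].
have {}sr : {ae leb, forall s, 0 < s -> sin (xi * aR s) * r s = 0}.
  apply: sr; first by apply: measurableT_comp => //; exact: continuous_measurable_fun (@continuous_sin R).
  by move: aes; apply: ae_lebesgueS => s /(_ I)/PQ0[].
have : {ae leb, forall s, (0 < s -> cos (xi * aR s) * r s = 0) /\ (0 < s -> sin (xi * aR s) * r s = 0)}.
  by apply: filterI => //; exact: (ae_filter_ringOfSetsType leb).
apply: ae_lebesgueS => s [c0 s0]; have [sp|] := ltP 0 s; last exact: r0.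
have := cos2Dsin2 (xi * aR s).
have -> : r s = (cos (xi * aR s) ^+ 2 + sin (xi * aR s) ^+ 2) * r s by rewrite cos2Dsin2 mul1r.
move=> _; rewrite mulrDl !expr2 -!mulrA c0// s0// !mulr0 addr0//.
Qed.

End transform_injective.

Lemma half_kernel0 {R : realType} (k e : R) : 0 < k -> 0 < e ->
  half_kernel k e 0 = 1 / 2 * ln ((k + e) / `|k - e|).
Proof.
move=> k0 e0; rewrite /half_kernel expr0n/= !addr0 !sqrtr_sqr.
by rewrite [`|k + e|]gtr0_norm// addr_gt0.
Qed.

(** Adding [A ^+ 2] to numerator and denominator moves a ratio above 1 towards 1. On the diagonal
    the kernel with [A = 0] has the default value 0, hence the hypothesis for [k = e]. *)
Lemma half_kernel_le {R : realType} (k e A : R) : 0 < k -> 0 < e -> (k = e -> A = 0) ->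
  0 <= half_kernel k e A <= half_kernel k e 0.
Proof.
move=> k0 e0 kA; have [ke|ke] := eqVneq k e.
  by rewrite (kA ke) lexx andbT ke half_kernel0// subrr normr0 invr0 mulr0 ln0// mulr0.
have a0 : 0 < (k - e) ^+ 2 by rewrite exprn_even_gt0//= subr_eq0.
have ab : (k - e) ^+ 2 < (k + e) ^+ 2.
  rewrite -subr_gt0; have -> : (k + e) ^+ 2 - (k - e) ^+ 2 = 4 * (k * e) by ring.
  by rewrite !mulr_gt0.
have c0 : 0 <= A ^+ 2 by exact: sqr_ge0.
have HE (B : R) : half_kernel k e B = 1 / 2 * ln (Num.sqrt (((k + e) ^+ 2 + B ^+ 2) / ((k - e) ^+ 2 + B ^+ 2))).
  by rewrite /half_kernel sqrtrM ?sqrtrV// addr_ge0// sqr_ge0.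
rewrite !HE expr0n/= !addr0.
move: ((k - e) ^+ 2) ((k + e) ^+ 2) (A ^+ 2) a0 ab c0 => a b c a0 ab c0.
have b0 : 0 < b := lt_trans a0 ab.
have ac0 : 0 < a + c by rewrite ltr_wpDr.
have bc0 : 0 < b + c by rewrite ltr_wpDr.
have q1 : 1 <= (b + c) / (a + c) by rewrite ler_pdivlMr// mul1r lerD2r ltW.
have q2 : (b + c) / (a + c) <= b / a.
  rewrite ler_pdivrMr// mulrAC ler_pdivlMr// mulrDl mulrDr lerD2l (mulrC c) ler_wpM2r//.
  exact: ltW.
apply/andP; split.
  by rewrite mulr_ge0// ln_ge0// -[leLHS]sqrtr1 ler_wsqrtr.
have h2 : 0 < 1 / 2 :> R by lra.
rewrite (ler_pM2l h2) ler_ln ?posrE ?sqrtr_gt0 ?divr_gt0//.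
by rewrite ler_wsqrtr.
Qed.

Section soliton_kernel.
Context {R : realType}.
Notation leb := (@lebesgue_measure R).
Variable d : R.

Definition zetaR (k : R) : R := k * cot (2 * d * k).

Lemma measurable_zetaR : measurable_fun setT zetaR.
Proof.
apply: measurable_funM => //; apply: measurable_funM.
  apply: measurableT_comp; first exact: continuous_measurable_fun (@continuous_cos R).
  exact: measurable_funM.
apply: measurable_funV; apply: measurableT_comp; first exact: continuous_measurable_fun (@continuous_sin R).
exact: measurable_funM.
Qed.

Definition soliton_kern (z : R * R) : R :=
  if (0 < z.1) && (0 < z.2) then half_kernel z.1 z.2 (zetaR z.1 - zetaR z.2) else 0.
Definition soliton_kern0 (z : R * R) : R :=
  if (0 < z.1) && (0 < z.2) then half_kernel z.1 z.2 0 else 0.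

Lemma kern_le z : 0 <= soliton_kern z <= soliton_kern0 z.
Proof.
rewrite /soliton_kern /soliton_kern0; case: ifPn => [/andP[h1 h2]|_]; last by rewrite !lexx.
by apply: half_kernel_le => // ->; rewrite subrr.
Qed.

Lemma kern_ge0 z : 0 <= soliton_kern z. Proof. by have /andP[] := kern_le z. Qed.
Lemma kern0_ge0 z : 0 <= soliton_kern0 z.
Proof.
rewrite /soliton_kern0; case: ifPn => // /andP[h1 h2].
by have /andP[] := @half_kernel_le _ _ _ 0 h1 h2 (fun _ => erefl).
Qed.

Let measurable_kern_gen (A : R * R -> R) : measurable_fun setT A ->
  measurable_fun setT (fun z : R * R =>
    if (0 < z.1) && (0 < z.2) then half_kernel z.1 z.2 (A z) else 0).
Proof.
move=> mA.
have m1 : measurable_fun setT (fun z : R * R => z.1) by exact: measurable_fst.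
have m2 : measurable_fun setT (fun z : R * R => z.2) by exact: measurable_snd.
apply: measurable_fun_ifT => //.
  by apply: measurable_and; exact: measurable_fun_ltr.
apply: measurable_funM => //; apply: measurableT_comp; first exact: measurable_ln.
have ms : measurable_fun setT (@Num.sqrt R) := continuous_measurable_fun (@sqrt_continuous R).
apply: measurable_funM; last apply: measurable_funV; apply: measurableT_comp => //;
  apply: measurable_funD; apply: measurable_funX => //.
  exact: measurable_funD.
exact: measurable_funB.
Qed.

Lemma measurable_kern : measurable_fun setT soliton_kern.
Proof.
apply: measurable_kern_gen; have mz := measurable_zetaR; apply: measurable_funB.
  by apply: measurableT_comp => //; exact: measurable_fst.
by apply: measurableT_comp => //; exact: measurable_snd.
Qed.

Lemma measurable_kern0 : measurable_fun setT soliton_kern0.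
Proof. exact: (@measurable_kern_gen (cst 0)). Qed.

Lemma zeta_kernel k e : 0 < k -> 0 < e ->
  ln (cabs (zeta d k - cconj (zeta d e)) / cabs (zeta d k - zeta d e)) = 2 * soliton_kern (k, e).
Proof.
move=> k0 e0; rewrite /soliton_kern /= k0 e0 /half_kernel /zeta !gt_eqF// /cabs /cconj /=.
have h2 (y : R) : 2 * (1 / 2 * y) = y by field.
rewrite h2 /zetaR.
by rewrite opprK; congr (ln (Num.sqrt _ / Num.sqrt _)); rewrite addrC.
Qed.

End soliton_kernel.

(** * The constrained variational problem *)

Section weyl_operator.
Context {R : realType}.
Notation leb := (@lebesgue_measure R).
Variables (d : R) (u0 : R -> R) (xmax : R).
Hypotheses (d0 : 0 < d) (adm : admissible u0 xmax).
Let umax := u0 xmax.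
Let km := kappa_max d umax.
Let g := weyl_g d u0 xmax.
Let g_ge0 y : 0 <= g y := weyl_g_ge0 u0 xmax d0 y.
Let mg : measurable_fun setT g := measurable_weyl_g d0 adm.
Let kern := soliton_kern d.
Let kern0 := @soliton_kern0 R.

Let cl := log_cst d u0 xmax / 2.

Lemma log_cst_ge0 : 0 <= log_cst d u0 xmax.
Proof.
have h1 : 0 <= dens_cst d umax := dens_cst_ge0 d0 (umax_gt0 adm).
have h2 : 0 <= width_cst d u0.
  have h := @Rintegral_ge0 _ _ _ leb setT (fun x => Num.sqrt (u0 x)) (fun x _ => sqrtr_ge0 _).
  by rewrite /width_cst mulr_ge0 ?sqrtr_ge0.
by apply: mulr_ge0 => //; apply: mulr_ge0.
Qed.

Let pair1m (f : R * R -> R) x :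
  measurable_fun setT f -> measurable_fun setT (fun y => f (x, y)).
Proof. by move=> mf; apply: measurableT_comp => //; exact: pair1_measurable. Qed.

(** The bound is [weyl_g_log], uniform in [k]; the factor 1/2 of [half_kernel] turns [log_cst] into
    [cl]. *)
Lemma kern0_bound (s : R -> R) c k : measurable_fun setT s -> 0 <= c ->
  (forall y, `|s y| <= c * g y) ->
  (\int[leb]_y (kern0 (k, y) * `|s y|)%:E <= (c * cl)%:E)%E.
Proof.
move=> ms c0 sc.
have cl0 : 0 <= cl by rewrite divr_ge0// log_cst_ge0.
have [k0|k0] := ltP 0 k; last first.
  have -> : (\int[leb]_y (kern0 (k, y) * `|s y|)%:E = 0)%E.
    by apply: integral0_eq => y _; rewrite /kern0 /soliton_kern0/= ltNge k0 mul0r.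
  by rewrite lee_fin mulr_ge0.
have l0 (y : R) : 0 <= ln ((k + y) / `|k - y|) * g y.
  have [y0|y0] := ltP 0 y; last first.
    by rewrite /g weyl_g_out ?mulr0// in_itv/= ltNge y0.
  rewrite mulr_ge0//; have [->|ky] := eqVneq k y.
    by rewrite subrr normr0 invr0 mulr0 ln0.
  rewrite ln_ge0// ler_pdivlMr ?normr_gt0 ?subr_eq0// mul1r ler_norml.
  by apply/andP; split; lra.
apply: (@le_trans _ _ (\int[leb]_y ((c / 2)%:E * (ln ((k + y) / `|k - y|) * g y)%:E))%E).
  apply: ge0_le_integral => //.
  - by move=> y _; rewrite lee_fin mulr_ge0// kern0_ge0.
  - apply/measurable_EFinP; apply: measurable_funM; last exact: measurableT_comp.
    by apply: pair1m; exact: measurable_kern0.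
  - apply: emeasurable_funM => //; apply/measurable_EFinP.
    by apply: measurable_funM => //; exact: measurable_log_kernel.
  - move=> y _; rewrite -EFinM lee_fin /kern0 /soliton_kern0/= k0/=.
    case: ifPn => y0; last by rewrite mul0r mulr_ge0// divr_ge0.
    rewrite half_kernel0//.
    have -> : c / 2 * (ln ((k + y) / `|k - y|) * g y) =
      1 / 2 * ln ((k + y) / `|k - y|) * (c * g y) by field.
    by rewrite ler_wpM2l// -half_kernel0//; have := kern0_ge0 (k, y); rewrite /soliton_kern0/= k0 y0.
rewrite ge0_integralZl//.
- have -> : c * cl = c / 2 * log_cst d u0 xmax by rewrite /cl; field.
  by rewrite [leRHS]EFinM lee_wpmul2l ?lee_fin ?divr_ge0// (weyl_g_log d0 adm (ltW k0)).
- apply/measurable_EFinP; apply: measurable_funM => //; exact: measurable_log_kernel.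
- by move=> y _; rewrite lee_fin l0.
- by rewrite lee_fin divr_ge0.
Qed.

Lemma kern_norm_bound (s : R -> R) c k : measurable_fun setT s -> 0 <= c ->
  (forall y, `|s y| <= c * g y) ->
  (\int[leb]_y `|(kern (k, y) * s y)%:E| <= (c * cl)%:E)%E.
Proof.
move=> ms c0 sc; apply: le_trans (kern0_bound k ms c0 sc).
apply: ge0_le_integral => //.
- apply/measurable_EFinP; apply: measurableT_comp => //; apply: measurable_funM => //.
  by apply: pair1m; exact: measurable_kern.
- apply/measurable_EFinP; apply: measurable_funM; last exact: measurableT_comp.
  by apply: pair1m; exact: measurable_kern0.
- move=> y _; rewrite lee_fin normrM ger0_norm ?kern_ge0// ler_wpM2r//.
  by have /andP[] := kern_le d (k, y).
Qed.

Lemma kern_int (s : R -> R) k : dominated g s ->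
  leb.-integrable setT (EFin \o (fun y => kern (k, y) * s y)).
Proof.
move=> [ms [c c0 sc]]; apply/integrableP; split.
  apply/measurable_EFinP; apply: measurable_funM => //.
  by apply: pair1m; exact: measurable_kern.
by rewrite (le_lt_trans (kern_norm_bound k ms c0 sc))// ltry.
Qed.

(** [2 / pi] combines the prefactor [1 / pi] of [Lop] with the factor 2 of [zeta_kernel]. *)
Definition weyl_op (s : R -> R) (k : R) : R :=
  if 0 < k < km then 2 / pi * \int[leb]_y (kern (k, y) * s y) else 0.

Let c2pi : 0 <= 2 / pi :> R. Proof. by rewrite divr_ge0// pi_ge0. Qed.

Lemma measurable_kern_integral s : measurable_fun setT s ->
  measurable_fun setT (fun k => \int[leb]_y (kern (k, y) * s y)).
Proof.
move=> ms.
pose F (z : R * R) : \bar R := (kern z * s z.2)%:E.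
have mF : measurable_fun setT F.
  apply/measurable_EFinP; apply: measurable_funM; first exact: measurable_kern.
  by apply: measurableT_comp => //; exact: measurable_snd.
have mI : measurable_fun setT (fun k => \int[leb]_y F (k, y))%E.
  have -> : (fun k => \int[leb]_y F (k, y))%E =
      (fun k => (\int[leb]_y F^\+ (k, y)) - (\int[leb]_y F^\- (k, y)))%E.
    apply/funext => k; rewrite [LHS]integralE; congr (_ - _)%E.
      by apply: eq_integral => y _; rewrite !funeposE.
    by apply: eq_integral => y _; rewrite !funenegE.
  apply: emeasurable_funB.
    exact: (measurable_fun_fubini_tonelli_F (m2 := leb) F^\+%E (measurable_funepos mF) (funepos_ge0 _)).
  exact: (measurable_fun_fubini_tonelli_F (m2 := leb) F^\-%E (measurable_funeneg mF) (funeneg_ge0 _)).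
by apply: measurableT_comp mI; exact: fine_measurable.
Qed.

Lemma measurable_weyl_op s : measurable_fun setT s -> measurable_fun setT (weyl_op s).
Proof.
move=> ms; apply: measurable_fun_ifT => //.
  by apply: measurable_and; exact: measurable_fun_ltr.
by apply: measurable_funM => //; exact: measurable_kern_integral.
Qed.

Lemma kern_integral_bound (s : R -> R) c k : measurable_fun setT s -> 0 <= c ->
  (forall y, `|s y| <= c * g y) -> `|\int[leb]_y (kern (k, y) * s y)| <= c * cl.
Proof.
move=> ms c0 sc.
have ki := @kern_int s k (conj ms (ex_intro2 _ _ c c0 sc)).
rewrite (le_trans (le_normr_Rintegral measurableT ki))//.
have := kern_norm_bound k ms c0 sc; rewrite -lee_fin /Rintegral fineK//.
exact: (integrable_fin_num measurableT (integrable_abse ki)).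
Qed.

Lemma weyl_op_bound (s : R -> R) c : measurable_fun setT s -> 0 <= c ->
  (forall y, `|s y| <= c * g y) ->
  forall k, `|weyl_op s k| <= c * (2 / pi * cl).
Proof.
move=> ms c0 sc k; have cl0 : 0 <= cl by rewrite divr_ge0// log_cst_ge0.
rewrite /weyl_op; case: ifP => _; last by rewrite normr0 mulr_ge0// mulr_ge0.
rewrite normrM (ger0_norm c2pi) mulrCA ler_wpM2l//.
exact: kern_integral_bound.
Qed.

Lemma weyl_op_lin a r s : dominated g r -> dominated g s -> forall k,
  weyl_op (fun y => a * r y + s y) k = a * weyl_op r k + weyl_op s k.
Proof.
move=> dr ds k; rewrite /weyl_op; case: ifP => _; last by rewrite mulr0 addr0.
have ir := kern_int k dr; have is_ := kern_int k ds.
have -> : \int[leb]_y (kern (k, y) * (a * r y + s y)) =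
    a * (\int[leb]_y (kern (k, y) * r y)) + \int[leb]_y (kern (k, y) * s y).
  rewrite -RintegralZl// -RintegralD//; last exact: integrableMl_EFin.
  by apply: eq_Rintegral => y _; ring.
by ring.
Qed.

Lemma weyl_op_cvg (r_ : nat -> R -> R) r : (forall n, between g (r_ n)) ->
  between g r -> {ae leb, forall x, r_ n x @[n --> \oo] --> r x} ->
  forall k, weyl_op (r_ n) k @[n --> \oo] --> weyl_op r k.
Proof.
move=> br [mr rg] rc k; rewrite /weyl_op; case: ifP => _; last exact: cvg_cst.
apply: cvgM; first exact: cvg_cst.
have dg : dominated g g.
  by split => //; exists 1 => // y; rewrite mul1r ger0_norm.
have gi : leb.-integrable setT (EFin \o (fun y => kern (k, y) * g y)) := kern_int k dg.
have mk : measurable_fun setT (fun y => kern (k, y)) by apply: pair1m; exact: measurable_kern.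
pose f_ n : R -> \bar R := EFin \o (fun y => kern (k, y) * r_ n y).
pose f : R -> \bar R := EFin \o (fun y => kern (k, y) * r y).
have [] := @dominated_convergence _ _ _ leb setT measurableT f_ f _ _ _ _ gi.
- by move=> n; apply/measurable_EFinP; apply: measurable_funM => //; have [] := br n.
- by apply/measurable_EFinP; exact: measurable_funM.
- move: rc; apply: ae_lebesgueS => y hy _; apply/fine_cvgP; split; first by near=> n.
  by apply: cvgM; [exact: cvg_cst|exact: hy].
- apply: aeW => y n _; rewrite lee_fin normrM ger0_norm ?kern_ge0// ler_wpM2l ?kern_ge0//.
  by have [_ /(_ y)/andP[h1 h2]] := br n; rewrite ger0_norm.
move=> fi _ fc; apply: fine_cvg; rewrite fineK//.
exact: (integrable_fin_num measurableT fi).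
Unshelve. all: by end_near. Qed.

Let D : set R := [set k | 0 < k].
Let w (z : R * R) : R := if z.1 == z.2 then 0 else 1.

Let dominated_D s : dominated g s -> forall x, s x != 0 -> D x.
Proof.
move=> [_ [c c0 sc]] x sx; rewrite /D/= ltNge; apply/negP => x0; move/eqP: sx; apply.
apply/eqP; rewrite -normr_le0 (le_trans (sc x))// /g weyl_g_out ?mulr0//.
by rewrite in_itv/= ltNge x0.
Qed.

Let dominated_int s : dominated g s -> leb.-integrable setT (EFin \o s).
Proof.
move=> [ms [c c0 sc]].
have gi : leb.-integrable setT (EFin \o (fun y => c * g y)).
  by apply: integrableMl_EFin; exact: (weyl_g_int d0 adm).
apply: (le_integrable measurableT _ _ gi); first exact/measurable_EFinP.
by move=> x _; rewrite lee_fin [leRHS]ger0_norm// mulr_ge0.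
Qed.

Let kern0_int r s : dominated g r -> dominated g s ->
  (\int[leb]_x \int[leb]_y (kern0 (x, y) * (`|r x| * `|s y|))%:E < +oo)%E.
Proof.
move=> dr [ms [c c0 sc]]; have ri := dominated_int dr; have mr := dr.1.
have /integrableP[_ ra] := ri.
apply: (@le_lt_trans _ _ (\int[leb]_x ((c * cl)%:E * `|(EFin \o r) x|))%E); last first.
  have cl0 : 0 <= cl by rewrite divr_ge0// log_cst_ge0.
  rewrite ge0_integralZl//.
  - by rewrite lte_mul_pinfty// lee_fin mulr_ge0.
  - by apply: measurableT_comp => //; exact/measurable_EFinP.
  - by rewrite lee_fin mulr_ge0.
apply: ge0_le_integral => //.
- move=> x _; apply: integral_ge0 => y _; rewrite lee_fin mulr_ge0 ?kern0_ge0// mulr_ge0//.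
- apply: (measurable_fun_fubini_tonelli_F (m2 := leb) (fun z => (kern0 z * (`|r z.1| * `|s z.2|))%:E)).
  + apply/measurable_EFinP; apply: measurable_funM; first exact: measurable_kern0.
    apply: measurable_funM.
      by apply: measurableT_comp => //; apply: measurableT_comp => //; exact: measurable_fst.
    by apply: measurableT_comp => //; apply: measurableT_comp => //; exact: measurable_snd.
  + by move=> z; rewrite lee_fin mulr_ge0 ?kern0_ge0// mulr_ge0.
- by apply: emeasurable_funM => //; apply: measurableT_comp => //; exact/measurable_EFinP.
- move=> x _.
  have -> : (\int[leb]_y (kern0 (x, y) * (`|r x| * `|s y|))%:E =
      \int[leb]_y (`|r x|%:E * (kern0 (x, y) * `|s y|)%:E))%E.
    by apply: eq_integral => y _; rewrite -EFinM; congr EFin; ring.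
  rewrite ge0_integralZl//.
  + by rewrite muleC lee_wpmul2r// kern0_bound.
  + apply/measurable_EFinP; apply: measurable_funM; last exact: measurableT_comp.
    by apply: pair1m; exact: measurable_kern0.
  + by move=> y _; rewrite lee_fin mulr_ge0// kern0_ge0.
Qed.

Let mz := measurable_zetaR d.
Let P s (z : R * R) := \int[leb]_x (featc (zetaR d) (x, z) * s x).
Let Q s (z : R * R) := \int[leb]_x (feats (zetaR d) (x, z) * s x).

Let mw : measurable_fun setT w.
Proof.
apply: measurable_fun_ifT => //; apply: measurable_fun_eqr.
  exact: measurable_fst.
exact: measurable_snd.
Qed.

Let w01 z : w z = 0 \/ w z = 1.
Proof. by rewrite /w; case: ifP => _; [left|right]. Qed.

Let w_ae x : {ae leb, forall y, w (x, y) = 1}.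
Proof.
exists [set x]; split => //; first by rewrite lebesgue_measure_set1.
by move=> y /=; rewrite /w/=; case: eqVneq => [->|].
Qed.

Let w_off x y : w (x, y) = 1 -> x != y.
Proof. by rewrite /w/=; case: eqVneq => // _ /esym/eqP; rewrite oner_eq0. Qed.

Let kern_gram x y : D x -> D y -> w (x, y) = 1 ->
  (\int[mprod leb leb]_z (featc (zetaR d) (x, z) * featc (zetaR d) (y, z) +
     feats (zetaR d) (x, z) * feats (zetaR d) (y, z))%:E = (kern (x, y))%:E)%E.
Proof.
move=> x0 y0 /w_off xy; rewrite (featcs_gram mz)// /kern /soliton_kern/=.
by rewrite (x0 : 0 < x) (y0 : 0 < y).
Qed.

Let kern0_gram x y : D x -> D y -> w (x, y) = 1 ->
  (\int[mprod leb leb]_z (feat (x, z) * feat (y, z))%:E <= (kern0 (x, y))%:E)%E.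
Proof.
move=> x0 y0 /w_off xy; rewrite feat_gram// /kern0 /soliton_kern0/=.
by rewrite (x0 : 0 < x) (y0 : 0 < y).
Qed.

Let kern_w0 z : w z = 0 -> kern z = 0.
Proof.
case: z => x y; rewrite /w/=; case: eqVneq => [->|_ /eqP]; last by rewrite oner_eq0.
move=> _; rewrite /kern /soliton_kern/= andbb; case: ifP => // y0.
by rewrite !subrr half_kernel0// subrr normr0 invr0 mulr0 ln0// mulr0.
Qed.

Let dominated_weyl_op r s : dominated g s ->
  \int[leb]_k (weyl_op r k * s k) =
  \int[leb]_k (2 / pi * ((\int[leb]_y (kern (k, y) * r y)) * s k)).
Proof.
move=> [_ [c c0 sc]]; apply: eq_Rintegral => k _; rewrite /weyl_op.
case: ifPn => kk; first by rewrite mulrA.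
have -> : s k = 0; last by rewrite !mulr0.
apply/eqP; rewrite -normr_le0 (le_trans (sc k))// /g weyl_g_out ?mulr0//.
Qed.

Lemma weyl_op_form r s : dominated g r -> dominated g s ->
  \int[leb]_k (weyl_op r k * s k) =
  2 / pi * \int[mprod leb leb]_z (P s z * P r z + Q s z * Q r z).
Proof.
move=> dr ds; rewrite dominated_weyl_op//.
rewrite -(gram_form (m := leb) (n := mprod leb leb) (measurable_featc mz) (measurable_feats mz) measurable_feat
  measurable_kern0 mw (featc_le (zetaR d)) (feats_le (zetaR d)) feat01 w01 w_ae kern0_ge0
  kern_w0 kern_gram kern0_gram (dominated_int ds) (dominated_int dr) (dominated_D ds)
  (dominated_D dr) (kern0_int ds dr) (fun k _ => kern_int k dr)).
rewrite RintegralZl//; have [mr [c c0 rc]] := dr; have ms := ds.1.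
have si : leb.-integrable setT (EFin \o (fun k => c * cl * s k)).
  exact: integrableMl_EFin (dominated_int ds).
apply: (le_integrable measurableT _ _ si).
  by apply/measurable_EFinP; apply: measurable_funM => //; exact: measurable_kern_integral.
have cl0 : 0 <= cl by rewrite divr_ge0// log_cst_ge0.
have ccl0 : 0 <= c * cl by exact: mulr_ge0.
move=> k _; rewrite lee_fin normrM [leRHS]normrM [X in _ <= X * _](ger0_norm ccl0).
by rewrite ler_wpM2r//; exact: kern_integral_bound.
Qed.

Lemma weyl_op_sym r s : dominated g r -> dominated g s ->
  \int[leb]_k (weyl_op r k * s k) = \int[leb]_k (weyl_op s k * r k).
Proof.
move=> dr ds; rewrite !weyl_op_form//; congr (_ * _).
by apply: eq_Rintegral => z _; rewrite [P s z * _]mulrC [Q s z * _]mulrC.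
Qed.

Lemma weyl_op_pos r : dominated g r -> 0 <= \int[leb]_k (weyl_op r k * r k).
Proof.
move=> dr; rewrite weyl_op_form// mulr_ge0// Rintegral_ge0// => z _.
by rewrite addr_ge0// -expr2 sqr_ge0.
Qed.

Lemma weyl_op_def r : dominated g r -> \int[leb]_k (weyl_op r k * r k) = 0 ->
  {ae leb, forall k, r k = 0}.
Proof.
move=> dr; rewrite weyl_op_form// => /eqP; rewrite mulf_eq0 gt_eqF ?divr_gt0 ?pi_gt0//= => /eqP.
apply: (feat_transform_inj mz (dominated_int dr)).
  move=> k k0; apply/eqP/negPn/negP => /(dominated_D dr); rewrite /D/= ltNge k0//.
exact: (gram_integrable (m := leb) (n := mprod leb leb) (measurable_featc mz) (measurable_feats mz) measurable_feat
  measurable_kern0 mw (featc_le (zetaR d)) (feats_le (zetaR d)) feat01 w01 w_ae kern0_ge0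
  kern0_gram (dominated_int dr) (dominated_int dr) (dominated_D dr)
  (dominated_D dr) (kern0_int dr dr)).
Qed.

End weyl_operator.

(** * From the constraint set to a pointwise order interval *)

Section weyl_constraint.
Local Open Scope complex_scope.
Context {R : realType}.
Notation leb := (@lebesgue_measure R).
Variables (d : R) (u0 : R -> R) (xmax x t : R).
Hypotheses (d0 : 0 < d) (adm : admissible u0 xmax).
Let umax := u0 xmax.
Let km := kappa_max d umax.
Let g := weyl_g d u0 xmax.
Let L := weyl_op d u0 xmax.
Let g_ge0 y : 0 <= g y := weyl_g_ge0 u0 xmax d0 y.
Let mg : measurable_fun setT g := measurable_weyl_g d0 adm.
Let km0 : 0 < km := kappa_max_gt0 d0 (umax_gt0 adm).
Let I : set R := `]0, km[%classic.

Let mI : measurable I. Proof. exact: measurable_itv. Qed.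

Let IE k : I k = (0 < k < km) :> Prop.
Proof. by rewrite /I /= in_itv. Qed.

Definition field_V : R -> R := (Vfn d u0 xmax x t) \_ I.

Lemma Im_zeta_sq k : 0 < k ->
  complex.Im ((zeta d k - (1 / (2 * d))%:C) ^+ 2) = 2 * k * (zetaR d k - 1 / (2 * d)).
Proof. by move=> k0; rewrite /zeta gt_eqF// expr2 /= /zetaR; ring. Qed.

Lemma measurable_field_V : measurable_fun setT field_V.
Proof.
apply: (measurable_restrictT _ mI).1.
apply: measurable_funB; last exact: measurable_thetaplus.
apply: measurable_funD; first exact: measurable_funM.
apply: measurable_funM => //.
apply: (@eq_measurable_fun _ _ _ _ I (fun k => 2 * k * (zetaR d k - 1 / (2 * d)))).
  by move=> k; rewrite inE IE => /andP[k0 _]; rewrite Im_zeta_sq.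
apply: (measurable_funS (E := setT)) => //.
apply: measurable_funM; first exact: measurable_funM.
by apply: measurable_funB => //; exact: measurable_zetaR.
Qed.

(** The cotangent pole at 0 cancels: the difference is [- (1 - s cot s) / (2 d)] with
    [s = 2 * d * k], controlled by [one_sub_scot]. *)
Lemma zetaR_bound k : 0 < k <= km ->
  `|zetaR d k - 1 / (2 * d)| <= 1 / (2 * d) * (pi / (1 + cos (2 * d * km))).
Proof.
move=> kk; have s0 := kappa_pi d0 (umax_gt0 adm) kk.
have [/andP[m0 mpi] _] := kappa_max_pi d0 (umax_gt0 adm).
have /andP[k0 kkm] := kk; have dd : 0 < 2 * d by rewrite mulr_gt0.
have -> : zetaR d k - 1 / (2 * d) =
    - (1 / (2 * d) * (1 - (2 * d * k) * (cos (2 * d * k) / sin (2 * d * k)))).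
  have sn : sin (2 * d * k) != 0 by rewrite gt_eqF// sin_gt0_pi.
  by rewrite /zetaR /cot; field; rewrite sn gt_eqF.
have /andP[h1 h2] := one_sub_scot s0.
have i0 : 0 <= 1 / (2 * d) by rewrite divr_ge0// ltW.
rewrite normrN normrM (ger0_norm i0) (ger0_norm h1); apply: (ler_wpM2l i0).
apply: (le_trans h2); have /andP[s1 s2] := s0.
have c1 : 0 < 1 + cos (2 * d * km) by rewrite one_add_cos_gt0// ltW.
have c2 : 1 + cos (2 * d * km) <= 1 + cos (2 * d * k).
  rewrite lerD2l; have [->//|nk] := eqVneq k km.
  by rewrite ltW// ltr_cos ?in_itv/= ?ltW// ltr_pM2l// lt_neqAle nk.
by rewrite ler_pM ?invr_ge0 ?(ltW s1) ?(ltW s2)// ?lef_pV2 ?posrE// ?(lt_le_trans c1)// (le_trans (ltW c1)).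
Qed.

Definition field_bound :=
  `|x| * km + `|t| * (2 * km * (1 / (2 * d) * (pi / (1 + cos (2 * d * km))))) + theta_bound d u0 xmax.

Lemma field_V_bound k : `|field_V k| <= field_bound.
Proof.
have km_in : 0 < km <= km by rewrite km0 lexx.
have z0 := le_trans (normr_ge0 _) (zetaR_bound km_in).
have t0 := le_trans (normr_ge0 _) (thetaplus_bound d0 adm km_in).
have [kI|kI] := pselect (I k); last first.
  rewrite /field_V patchE memNset// normr0 /field_bound.
  have a1 : 0 <= `|x| * km by rewrite mulr_ge0// ltW.
  have a2 : 0 <= 2 * km by rewrite mulr_ge0// ltW.
  apply: addr_ge0 => //; apply: addr_ge0 => //; apply: mulr_ge0 => //.
  exact: mulr_ge0.
rewrite /field_V patchE mem_set//; move: kI; rewrite IE => /andP[k0 kk].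
have kin : 0 < k <= km by rewrite k0 ltW.
rewrite /Vfn Im_zeta_sq// (le_trans (ler_normB _ _))// lerD ?thetaplus_bound//.
rewrite (le_trans (ler_normD _ _))// lerD//.
  by rewrite normrM ler_wpM2l// gtr0_norm// ltW.
rewrite normrM ler_wpM2l// normrM ler_pM ?zetaR_bound//.
by rewrite normrM gtr0_norm// gtr0_norm// ler_wpM2l// ltW.
Qed.

(** Turns constraints valid almost everywhere on [[0, km]] into pointwise ones on the whole line.
    For members of the constraint set, [ae_clip] shows that the values on [[0, km]] change only on a
    null set. *)
Definition clip (rho : R -> R) : R -> R := (fun k => Num.max 0 (Num.min (rho k) (g k))) \_ I.

Lemma clip_between rho : inA d u0 xmax rho -> between g (clip rho).
Proof.
move=> [mr _]; split.
  apply: (measurable_restrictT _ mI).1.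
  apply: measurable_maxr => //; apply: measurable_minr; last exact: measurable_funS mg.
  by apply: measurable_funS mr => //; apply: subset_itvW.
move=> k; rewrite /clip patchE; case: ifP => _; last by rewrite lexx g_ge0.
by rewrite le_max lexx/= ge_max g_ge0/= ge_min lexx orbT.
Qed.

Lemma clip_id r : between g r -> clip r = r.
Proof.
move=> [_ rg]; apply/funext => k; have /andP[r0 r1] := rg k.
rewrite /clip patchE; case: ifPn => kI; first by rewrite min_l// max_r.
apply/esym/eqP; rewrite eq_le r0 andbT (le_trans r1)// /g weyl_g_out//.
by move: kI; rewrite mem_setE.
Qed.

Let ae_neq (a : R) : {ae leb, forall k, k != a}.
Proof.
exists [set a]; split => //; first by rewrite lebesgue_measure_set1.
by move=> k /= /negP/negPn/eqP.
Qed.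

Lemma ae_interior : {ae leb, forall k, 0 <= k <= km -> I k}.
Proof.
have := ae_lebesgueI (ae_neq 0) (ae_neq km); apply: ae_lebesgueS => k [k0 kk].
by rewrite IE !lt_neqAle [0 == k]eq_sym k0 kk.
Qed.

Lemma ae_clip rho : inA d u0 xmax rho ->
  {ae leb, forall k, 0 <= k <= km -> [/\ I k, rho k = clip rho k & rhoWyl d u0 xmax k = g k]}.
Proof.
move=> [_ hr]; have h := ae_lebesgueI hr (ae_lebesgueI ae_interior (rhoWyl_weyl_g d0 adm)).
move: h; apply: ae_lebesgueS => k [h1 [h2 h3]] kk; have kI := h2 kk.
have gk : rhoWyl d u0 xmax k = g k by move: kI; rewrite IE => /h3.
split => //; rewrite /clip patchE mem_set//.
by have := h1 kk; rewrite gk => /andP[r0 r1]; rewrite min_l// max_r.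
Qed.

Lemma between_inA r : between g r -> inA d u0 xmax r.
Proof.
move=> [mr rg]; split; first exact: measurable_funS mr.
have h := ae_lebesgueI ae_interior (rhoWyl_weyl_g d0 adm).
by move: h; apply: ae_lebesgueS => k [h1 h2] /h1; rewrite IE => /h2 ->.
Qed.

Lemma Rintegral_patch (f h : R -> R) : measurable_fun I f -> measurable_fun setT h ->
  {ae leb, forall k, I k -> f k = h k} -> (forall k, ~ I k -> h k = 0) ->
  \int[leb]_(k in `[0, km]) f k = \int[leb]_k h k.
Proof.
move=> mf mh fh h0; rewrite /Rintegral; congr fine.
have mfE : measurable_fun I (EFin \o f) by exact/measurable_EFinP.
rewrite -integral_itv_obnd_cbnd; last first.
  rewrite -(@setUitv1 _ _ (BRight 0) km true) ?bnd_simp//.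
  by apply/measurable_funU => //; split => //; exact: measurable_fun_set1.
rewrite -integral_itv_bndo_bndc//.
transitivity (\int[leb]_(k in I) (h k)%:E)%E.
  apply: ae_eq_integral => //.
    by apply/measurable_EFinP; exact: measurable_funS mh.
  by move: fh; apply: ae_lebesgueS => k /[apply] ->.
rewrite [LHS]integral_mkcond; apply: eq_integral => k _; rewrite patchE.
by case: ifPn => // /negP kI; rewrite h0// => kI'; apply: kI; rewrite inE.
Qed.

Lemma measurable_clip rho : inA d u0 xmax rho -> measurable_fun setT (clip rho).
Proof. by move=> /clip_between[]. Qed.

Lemma clip_out rho k : ~ I k -> clip rho k = 0.
Proof. by move=> kI; rewrite /clip patchE memNset. Qed.

Lemma inA_measurable rho : inA d u0 xmax rho -> measurable_fun I rho.
Proof. by move=> [mr _]; apply: measurable_funS mr => //; apply: subset_itvW. Qed.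

Lemma clip_interior rho : inA d u0 xmax rho -> {ae leb, forall k, I k -> rho k = clip rho k}.
Proof.
move=> /ae_clip; apply: ae_lebesgueS => k h; rewrite IE => /andP[k0 kk].
by have [] := h; rewrite ?(ltW k0) ?(ltW kk).
Qed.

Lemma Lop_clip rho k : inA d u0 xmax rho -> I k -> Lop d u0 xmax rho (zeta d k) = L (clip rho) k.
Proof.
move=> hr kI; have k0 : 0 < k by move: kI; rewrite IE => /andP[].
have mk : measurable_fun setT (fun y => soliton_kern d (k, y)).
  by apply: measurableT_comp; [exact: measurable_kern|exact: pair1_measurable].
rewrite /Lop (@Rintegral_patch _ (fun y => 2 * (soliton_kern d (k, y) * clip rho y))).
- rewrite /L /weyl_op; have -> : 0 < k < kappa_max d (u0 xmax) by move: kI; rewrite IE.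
  rewrite RintegralZl//; first by rewrite mulrA; congr (_ * _); rewrite mul1r mulrC.
  by apply: (kern_int d0 adm k (between_dominated _ _ _ _ _ (clip_between hr))).
- apply: (@eq_measurable_fun _ _ _ _ I (fun y => 2 * soliton_kern d (k, y) * rho y)).
    by move=> y; rewrite inE IE => /andP[y0 _]; rewrite zeta_kernel.
  apply: measurable_funM; last exact: inA_measurable.
  by apply: (measurable_funS (E := setT)) => //; exact: measurable_funM.
- by apply: measurable_funM => //; apply: measurable_funM => //; exact: measurable_clip.
- have := clip_interior hr; apply: ae_lebesgueS => y hy yI.
  have y0 : 0 < y by move: yI; rewrite IE => /andP[].
  by rewrite zeta_kernel// hy// mulrA.
- by move=> y yI; rewrite clip_out// !mulr0.
Qed.

Lemma Phi_clip rho k : inA d u0 xmax rho -> I k ->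
  Phi d u0 xmax x t rho k = denergy field_V L (clip rho) k.
Proof.
by move=> hr kI; rewrite /Phi /denergy Lop_clip// /field_V patchE mem_set.
Qed.

Lemma Efun_clip rho : inA d u0 xmax rho ->
  Efun d u0 xmax x t rho = energy leb field_V L (clip rho).
Proof.
move=> hr; have mV := measurable_field_V; have mc := measurable_clip hr.
have mL : measurable_fun setT (L (clip rho)) := measurable_weyl_op d u0 xmax mc.
have mW : measurable_fun setT (fun k => field_V k + 1 / 2 * L (clip rho) k).
  by apply: measurable_funD => //; exact: measurable_funM.
have VE k : I k -> Vfn d u0 xmax x t k + 1 / 2 * Lop d u0 xmax rho (zeta d k) =
    field_V k + 1 / 2 * L (clip rho) k.
  by move=> kI; rewrite Lop_clip// /field_V patchE mem_set.
rewrite /Efun /energy; apply: Rintegral_patch.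
- apply: (@eq_measurable_fun _ _ _ _ I (fun k => (field_V k + 1 / 2 * L (clip rho) k) * rho k)).
    by move=> k; rewrite inE => kI; rewrite VE.
  apply: measurable_funM; last exact: inA_measurable.
  exact: (measurable_funS (E := setT)).
- exact: measurable_funM.
- by have := clip_interior hr; apply: ae_lebesgueS => k hk kI; rewrite VE// hk.
- by move=> k kI; rewrite clip_out// mulr0.
Qed.

Let cl := log_cst d u0 xmax / 2.
Let gi : leb.-integrable setT (EFin \o g) := weyl_g_int d0 adm.

Lemma weyl_minimizer : exists2 r, between g r &
  forall s, between g s -> energy leb field_V L r <= energy leb field_V L s.
Proof.
exact: (minimizer_ex _ _ _ leb g field_V L field_bound (2 / pi * cl) gi g_ge0
  measurable_field_V field_V_bound (fun r dr => measurable_weyl_op d u0 xmax dr.1)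
  (weyl_op_lin d0 adm) (weyl_op_bound d0 adm) (weyl_op_cvg d0 adm) (weyl_op_sym d0 adm)
  (weyl_op_pos d0 adm)).
Qed.

Lemma weyl_minimizer_kkt r : between g r ->
  (forall s, between g s -> energy leb field_V L r <= energy leb field_V L s) ->
  kkt leb g field_V L r.
Proof.
exact: (minimizer_kkt _ _ _ leb g field_V L field_bound (2 / pi * cl) gi g_ge0
  measurable_field_V field_V_bound (fun r dr => measurable_weyl_op d u0 xmax dr.1)
  (weyl_op_lin d0 adm) (weyl_op_bound d0 adm) (weyl_op_sym d0 adm) (weyl_op_pos d0 adm) r).
Qed.

Lemma weyl_minimizer_unique r s : between g r -> between g s ->
  kkt leb g field_V L r ->
  energy leb field_V L s <= energy leb field_V L r -> {ae leb, forall k, s k = r k}.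
Proof.
exact: (minimizer_unique _ _ _ leb g field_V L field_bound (2 / pi * cl) gi g_ge0
  measurable_field_V field_V_bound (fun r dr => measurable_weyl_op d u0 xmax dr.1)
  (weyl_op_lin d0 adm) (weyl_op_bound d0 adm) (weyl_op_sym d0 adm) (weyl_op_pos d0 adm)
  (weyl_op_def d0 adm) r s).
Qed.

Lemma weyl_kkt_minimizer r s : between g r -> between g s ->
  kkt leb g field_V L r -> energy leb field_V L r <= energy leb field_V L s.
Proof.
exact: (kkt_minimizer _ _ _ leb g field_V L field_bound (2 / pi * cl) gi g_ge0
  measurable_field_V field_V_bound (fun r dr => measurable_weyl_op d u0 xmax dr.1)
  (weyl_op_lin d0 adm) (weyl_op_bound d0 adm) (weyl_op_sym d0 adm) (weyl_op_pos d0 adm) r s).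
Qed.

(** This is [weyl_op_cvg] for a constant sequence: changing a competitor on a null set does not
    change the operator at any point. *)
Lemma weyl_op_ae r s : between g r -> between g s ->
  {ae leb, forall k, r k = s k} -> forall k, L r k = L s k.
Proof.
move=> br bs rs k.
have := @weyl_op_cvg _ _ _ _ d0 adm (fun=> r) s (fun=> br) bs _ k.
have rcs : {ae leb, forall y, (fun _ : nat => r y) n @[n --> \oo] --> s y}.
  by move: rs; apply: ae_lebesgueS => y ->; exact: cvg_cst.
move=> /(_ rcs) h; apply: (cvg_unique _ (cvg_cst _) h); exact: Rhausdorff.
Qed.

End weyl_constraint.

Theorem mainTheorem9 (R : realType) (d : R) (u0 : R -> R) (xmax x t : R) :
  0 < d -> admissible u0 xmax ->
  exists rmin : R -> R,
    inA d u0 xmax rmin /\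
    (forall rho, inA d u0 xmax rho -> Efun d u0 xmax x t rmin <= Efun d u0 xmax x t rho) /\
    (forall rho, inA d u0 xmax rho ->
       (forall rho', inA d u0 xmax rho' -> Efun d u0 xmax x t rho <= Efun d u0 xmax x t rho') ->
       ae_eq_on d u0 xmax rho rmin) /\
    (forall rho, inA d u0 xmax rho ->
       (ae_eq_on d u0 xmax rho rmin <->
        {ae (@lebesgue_measure R), forall k, 0 <= k <= kappa_max d (u0 xmax) ->
           (0 < Phi d u0 xmax x t rho k -> rho k = 0) /\
           (Phi d u0 xmax x t rho k < 0 -> rho k = rhoWyl d u0 xmax k) /\
           (Phi d u0 xmax x t rho k = 0 -> 0 <= rho k <= rhoWyl d u0 xmax k)})).
Proof.
move=> d0 adm.
set km := kappa_max d (u0 xmax); set g := weyl_g d u0 xmax; set leb := @lebesgue_measure R.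
pose I : set R := `]0, km[%classic; have IE k : I k = (0 < k < km) :> Prop by rewrite /I /= in_itv.
set L := weyl_op d u0 xmax; set V := field_V d u0 xmax x t.
have [r br rmin] := weyl_minimizer x t d0 adm.
have kr := weyl_minimizer_kkt d0 adm br rmin.
have Ar := between_inA d0 adm br.
have Er : Efun d u0 xmax x t r = energy leb V L r by rewrite (Efun_clip x t d0 adm)// clip_id.
(* Uniqueness holds for clipped functions and is carried back through [ae_clip]. *)
have uniq rho : inA d u0 xmax rho ->
    energy leb V L (clip d u0 xmax rho) <= energy leb V L r ->
    ae_eq_on d u0 xmax rho r.
  move=> hr he; have := weyl_minimizer_unique d0 adm br (clip_between d0 adm hr) kr he.
  move=> /(ae_lebesgueI (ae_clip d0 adm hr)); apply: ae_lebesgueS => k [h1 h2] kk.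
  by have [_ -> _] := h1 kk.
exists r; split => //; split; last split.
- by move=> rho hr; rewrite Er (Efun_clip x t d0 adm)// rmin//; exact: (clip_between d0 adm).
- by move=> rho hr hm; apply: uniq => //; rewrite -Er -(Efun_clip x t d0 adm)// hm.
move=> rho hr; have bc := clip_between d0 adm hr; split => [rr|hk].
  have cr : {ae leb, forall k, clip d u0 xmax rho k = r k}.
    move: (ae_lebesgueI (ae_clip d0 adm hr) rr); apply: ae_lebesgueS => k [h1 h2].
    have [kI|kI] := pselect (I k).
      have kk : 0 <= k <= km by move: kI; rewrite IE => /andP[? ?]; rewrite !ltW.
      by have [_ <- _] := h1 kk; exact: h2.
    by rewrite clip_out// -(clip_id br) clip_out.
  (* [Phi] sees [rho] only through an integral, so on the interior it agrees everywhere with the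
     first variation at [r], and the sign conditions of [r] transfer. *)
  have Lr := weyl_op_ae d0 adm bc br cr.
  have [_ hr'] := hr.
  move: (ae_lebesgueI (ae_lebesgueI (ae_clip d0 adm hr) cr) (ae_lebesgueI kr hr')).
  apply: ae_lebesgueS => k [[h1 h2] [[h3 h4] h5]] kk.
  have [kI rk gk] := h1 kk.
  have PE : Phi d u0 xmax x t rho k = denergy V L r k.
    by rewrite (Phi_clip x t d0 adm)// /denergy Lr.
  rewrite PE gk; split; first by move=> /h3; rewrite rk h2.
  split; first by move=> /h4; rewrite rk h2.
  by move=> _; rewrite -gk; exact: h5.
(* Conversely, the sign conditions make the clip of [rho] a minimizer, so its energy is at most that
   of [r]. *)
apply: uniq => //; apply: (weyl_kkt_minimizer d0 adm) => //.
move: (ae_lebesgueI (ae_clip d0 adm hr) hk); apply: ae_lebesgueS => k [h1 h2].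
have [kI|kI] := pselect (I k); last first.
  rewrite clip_out// /g weyl_g_out//; by apply/negP => h; apply: kI.
have kk : 0 <= k <= km by move: kI; rewrite IE => /andP[? ?]; rewrite !ltW.
have [_ rk gk] := h1 kk; have [h3 [h4 _]] := h2 kk.
move: h3 h4; rewrite (Phi_clip x t d0 adm hr kI) rk gk => h3 h4.
by split; [exact: h3|exact: h4].
Qed.
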